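(* Let $A>0$, $\gamma>1$, $0<\delta<1$, $\alpha>0$, $\alpha+\beta\ge0$ and $\epsilon\ge0$. Assume that $0<m(0)<\infty$ and $|\mathbb{P}(0)|>0$. Then there is no global regular solution $(\rho^\epsilon,u^\epsilon)$ (of the Euler Cauchy problem if $\epsilon=0$, of the Navier-Stokes Cauchy problem with far-field vacuum if $\epsilon>0$) satisfying $$\limsup_{t\to\infty}|u^\epsilon(t,\cdot)|_\infty=0.$$
   Context: Notation: all spaces are over $\mathbb{R}^3$; $|f|_q=\|f\|_{L^q}$; $D^2=\{f\in L^1_{\rm loc}:|\nabla^2f|_2<\infty\}$. $m(t)=\int\rho^\epsilon(t,x)\,dx$ is the total mass and $\mathbb{P}(t)=\int(\rho^\epsilon u^\epsilon)(t,x)\,dx$ the total momentum (integrals over $\mathbb{R}^3$). The local sound speed is $c^\epsilon=\sqrt{A\gamma}(\rho^\epsilon)^{(\gamma-1)/2}$. Equations: $$\rho^\epsilon_t+\mathrm{div}(\rho^\epsilon u^\epsilon)=0,\qquad (\rho^\epsilon u^\epsilon)_t+\mathrm{div}(\rho^\epsilon u^\epsilon\otimes u^\epsilon)+\nabla p(\rho^\epsilon)=\epsilon\,\mathrm{div}\,\mathbb{T}(\rho^\epsilon,\nabla u^\epsilon),$$ with $p(\rho)=A\rho^\gamma$ and $\mathbb{T}(\rho,\nabla u)=\alpha\rho^\delta(\nabla u+(\nabla u)^\top)+\beta\rho^\delta\,\mathrm{div}u\,\mathbb{I}_3$, and prescribed initial data $(\rho_0^\epsilon,u_0^\epsilon)$.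 For $\epsilon=0$ these are the Euler equations; for $\epsilon>0$ the Navier-Stokes equations, considered with $\rho_0^\epsilon>0$ and $(\rho_0^\epsilon,u_0^\epsilon)(x)\to(0,0)$ as $|x|\to\infty$. Regular solution for $\epsilon>0$ in $[0,T]\times\mathbb{R}^3$: a weak solution in the sense of distributions such that (i) $\rho^\epsilon>0$, $c^\epsilon\in C([0,T];H^3)$, $\nabla(\rho^\epsilon)^{\frac{\delta-1}{2}}\in C([0,T];L^\infty\cap D^2)$; (ii) $u^\epsilon\in C([0,T];H^3_{\rm loc})\cap L^\infty([0,T];H^3)$, $(\rho^\epsilon)^{\frac{1-\delta}{2}}u^\epsilon\in C([0,T];H^3)$, $(\rho^\epsilon)^{\frac{\delta-1}{2}}\nabla u^\epsilon\in L^2([0,T];H^3)$, $(\rho^\epsilon)^{\frac{1-\delta}{2}}u^\epsilon_t\in L^\infty([0,T];H^1)\cap L^2([0,T];H^2)$. Regular solution for $\epsilon=0$ in $[0,T]\times\mathbb{R}^3$ (in the sense of Makino-Ukai-Kawashima), writing $(\rho,u,c)$: $(\rho,u)$ satisfies the Euler Cauchy problem in the sense of distributions; $\rho\ge0$ and $(c,u)\in C^1([0,T]\times\mathbb{R}^3)$; $u_t+u\cdot\nabla u=0$ when $\rho(t,x)=0$; and $(c,u)\in C([0,T];H^3)$, $(c_t,u_t)\in C([0,T];H^2)$. A global regular solution is a pair defined on $[0,\infty)\times\mathbb{R}^3$ that is a regular solution in $[0,T]\times\mathbb{R}^3$ for every $T>0$. *)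

(* Defs.v *)
From HB Require Import structures.
From mathcomp Require Import all_boot all_order all_algebra.
From mathcomp Require Import all_classical all_reals all_analysis.

Set Implicit Arguments.
Unset Strict Implicit.
Unset Printing Implicit Defensive.

Import Order.TTheory GRing.Theory Num.Theory.
Import numFieldNormedType.Exports.

Local Open Scope classical_set_scope.
Local Open Scope ring_scope.

(* Space-time functions are curried, [f t x] with [t : R] and [x : space3 R], so
   that [f t] is the spatial profile at time [t].  Only the values at
   nonnegative times matter.  The library's norm on [space3 R] is the sup norm,
   so its balls are cubes. *)
Notation space3 R := (R * R * R)%type (only parsing).

Section Space.
Variable R : realType.
Local Notation E := (space3 R).

Definition leb1 :=
  [the {sigma_finite_measure set (measurableTypeR R) -> \bar R} of
   @lebesgue_measure R].

Definition leb3 : {measure set (measurableTypeR R * measurableTypeR R *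
    measurableTypeR R)%type -> \bar R} :=
  [the measure _ _ of ((leb1 \x leb1) \x leb1)%E].

Definition basis3 (i : 'I_3) : E :=
  ((val i == 0%N)%:R, (val i == 1%N)%:R, (val i == 2%N)%:R).

Definition enorm3 (v : 'I_3 -> R) : R := Num.sqrt (\sum_(i < 3) v i ^+ 2).

(* On a finite dimensional space this is [C^n], resp. [C^oo]: continuity of all
   iterated directional derivatives. *)
Fixpoint Ck (V : normedModType R) (n : nat) (f : V -> R) : Prop :=
  if n is m.+1 then
    continuous f /\
    forall v : V, (forall x, derivable f x v) /\ Ck m (fun x => 'D_v f x)
  else continuous f.

Definition smooth (V : normedModType R) (f : V -> R) : Prop :=
  forall n, Ck n f.

Definition test_function (V : normedModType R) (Om : set V) (phi : V -> R) :
    Prop :=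
  smooth phi /\
  exists K : set V,
    [/\ compact K, K `<=` Om & forall x, ~ K x -> phi x = 0].

Definition iterD (l : seq 'I_3) (phi : E -> R) : E -> R :=
  foldr (fun i (h : E -> R) => fun x => 'D_(basis3 i) h x) phi l.

Definition loc_integrable (Om : set E) (f : E -> R) : Prop :=
  forall K : set E, compact K -> K `<=` Om -> leb3.-integrable K (EFin \o f).

(* [l] lists the directions of differentiation; [is_wderiv Om [::] f g] says
   that [f] and [g] are locally integrable and agree almost everywhere. *)
Definition is_wderiv (Om : set E) (l : seq 'I_3) (f g : E -> R) : Prop :=
  [/\ loc_integrable Om f, loc_integrable Om g &
   forall phi : E -> R, test_function Om phi ->
     \int[leb3]_(x in Om) (f x * iterD l phi x) =
     (-1) ^+ size l * \int[leb3]_(x in Om) (g x * phi x)].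

(* Weak derivative on the whole space, unique almost everywhere when it exists;
   the junk value [0] is excluded by the hypotheses wherever it is used. *)
Definition wderiv (l : seq 'I_3) (f : E -> R) : E -> R :=
  xget (fun=> 0) [set g | is_wderiv setT l f g].

(* A space of functions of [x] is represented by its norm, extended by [+oo]
   to the functions which are not in the space.  In particular the norm of a
   missing weak derivative is [+oo], the infimum of the empty set; otherwise
   the infimum runs over representatives of one and the same class. *)
Definition wderiv_norm2 (Om : set E) (l : seq 'I_3) (f : E -> R) : \bar R :=
  ereal_inf [set Lnorm leb3 2%:E (EFin \o (g \_ Om)) | g in is_wderiv Om l f].

Definition sobolev_norm (Om : set E) (k : nat) (f : E -> R) : \bar R :=
  (\sum_(j < k.+1) \sum_(l : j.-tuple 'I_3) wderiv_norm2 Om l f)%E.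

Definition Hk_norm (k : nat) : (E -> R) -> \bar R := sobolev_norm setT k.

Definition LinftyD2_norm (f : E -> R) : \bar R :=
  (Lnorm leb3 +oo (EFin \o f) +
   \sum_(l : 2.-tuple 'I_3) wderiv_norm2 setT l f)%E.

Definition C_in (N : (E -> R) -> \bar R) (T : R) (f : R -> E -> R) : Prop :=
  forall t, t \in `[0, T] ->
    (N (f t) < +oo)%E /\
    (N (f s \- f t)) @[s --> within `[0, T]%classic (nbhs t)] --> 0%E.

Definition C_in_Hloc (k : nat) (T : R) (f : R -> E -> R) : Prop :=
  forall r : R, 0 < r -> C_in (sobolev_norm (ball (0 : E) r) k) T f.

(* Lebesgue-Bochner spaces over [0, T] *)
Definition simple_in (N : (E -> R) -> \bar R) (s : R -> E -> R) : Prop :=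
  exists (m : nat) (A : 'I_m -> set R) (g : 'I_m -> E -> R),
    (forall k, measurable (A k) /\ (N (g k) < +oo)%E) /\
    forall t x, s t x = \sum_(k < m) \1_(A k) t * g k x.

Definition strongly_measurable (N : (E -> R) -> \bar R) (T : R)
    (f : R -> E -> R) : Prop :=
  exists s : nat -> R -> E -> R,
    (forall n, simple_in N (s n)) /\
    {ae leb1, forall t, t \in `[0, T] ->
      (N (s n t \- f t)) @[n --> \oo] --> 0%E}.

Definition Lp_in (p : \bar R) (N : (E -> R) -> \bar R) (T : R)
    (f : R -> E -> R) : Prop :=
  strongly_measurable N T f /\
  (Lnorm leb1 p ((fun t => N (f t)) \_ `[0%R, T]%classic) < +oo)%E.

End Space.

Section Equations.
Variable R : realType.
Local Notation E := (space3 R).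
Variables (A gam del alp bet eps : R).
Variables (rho0 : E -> R) (u0 : 'I_3 -> E -> R).
Variables (rho : R -> E -> R) (u : R -> 'I_3 -> E -> R).

Definition total_mass (r : E -> R) : \bar R := (\int[leb3 R]_x (r x)%:E)%E.

Definition total_momentum (r : E -> R) (v : 'I_3 -> E -> R) (i : 'I_3) : R :=
  \int[leb3 R]_x (r x * v i x).

Definition pressure (r : R) : R := A * r `^ gam.

Definition sound_speed (t : R) (x : E) : R :=
  Num.sqrt (A * gam) * rho t x `^ ((gam - 1) / 2).

Definition grad_u (t : R) (i j : 'I_3) : E -> R := wderiv [:: j] (u t i).

Definition stress (t : R) (i j : 'I_3) (x : E) : R :=
  alp * rho t x `^ del * (grad_u t i j x + grad_u t j i x) +
  bet * rho t x `^ del * (\sum_(k < 3) grad_u t k k x) * (i == j)%:R.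

Definition d_t (phi : R * E -> R) (t : R) (x : E) : R := 'D_(1, 0) phi (t, x).

Definition d_x (j : 'I_3) (phi : R * E -> R) (t : R) (x : E) : R :=
  'D_(0, basis3 R j) phi (t, x).

Definition strip (T : R) : set (R * E) := [set p | p.1 < T].

Definition open_strip (T : R) : set (R * E) := [set p | 0 < p.1 < T].

(* The test functions are restrictions to nonnegative times of test functions
   on the strip t < T; they need not vanish at t = 0, so that the equations
   also encode the initial data.  The pairings are iterated integrals, hence
   independent of the representative chosen for the spatial profile at each
   time. *)
Definition continuity_eq (T : R) : Prop :=
  forall phi : R * E -> R, test_function (strip T) phi ->
    \int[leb1 R]_(t in `[0, T]%classic) \int[leb3 R]_x
      (rho t x * d_t phi t x + \sum_(j < 3) rho t x * u t j x * d_x j phi t x)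
    + \int[leb3 R]_x (rho0 x * phi (0, x)) = 0.

Definition momentum_eq (T : R) : Prop :=
  forall (i : 'I_3) (phi : R * E -> R), test_function (strip T) phi ->
    \int[leb1 R]_(t in `[0, T]%classic) \int[leb3 R]_x
      (rho t x * u t i x * d_t phi t x
       + \sum_(j < 3) rho t x * u t i x * u t j x * d_x j phi t x
       + pressure (rho t x) * d_x i phi t x
       - eps * \sum_(j < 3) stress t i j x * d_x j phi t x)
    + \int[leb3 R]_x (rho0 x * u0 i x * phi (0, x)) = 0.

Definition weak_solution (T : R) : Prop :=
  [/\ rho 0 = rho0, u 0 = u0, continuity_eq T & momentum_eq T].

Definition is_weak_dt (T : R) (f ft : R -> E -> R) : Prop :=
  forall phi : R * E -> R, test_function (open_strip T) phi ->
    \int[leb1 R]_(t in `[0, T]%classic) \int[leb3 R]_x (f t x * d_t phi t x) =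
    - \int[leb1 R]_(t in `[0, T]%classic) \int[leb3 R]_x (ft t x * phi (t, x)).

Definition ns_regular (T : R) : Prop :=
  [/\ weak_solution T,
   [/\ forall t x, t \in `[0, T] -> 0 < rho t x,
       C_in (@Hk_norm R 3) T sound_speed,
       forall t i, t \in `[0, T] -> exists g,
         is_wderiv setT [:: i] (fun x => rho t x `^ ((del - 1) / 2)) g &
       forall i, C_in (@LinftyD2_norm R) T
         (fun t => wderiv [:: i] (fun x => rho t x `^ ((del - 1) / 2)))] &
   [/\ forall i, C_in_Hloc 3 T (fun t => u t i) /\
                 Lp_in +oo (@Hk_norm R 3) T (fun t => u t i),
       forall i, C_in (@Hk_norm R 3) T
         (fun t x => rho t x `^ ((1 - del) / 2) * u t i x),
       forall i j, Lp_in 2%:E (@Hk_norm R 3) T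
         (fun t x => rho t x `^ ((del - 1) / 2) * grad_u t i j x) &
       exists ut : R -> 'I_3 -> E -> R, forall i,
         let w := fun t x => rho t x `^ ((1 - del) / 2) * ut t i x in
         [/\ is_weak_dt T (fun t => u t i) (fun t => ut t i),
             Lp_in +oo (@Hk_norm R 1) T w & Lp_in 2%:E (@Hk_norm R 2) T w]]].

Definition continuous_on (T : R) (f : R -> E -> R) : Prop :=
  {within `[0, T]%classic `*` setT, continuous (fun p : R * E => f p.1 p.2)}.

(* [C^1] on the closed slab: [ft] and [fx] are the partial derivatives, that
   of time being required in the open slab only; by continuity it is then the
   one-sided one at both ends. *)
Definition C1_with (T : R) (f ft : R -> E -> R) (fx : 'I_3 -> R -> E -> R) :
    Prop :=
  [/\ continuous_on T f, continuous_on T ft,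
      forall j, continuous_on T (fx j),
      forall t x, t \in `]0, T[ -> is_derive t 1 (fun s => f s x) (ft t x) &
      forall j t x, t \in `[0, T] -> is_derive x (basis3 R j) (f t) (fx j t x)].

Definition euler_regular (T : R) : Prop :=
  [/\ weak_solution T,
      forall t x, t \in `[0, T] -> 0 <= rho t x &
   exists (ct : R -> E -> R) (cx : 'I_3 -> R -> E -> R)
          (ut : 'I_3 -> R -> E -> R) (ux : 'I_3 -> 'I_3 -> R -> E -> R),
   [/\ C1_with T sound_speed ct cx /\
       (forall i, C1_with T (fun t => u t i) (ut i) (ux i)),
       forall t x i, t \in `[0, T] -> rho t x = 0 ->
         ut i t x + \sum_(j < 3) u t j x * ux i j t x = 0,
       C_in (@Hk_norm R 3) T sound_speed /\
       (forall i, C_in (@Hk_norm R 3) T (fun t => u t i)) &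
       C_in (@Hk_norm R 2) T ct /\ (forall i, C_in (@Hk_norm R 2) T (ut i))]].

Definition regular_solution (T : R) : Prop :=
  if eps == 0 then euler_regular T else ns_regular T.

Definition global_regular_solution : Prop :=
  forall T : R, 0 < T -> regular_solution T.

Definition vanishes_at_infinity (f : E -> R) : Prop :=
  forall e : R, 0 < e -> exists M : R, forall x, M < `|x| -> `|f x| < e.

Definition far_field_vacuum_data : Prop :=
  [/\ forall x, 0 < rho0 x, vanishes_at_infinity rho0 &
      forall i, vanishes_at_infinity (u0 i)].

Definition sup_norm (v : 'I_3 -> E -> R) : \bar R :=
  Lnorm (leb3 R) +oo (fun x => (enorm3 (fun i => v i x))%:E).

End Equations.

(* Main.v *)
Require Import Defs.
From HB Require Import structures.
From mathcomp Require Import all_boot all_order all_algebra.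
From mathcomp Require Import all_classical all_reals all_analysis.
From mathcomp Require Import measurable_realfun ess_sup_inf.
From mathcomp Require Import ring lra.

(** Total momentum is conserved and total mass does not grow, so a velocity
    which is uniformly small forces a small momentum: |u(t)| <= d gives
    |P(0)| = |P(t)| <= d m(0), and d is arbitrary when the velocity vanishes in
    the limit.  Both statements come from the weak equations, tested with explicit
    cutoffs of the whole space.

    Mass ([mass_le]).  The continuity equation is tested with a window that
    closes in at a speed V >= |u|.  Its transport derivative phi_t + u . grad phi
    is then nonpositive, up to the ramp that switches it off in time
    ([spacetime_test_transport]); hence the mass of a cube at time t is at most
    the mass of a larger cube at time 0.

    Momentum ([momentum_le]).  The momentum equation is tested with
    eta(t) w(x / R), where eta falls from 1 to 0 on a time interval on which
    |u| <= d.  The term with eta' is at most d m(0).  All the other terms carry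
    grad w(x / R) = O(1 / R) and are integrable ([flux_le]): rho u u and p(rho)
    are bounded multiples of rho, and for the viscous stress
    rho^del grad u = rho^((1 + del) / 2) f with f = rho^((del - 1) / 2) grad u in
    L^2, so that Young's inequality leaves rho^(1 + del) + f^2
    ([weighted_young], [viscous_stress_bound]).  Then R tends to infinity.

    The pointwise bounds on rho and u come from the embedding of H^3 in L^oo
    ([sobolev]).  The average of f over a box is approached by its pairings with
    products of three smooth plateaus of one variable.  Each plateau is k - j'
    with k and j bounded by a multiple of the length of its interval and
    supported in an interval of length 1 ([plateau_decomp]).  Expanding, and
    moving the derivatives onto f, one is left with pairings of weak derivatives
    of f, at most one in each variable, with functions of size O(volume of the
    box); so the averages of f are bounded, and Lebesgue's differentiation
    theorem on the line, carried to products by [detectingX], bounds f.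

    The weak formulation pairs profiles that need not depend measurably on time.
    The integral of a nonnegative function is the supremum of the integrals of
    the simple functions below it, and this is monotone without measurability;
    majorants that are measurable in time are therefore enough
    ([Rintegral_le_ae], [L2_in_time_majorant]). *)

Set Implicit Arguments.
Unset Strict Implicit.
Unset Printing Implicit Defensive.

Import Order.TTheory GRing.Theory Num.Theory.
Import numFieldNormedType.Exports.

Local Open Scope classical_set_scope.
Local Open Scope ring_scope.

(** * Smooth functions and a smooth step *)

Section CkCalculus.
Variable R : realType.
Implicit Types V W : normedModType R.

Lemma Ck_continuous V n (f : V -> R) : Ck n f -> continuous f.
Proof. by case: n => [//|n []]. Qed.

(** Lets the derivatives be given in closed form, so that inductions on the
    order of smoothness never unfold ['D_v f]. *)
Lemma CkS_is_derive V n (f : V -> R) (df : V -> V -> R) :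
  continuous f -> (forall x v, is_derive x v f (df v x)) ->
  (forall v, Ck n (df v)) -> Ck n.+1 f.
Proof.
move=> cf dfE Cdf; split => // v; split => [x|]; first exact: ex_derive.
suff -> : (fun x => 'D_v f x) = df v by [].
by apply/funext => x; exact: derive_val.
Qed.

Lemma CkW V n (f : V -> R) : Ck n.+1 f -> Ck n f.
Proof.
elim: n f => [|n IH] f; first by case.
move=> [cf Df]; split => // v; have [dv Cv] := Df v; split => //.
exact: IH.
Qed.

Lemma Ck_cst V n (c : R) : Ck n (fun _ : V => c).
Proof.
elim: n c => [|n IH] c; first exact: cst_continuous.
apply: (@CkS_is_derive _ _ _ (fun _ _ => 0)) => //; exact: cst_continuous.
Qed.

Lemma CkD V n (f g : V -> R) : Ck n f -> Ck n g -> Ck n (fun x => f x + g x).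
Proof.
elim: n f g => [|n IH] f g Cf Cg.
  by move=> x; apply: continuousD; [exact: Cf|exact: Cg].
have [cf Df] := Cf; have [cg Dg] := Cg.
apply: (@CkS_is_derive _ _ _ (fun v x => 'D_v f x + 'D_v g x)).
- by move=> x; apply: continuousD; [exact: cf|exact: cg].
- move=> x v; have [/(_ x) df _] := Df v; have [/(_ x) dg _] := Dg v.
  by apply: is_deriveD; exact/derivableP.
- by move=> v; apply: IH; [exact: (Df v).2|exact: (Dg v).2].
Qed.

Lemma CkM V n (f g : V -> R) : Ck n f -> Ck n g -> Ck n (fun x => f x * g x).
Proof.
elim: n f g => [|n IH] f g Cf Cg.
  by move=> x; apply: continuousM; [exact: Cf|exact: Cg].
have [cf Df] := Cf; have [cg Dg] := Cg.
apply: (@CkS_is_derive _ _ _ (fun v x => f x * 'D_v g x + g x * 'D_v f x)).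
- by move=> x; apply: continuousM; [exact: cf|exact: cg].
- move=> x v; have [/(_ x) df _] := Df v; have [/(_ x) dg _] := Dg v.
  exact: (is_deriveM (derivableP df) (derivableP dg)).
- move=> v; apply: CkD; apply: IH; try exact: CkW.
    exact: (Dg v).2.
  exact: (Df v).2.
Qed.

(** The difference quotient of [h \o l] in the direction [v] is that of [h] in
    the direction [L v], so that the directional derivative of [h] suffices. *)
Lemma is_derive_comp_affine V W (l L : V -> W) (h : W -> R) x v :
  (forall t x v, l (t *: v + x) = t *: L v + l x) ->
  derivable h (l x) (L v) ->
  is_derive x v (h \o l) ('D_(L v) h (l x)).
Proof.
move=> lE dh.
have E : (fun t : R => t^-1 *: (((h \o l) \o shift x) (t *: v) - (h \o l) x)) =
         (fun t => t^-1 *: ((h \o shift (l x)) (t *: L v) - h (l x))).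
  by apply/funext => t /=; rewrite lE.
by split; [rewrite /derivable E|rewrite /derive E].
Qed.

Lemma Ck_comp_affine V W (l L : V -> W) n (h : W -> R) :
  (forall t x v, l (t *: v + x) = t *: L v + l x) -> continuous l ->
  Ck n h -> Ck n (h \o l).
Proof.
move=> lE cl; elim: n h => [|n IH] h Ch.
  by move=> x; apply: continuous_comp; [exact: cl|exact: Ch].
have [ch Dh] := Ch.
apply: (@CkS_is_derive _ _ _ (fun v => (fun y => 'D_(L v) h y) \o l)).
- by move=> x; apply: continuous_comp; [exact: cl|exact: ch].
- by move=> x v; apply: is_derive_comp_affine => //; exact: (Dh (L v)).1.
- by move=> v; apply: IH; exact: (Dh (L v)).2.
Qed.

Lemma is_derive_scale_dir (f : R -> R) (x v df : R) :
  is_derive x 1 f df -> is_derive x v f (v * df).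
Proof.
move=> [df1 dfE].
have fd : differentiable f x by exact/derivable1_diffP.
have E : 'D_v f x = v * df.
  rewrite deriveE// -dfE deriveE// -[v in LHS]mulr1.
  by rewrite -[v * 1]/(v *: (1 : R^o)) linearZ.
by rewrite -E; apply/derivableP; exact: diff_derivable.
Qed.

Lemma CkS1 n (f f' : R -> R) :
  (forall x : R, is_derive x 1 f (f' x)) -> Ck n f' -> Ck n.+1 f.
Proof.
move=> df Cf'; refine (@CkS_is_derive R n f (fun v x : R => v * f' x) _ _ _).
- move=> x; apply: differentiable_continuous; apply/derivable1_diffP.
  exact: ex_derive.
- by move=> x v; exact: is_derive_scale_dir.
- by move=> v; apply: CkM => //; exact: Ck_cst.
Qed.

Lemma Ck_derive1 n (f f' : R -> R) :
  (forall x : R, is_derive x 1 f (f' x)) -> Ck n.+1 f -> Ck n f'.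
Proof.
move=> df [_ /(_ 1)[_]]; congr Ck; apply/funext => x; exact: derive_val.
Qed.

End CkCalculus.

Section Bump.
Variable R : realType.

(** The functions x^(-k) exp(-1 / x) on the positive half-line form a family
    that is closed under differentiation, which makes them smooth at 0. *)
Definition flat (k : nat) (x : R) : R :=
  if 0 < x then x^-1 ^+ k * expR (- x^-1) else 0.

(** From exp(y) >= y^(k+1) / (k+1)! at y = 1 / x.  Applied to the quotient
    [flat k h / h = flat k.+1 h], it gives the derivative at 0. *)
Lemma flat_le k (x : R) : flat k x <= k.+1`!%:R * `|x|.
Proof.
rewrite /flat; case: ifPn => x0; last by rewrite mulr_ge0.
rewrite gtr0_norm// expRN.
have y0 : 0 < x^-1 by rewrite invr_gt0.
have := expR_ge1Dxn k (ltW y0).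
set e := expR _ => he.
have e0 : 0 < e by exact: expR_gt0.
have f0 : 0 < (k.+1)`!%:R :> R by rewrite ltr0n fact_gt0.
have h : x^-1 ^+ k.+1 <= e * (k.+1)`!%:R.
  rewrite -ler_pdivrMr//; apply: le_trans he; by rewrite lerDr.
rewrite ler_pdivrMr//.
rewrite -(ler_pM2l y0) -exprS (le_trans h)// le_eqVlt; apply/orP; left.
by apply/eqP; field; rewrite gt_eqF.
Qed.

Lemma flat_ge0 k x : 0 <= flat k x.
Proof.
rewrite /flat; case: ifPn => // x0.
by rewrite mulr_ge0// ?expR_ge0// exprn_ge0// invr_ge0 ltW.
Qed.

Lemma flat_gt0 x : 0 < x -> 0 < flat 0 x.
Proof. by move=> x0; rewrite /flat x0 mulr_gt0// ?expR_gt0. Qed.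

Lemma flat_npos k x : x <= 0 -> flat k x = 0.
Proof. by rewrite leNgt /flat => /negbTE ->. Qed.

Lemma is_derive_flat k (x : R) :
  is_derive x 1 (flat k) (flat k.+2 x - k%:R * flat k.+1 x).
Proof.
have [x0|x0|->] := ltgtP x 0.
- rewrite !flat_npos ?ltW// mulr0 subr0.
  have : is_derive x 1 (fun _ : R => 0 : R) 0 by exact: is_derive_cst.
  apply: near_eq_is_derive.
  by near=> y; rewrite flat_npos// ltW//; near: y; exact: lt_nbhsl.
- apply: (@near_eq_is_derive _ _ _ (fun y : R => (y^-1) ^+ k * expR (- y^-1))).
  + near=> y; rewrite /flat ifT//; near: y; exact: lt_nbhsr.
  rewrite /flat x0.
  have xn0 : x != 0 by rewrite gt_eqF.
  have dV : is_derive x 1 (fun y : R => y^-1) (- x ^- 2).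
    apply: DeriveDef; first by apply: derivableV => //; exact: derivable_id.
    rewrite (@deriveV _ _ (fun y : R => y))// derive_id.
    by rewrite [LHS]mulr1.
  have dE : is_derive x 1 (fun y : R => expR (- y^-1)) (expR (- x^-1) * x ^- 2).
    have dN : is_derive x 1 (fun y : R => - y^-1) (x ^- 2).
      by rewrite -[x ^- 2]opprK; exact: is_deriveN.
    exact: (@is_derive1_comp _ expR (fun y => - y^-1) x).
  have dX : is_derive x 1 (fun y : R => y^-1 ^+ k) ((k%:R * x^-1 ^+ k.-1) *: - x ^- 2).
    have := @is_deriveX _ _ (fun y : R => y^-1) k x 1 _ dV.
    by rewrite exprfctE.
  apply: (@is_derive_eq _ _ _ (fun y : R => y^-1 ^+ k * expR (- y^-1)) _ _
    _ _ (is_deriveM dX dE)).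
  rewrite /GRing.scale/=.
  case: k {dX} => [|k]; first by rewrite /= !mul0r mulr0 subr0 expr0 mul1r addr0 exprVn mulrC.
  by rewrite /= -!exprVn !exprS expr0; ring.
- rewrite !flat_npos// mulr0 subr0.
  have L : (fun h : R => h^-1 *: ((flat k \o shift 0) (h *: 1) - flat k 0)) @ 0^'
           --> (0 : R).
    rewrite flat_npos//.
    apply/cvgrPdist_le => e e0; near=> h.
    rewrite sub0r normrN subr0 /= addr0 [h *: 1]mulr1.
    have [h0|h0] := leP h 0; first by rewrite flat_npos// scaler0 normr0 ltW.
    have -> : h^-1 *: flat k h = flat k.+1 h.
      by rewrite /flat h0 exprS -mulrA.
    rewrite ger0_norm ?flat_ge0// (le_trans (flat_le _ _))//.
    rewrite -ler_pdivlMl ?ltr0n ?fact_gt0//.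
    near: h; apply: nbhs_dnbhs.
    have d0 : 0 < (k.+2)`!%:R^-1 * e.
      by rewrite mulr_gt0// invr_gt0 ltr0n fact_gt0.
    exact: (@nbhs0_le R R _ d0).
  split; first by apply/cvg_ex; exists 0; exact: L.
  by apply/cvg_lim => //.
Unshelve. all: by end_near. Qed.

Lemma Ck_flat n k : Ck n (flat k).
Proof.
elim: n k => [|n IH] k.
  by move=> x; apply: differentiable_continuous; apply/derivable1_diffP;
    have [] := is_derive_flat k x.
apply: CkS1; first exact: is_derive_flat.
have -> : (fun x => flat k.+2 x - k%:R * flat k.+1 x) =
          (fun x => flat k.+2 x + (- k%:R) * flat k.+1 x).
  by apply/funext => x; rewrite mulNr.
by apply: CkD => //; apply: CkM => //; exact: Ck_cst.
Qed.

(** The fundamental theorem of calculus gives primitives to the right of a base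
    point.  Those with base points -n, normalized at 0, agree where they are
    defined, and glue to a primitive on the line. *)
Lemma antiderivative (f : R -> R) : continuous f ->
  exists F, forall x : R, is_derive x 1 F (f x).
Proof.
move=> cf.
pose mu := @lebesgue_measure R.
have intf a b : mu.-integrable `[a, b] (EFin \o f).
  apply: continuous_compact_integrable; first exact: segment_compact.
  exact: continuous_subspaceT.
pose F (a x : R) := \int[mu]_(t in `[a, x]) f t.
have dF (a x : R) : a < x -> is_derive x 1 (F a) (f x).
  move=> ax; have [|d1 d2] := @continuous_FTC1_closed _ f a x (x + 1) _ (intf _ _) ax (cf x).
    by rewrite ltrDl.
  by apply: DeriveDef; [exact: d1|rewrite -derive1E; exact: d2].
have FB (a b x : R) : a <= b -> b <= x -> F a x - F a b = F b x.
  move=> ab bx; rewrite /F Rintegral_itvB ?bnd_simp//=.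
  rewrite Rintegral_itv_obnd_cbnd//.
  by apply: integrableS (intf b x) => //; exact: subset_itv_oc_cc.
pose N (x : R) : nat := `|Num.ceil `|x| |.+1%N.
have Nx (x : R) : - (N x)%:R < x.
  rewrite /N ltrNl; apply: (@le_lt_trans _ _ `|x|).
    by rewrite -normrN ler_norm.
  rewrite -natr1; apply: (@le_lt_trans _ _ (Num.ceil `|x|)%:~R).
    exact: ceil_ge.
  by rewrite natr_absz intr_norm (le_lt_trans (ler_norm _))// ltrDl.
pose G (x : R) := F (- (N x)%:R) x - F (- (N x)%:R) 0.
have GE (n : nat) (x : R) : - n%:R <= x -> G x = F (- n%:R) x - F (- n%:R) 0.
  move=> nx; rewrite /G.
  wlog nm : / ((N x) <= n)%N.
    move=> H; case: (leqP (N x) n) => [|/ltnW] nm; first exact: H.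
    rewrite -(FB (- (N x)%:R) (- n%:R) x) ?lerN2 ?ler_nat//.
    rewrite -(FB (- (N x)%:R) (- n%:R) 0) ?lerN2 ?ler_nat ?oppr_le0//.
    by rewrite opprB addrA subrK.
  have Nxx := ltW (Nx x).
  rewrite -(FB (- n%:R) (- (N x)%:R) x) ?lerN2 ?ler_nat//.
  rewrite -(FB (- n%:R) (- (N x)%:R) 0) ?lerN2 ?ler_nat ?oppr_le0//.
  by rewrite opprB addrA subrK.
exists G => x.
apply: (@near_eq_is_derive _ _ _ (fun y => F (- (N x)%:R) y - F (- (N x)%:R) 0)).
- near=> y; rewrite (GE (N x))// ltW//.
  near: y; apply: lt_nbhsr; exact: Nx.
rewrite -[f x]subr0; apply: is_deriveB; exact: dF.
Unshelve. all: by end_near. Qed.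

Lemma is_derive_const_eq (f f' : R -> R) (a b : R) : a <= b ->
  (forall x : R, is_derive x 1 f (f' x)) -> (forall x, a < x < b -> f' x = 0) ->
  f a = f b.
Proof.
move=> ab df f0; apply/esym/eqP; rewrite -subr_eq0; apply/eqP.
move: ab; rewrite le_eqVlt => /predU1P[->|ab]; first by rewrite subrr.
have [|c cab ->] := @MVT R f f' a b ab (fun x _ => df x).
  apply: continuous_subspaceT => x; apply: differentiable_continuous.
  by apply/derivable1_diffP; exact: ex_derive.
by rewrite f0 ?mul0r//; move: cab; rewrite in_itv.
Qed.

Lemma is_derive_homo (f f' : R -> R) :
  (forall x : R, is_derive x 1 f (f' x)) -> (forall x, 0 <= f' x) ->
  {homo f : x y / x <= y}.
Proof.
move=> df f0 a b; rewrite le_eqVlt => /predU1P[->//|ab].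
rewrite -subr_ge0.
have [|c cab ->] := @MVT R f f' a b ab (fun x _ => df x).
  apply: continuous_subspaceT => x; apply: differentiable_continuous.
  by apply/derivable1_diffP; exact: ex_derive.
by rewrite mulr_ge0// subr_ge0 ltW.
Qed.

(** The normalized primitive of a bump that is positive exactly in ]0, 1[.  The
    derivative is part of the data since later constants depend on its bound. *)
Lemma smooth_step : exists (S S' : R -> R) (C : R),
  [/\ [/\ smooth S, smooth S' & forall x : R, is_derive x 1 S (S' x)],
      (forall x, x <= 0 -> S x = 0), (forall x, 1 <= x -> S x = 1),
      (forall x, 0 <= S x <= 1) &
      [/\ (forall x, 0 <= S' x <= C), (forall x, x <= 0 -> S' x = 0),
          (forall x, 1 <= x -> S' x = 0) & 0 < C]].
Proof.
pose b (x : R) := flat 0 x * flat 0 (1 - x).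
have sb n : Ck n b.
  apply: CkM; first exact: Ck_flat.
  refine (@Ck_comp_affine R R R (fun x => 1 - x) (fun x => - x) n (flat 0) _ _ _).
  - move=> t x v; rewrite scalerN; ring.
  - by move=> x; apply: continuousB; [exact: cst_continuous|exact: id].
  - exact: Ck_flat.
have b0 x : 0 <= b x by rewrite mulr_ge0// flat_ge0.
have bn x : x <= 0 -> b x = 0 by move=> x0; rewrite /b flat_npos// mul0r.
have bp x : 1 <= x -> b x = 0.
  by move=> x0; rewrite /b [flat 0 (1 - x)]flat_npos ?mulr0// subr_le0.
have [F dF] := antiderivative (Ck_continuous (sb 0)).
have ndF := is_derive_homo dF b0.
have cF : continuous F.
  move=> x; apply: differentiable_continuous; apply/derivable1_diffP.
  exact: ex_derive.
have F01 : 0 < F 1 - F 0.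
  have [|c] := @MVT R F b 0 1 ltr01 (fun x _ => dF x).
    exact: continuous_subspaceT.
  rewrite in_itv/= => /andP[c0 c1] ->.
  by rewrite subr0 mulr1 mulr_gt0// flat_gt0// subr_gt0.
set d := F 1 - F 0 in F01.
have [M HM] : exists M, forall x, b x <= M.
  have [|c _ Hc] := @EVT_max R b 0 1 ler01.
    exact/continuous_subspaceT/(Ck_continuous (sb 0)).
  exists (b c) => x.
  case: (leP x 0) => [/bn -> //|x0].
  case: (leP 1 x) => [/bp -> //|x1].
  by apply: Hc; rewrite in_itv/= !ltW.
exists (fun x => d^-1 * (F x - F 0)), (fun x => d^-1 * b x), (d^-1 * M + 1).
have dS (x : R) : is_derive x 1 (fun x => d^-1 * (F x - F 0)) (d^-1 * b x).
  rewrite -[b x]subr0; apply: is_deriveZ; apply: is_deriveB.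
have sS' : smooth (fun x => d^-1 * b x).
  by move=> n; apply: CkM => //; exact: Ck_cst.
have di : 0 < d^-1 by rewrite invr_gt0.
split.
- split => // -[|n]; last exact: (CkS1 dS).
  exact: Ck_continuous (CkS1 dS (sS' 0)).
- move=> x x0; rewrite (@is_derive_const_eq F b x 0)// ?subrr ?mulr0//.
  by move=> y /andP[_ /ltW]; exact: bn.
- move=> x x1; rewrite -(@is_derive_const_eq F b 1 x)// ?mulVf// ?gt_eqF//.
  by move=> y /andP[/ltW + _]; exact: bp.
- move=> x; apply/andP; split.
    case: (leP 0 x) => x0.
      by rewrite mulr_ge0 ?subr_ge0 ?ndF// ltW.
    rewrite (@is_derive_const_eq F b x 0)// ?subrr ?mulr0//.
      exact: ltW.
    by move=> y /andP[_ /ltW]; exact: bn.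
  rewrite mulrC ler_pdivrMr// mul1r lerD2r.
  case: (leP x 1) => x1; first exact: ndF.
  rewrite -(@is_derive_const_eq F b 1 x)//; first exact: ltW.
  by move=> y /andP[/ltW + _]; exact: bp.
- have M0 : 0 <= M by rewrite (le_trans (b0 0)).
  have dM0 : 0 <= d^-1 * M by rewrite mulr_ge0// ltW.
  split.
  + move=> x; rewrite mulr_ge0//=; last exact: ltW.
    by rewrite ler_wpDr// ler_pM2l.
  + by move=> x x0; rewrite bn// mulr0.
  + by move=> x x0; rewrite bp// mulr0.
  + by rewrite ltr_wpDl.
Qed.

End Bump.

(** * Tensor products of functions of one variable *)

Section Affine.
Variables (R : realType) (V : normedModType R).

Lemma is_derive_comp_affine1 (l L : V -> R) (f f' : R -> R) x v :
  (forall (t : R) x v, l (t *: v + x) = t * L v + l x) ->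
  (forall y : R, is_derive y 1 f (f' y)) ->
  is_derive x v (fun y => f (l y)) (L v * f' (l x)).
Proof.
move=> lE df.
have D := is_derive_scale_dir (L v) (df (l x)).
have := @is_derive_comp_affine R V R l L f x v lE (@ex_derive _ _ _ _ _ _ _ D).
by rewrite (@derive_val _ _ _ _ _ _ _ D).
Qed.

Lemma Ck_comp_affine1 (l L : V -> R) n (f : R -> R) :
  (forall (t : R) x v, l (t *: v + x) = t * L v + l x) -> continuous l ->
  Ck n f -> Ck n (fun y => f (l y)).
Proof. by move=> lE cl Cf; exact: (@Ck_comp_affine R V R l L n f lE cl Cf). Qed.

End Affine.

Section Tensor.
Variable R : realType.
Local Notation E := (space3 R).

Definition tens3 (a b c : R -> R) (x : E) : R := a x.1.1 * b x.1.2 * c x.2.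

Definition axis0 : 'I_3 := @Ordinal 3 0 isT.
Definition axis1 : 'I_3 := @Ordinal 3 1 isT.
Definition axis2 : 'I_3 := @Ordinal 3 2 isT.

Lemma continuous_crd1 : continuous (fun x : E => x.1.1).
Proof.
by move=> x; apply: (@continuous_comp _ _ _ fst fst); [exact: cvg_fst|exact: cvg_fst].
Qed.
Lemma continuous_crd2 : continuous (fun x : E => x.1.2).
Proof.
by move=> x; apply: (@continuous_comp _ _ _ fst snd); [exact: cvg_fst|exact: cvg_snd].
Qed.
Lemma continuous_crd3 : continuous (fun x : E => x.2).
Proof. by move=> x; exact: cvg_snd. Qed.

Lemma smooth_tens3 a b c : smooth a -> smooth b -> smooth c ->
  smooth (tens3 a b c).
Proof.
move=> sa sb sc n; apply: CkM; first apply: CkM.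
- exact: (Ck_comp_affine1 (L := fun x : E => x.1.1) _ continuous_crd1 (sa n)).
- exact: (Ck_comp_affine1 (L := fun x : E => x.1.2) _ continuous_crd2 (sb n)).
- exact: (Ck_comp_affine1 (L := fun x : E => x.2) _ continuous_crd3 (sc n)).
Qed.

Definition cube (r : R) : set E := (`[- r, r] `*` `[- r, r]) `*` `[- r, r].

Lemma compact_cube r : compact (cube r).
Proof.
by apply: compact_setX; [apply: compact_setX|]; exact: segment_compact.
Qed.

Definition supp_in (r : R) (a : R -> R) := forall y, r < `|y| -> a y = 0.

Lemma tens3_out r a b c : supp_in r a -> supp_in r b -> supp_in r c ->
  forall x, ~ cube r x -> tens3 a b c x = 0.
Proof.
move=> ra rb rc x; rewrite /cube/= !in_itv/= -!ler_norml /tens3 => /not_andP[|].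
  move=> /not_andP[|] /negP; rewrite -ltNge.
    by move=> /ra ->; rewrite !mul0r.
  by move=> /rb ->; rewrite mulr0 mul0r.
by move=> /negP; rewrite -ltNge => /rc ->; rewrite mulr0.
Qed.

Lemma test_tens3 r a b c : smooth a -> smooth b -> smooth c ->
  supp_in r a -> supp_in r b -> supp_in r c ->
  test_function setT (tens3 a b c).
Proof.
move=> sa sb sc ra rb rc; split; first exact: smooth_tens3.
exists (cube r); split => //; first exact: compact_cube.
exact: tens3_out.
Qed.

Section derive_tens3.
Variables (a a' b b' c c' : R -> R).
Hypothesis da : forall x : R, is_derive x 1 a (a' x).
Hypothesis db : forall x : R, is_derive x 1 b (b' x).
Hypothesis dc : forall x : R, is_derive x 1 c (c' x).

Lemma is_derive_tens3 (x v : E) : is_derive x v (tens3 a b c)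
  (v.1.1 * tens3 a' b c x + v.1.2 * tens3 a b' c x + v.2 * tens3 a b c' x).
Proof.
have d1 := is_derive_comp_affine1 x v (l := fun x : E => x.1.1)
  (L := fun x : E => x.1.1) (fun _ _ _ => erefl) da.
have d2 := is_derive_comp_affine1 x v (l := fun x : E => x.1.2)
  (L := fun x : E => x.1.2) (fun _ _ _ => erefl) db.
have d3 := is_derive_comp_affine1 x v (l := fun x : E => x.2)
  (L := fun x : E => x.2) (fun _ _ _ => erefl) dc.
have D := is_deriveM (is_deriveM d1 d2) d3.
apply: (is_derive_eq D); rewrite /GRing.scale/= /tens3 fctE; ring.
Qed.

Lemma derive_tens3_1 : (fun x => 'D_(basis3 R axis0) (tens3 a b c) x) = tens3 a' b c.
Proof.
apply/funext => x; rewrite (@derive_val _ _ _ _ _ _ _ (is_derive_tens3 _ _))/=.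
by rewrite !mul0r !addr0 mul1r.
Qed.
Lemma derive_tens3_2 : (fun x => 'D_(basis3 R axis1) (tens3 a b c) x) = tens3 a b' c.
Proof.
apply/funext => x; rewrite (@derive_val _ _ _ _ _ _ _ (is_derive_tens3 _ _))/=.
by rewrite !mul0r addr0 add0r mul1r.
Qed.
Lemma derive_tens3_3 : (fun x => 'D_(basis3 R axis2) (tens3 a b c) x) = tens3 a b c'.
Proof.
apply/funext => x; rewrite (@derive_val _ _ _ _ _ _ _ (is_derive_tens3 _ _))/=.
by rewrite !mul0r !add0r mul1r.
Qed.
End derive_tens3.

(** The directions of the mixed derivatives of order at most one in each
    variable, the only ones that enter the Sobolev inequality. *)
Definition mixed3 (s1 s2 s3 : bool) : seq 'I_3 :=
  (if s1 then [:: axis0] else [::]) ++ (if s2 then [:: axis1] else [::]) ++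
  (if s3 then [:: axis2] else [::]).

Lemma smooth_is_derive (f : R -> R) : smooth f ->
  forall x : R, is_derive x 1 f ('D_1 f x).
Proof. by move=> /(_ 1)[_ /(_ 1)[df _]] x; exact/derivableP. Qed.

Lemma iterD_tens3 (a a' b b' c c' : R -> R) s1 s2 s3 :
  (forall x : R, is_derive x 1 a (a' x)) ->
  (forall x : R, is_derive x 1 b (b' x)) ->
  (forall x : R, is_derive x 1 c (c' x)) ->
  smooth b' -> smooth c' ->
  Defs.iterD (mixed3 s1 s2 s3) (tens3 a b c) =
  tens3 (if s1 then a' else a) (if s2 then b' else b) (if s3 then c' else c).
Proof.
move=> da db dc sb' sc'; rewrite /Defs.iterD /mixed3.
have E3 : foldr (fun i (h : E -> R) => fun x => 'D_(basis3 R i) h x) (tens3 a b c)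
    (if s3 then [:: axis2] else [::]) = tens3 a b (if s3 then c' else c).
  by case: s3 => //=; rewrite (derive_tens3_3 da db dc).
rewrite !foldr_cat E3.
have [c2 dc2] : exists c2, forall x : R, is_derive x 1 (if s3 then c' else c) (c2 x).
  by case: s3 {E3}; [exists ('D_1 c'); exact: smooth_is_derive|exists c'].
have [b2 db2] : exists b2, forall x : R, is_derive x 1 (if s2 then b' else b) (b2 x).
  by case: s2; [exists ('D_1 b'); exact: smooth_is_derive|exists b'].
have -> : foldr (fun i (h : E -> R) => fun x => 'D_(basis3 R i) h x)
    (tens3 a b (if s3 then c' else c)) (if s2 then [:: axis1] else [::]) =
    tens3 a (if s2 then b' else b) (if s3 then c' else c).
  by case: s2 {db2} => //=; rewrite (derive_tens3_2 da db dc2).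
by case: s1 => //=; rewrite (derive_tens3_1 da db2 dc2).
Qed.

End Tensor.

(** * Almost everywhere bounds from averages *)

Section Detecting.
Context d (X : measurableType d) (R : realType).
Variable mu : {measure set X -> \bar R}.

(** A family of sets whose averages control integrable functions almost
    everywhere.  This property, unlike Lebesgue's differentiation theorem, passes
    to product measures, which leads from intervals to boxes. *)
Definition detecting (I : Type) (B : I -> set X) : Prop :=
  [/\ forall i, measurable (B i), forall i, (mu (B i) < +oo)%E &
   forall (F : X -> R) (C : R), mu.-integrable setT (EFin \o F) ->
     (forall i, \int[mu]_(x in B i) (F x)%:E <= C%:E * mu (B i))%E ->
     {ae mu, forall x, F x <= C}].

End Detecting.

Lemma ae_mono d (X : measurableType d) (R : realType) (mu : {measure set X -> \bar R})
    (P Q : X -> Prop) : (forall x, P x -> Q x) ->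
  {ae mu, forall x, P x} -> {ae mu, forall x, Q x}.
Proof. by move=> PQ; exact: filterS. Qed.

Lemma ae_mono2 d (X : measurableType d) (R : realType) (mu : {measure set X -> \bar R})
    (P1 P2 Q : X -> Prop) : (forall x, P1 x -> P2 x -> Q x) ->
  {ae mu, forall x, P1 x} -> {ae mu, forall x, P2 x} -> {ae mu, forall x, Q x}.
Proof. by move=> PQ; exact: filterS2. Qed.

Lemma ae_off_null_set d (X : measurableType d) (R : realType)
    (mu : {measure set X -> \bar R}) (A : set X) (P : X -> Prop) :
  measurable A -> mu A = 0%E -> (forall x, ~ A x -> P x) ->
  {ae mu, forall x, P x}.
Proof.
by move=> mA A0 AP; exists A; split => // x nPx; apply: contrapT => /AP.
Qed.

Lemma ae_eq_integrable d (X : measurableType d) (R : realType)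
    (mu : {measure set X -> \bar R}) (f g : X -> \bar R) :
  measurable_fun setT g -> ae_eq mu setT f g ->
  mu.-integrable setT f -> mu.-integrable setT g.
Proof.
move=> mg fg /integrableP[mf fy]; apply/integrableP; split => //.
have <- : (\int[mu]_x `|f x| = \int[mu]_x `|g x|)%E.
  apply: ae_eq_integral => //; [exact: measurableT_comp|exact: measurableT_comp|].
  exact: ae_eq_abse.
exact: fy.
Qed.

Section DetectingProduct.
Context d1 d2 (X : measurableType d1) (Y : measurableType d2) (R : realType).
Variable m1 : {sigma_finite_measure set X -> \bar R}.
Variable m2 : {sigma_finite_measure set Y -> \bar R}.
Variables (I : Type) (J : countType) (B1 : I -> set X) (B2 : J -> set Y).

(** For a fixed [j], the averages over the [B1 i] of the partial integral of [F]
    over [B2 j] are at most [C * m2 (B2 j)], hence so is this partial integral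
    for almost every [x]; the countability of [J] makes this hold for all [j] at
    once, and the second family bounds [F (x, _)] almost everywhere. *)
Lemma detectingX : detecting m1 B1 -> detecting m2 B2 ->
  detecting (m1 \x m2)%E (fun ij : I * J => B1 ij.1 `*` B2 ij.2).
Proof.
move=> [mB1 fB1 D1] [mB2 fB2 D2]; split.
- by move=> [i j]; exact: measurableX.
- move=> [i j] /=.
  rewrite product_measure1E// lte_mul_pinfty ?fB2 ?ge0_fin_numE ?fB1//.
move=> F C iF FC.
have mF : measurable_fun setT F by apply/measurable_EFinP; exact: measurable_int iF.
pose Fj (j : J) := (EFin \o F) \_ (setT `*` B2 j).
have iFj j : (m1 \x m2)%E.-integrable setT (Fj j).
  have mS : measurable ([set: X] `*` B2 j) by exact: measurableX.
  by apply: (integrable_mkcond _ mS).1; exact: integrableS iF.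
have HG j : {ae m1, forall x, (fubini_F m2 (Fj j) x <= C%:E * m2 (B2 j))%E}.
  have iG := integrable_fubini_F (iFj j).
  have mG := measurable_int _ iG.
  have fG := integrable_ae measurableT iG.
  pose G x := fine (fubini_F m2 (Fj j) x).
  have Gae : ae_eq m1 setT (fubini_F m2 (Fj j)) (EFin \o G).
    by apply: filterS fG => x fx _; rewrite /= /G fineK// fx.
  have mEG : measurable_fun setT (EFin \o G).
    by apply/measurable_EFinP; exact: measurableT_comp.
  have iEG : m1.-integrable setT (EFin \o G).
    exact: ae_eq_integrable iG.
  have : {ae m1, forall x, G x <= C * fine (m2 (B2 j))}.
    apply: D1 => // i.
    have <- : (\int[m1]_(x in B1 i) fubini_F m2 (Fj j) x =
               \int[m1]_(x in B1 i) (G x)%:E)%E.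
      apply: ae_eq_integral => //.
      - exact: measurable_funS mG.
      - exact: measurable_funS mEG.
      - exact: ae_eq_subset Gae.
    have := FC (i, j) => /=; rewrite product_measure1E//.
    have fin2 : m2 (B2 j) \is a fin_num by rewrite ge0_fin_numE ?fB2.
    have -> : (C%:E * (m1 (B1 i) * m2 (B2 j)) =
      (C * fine (m2 (B2 j)))%:E * m1 (B1 i))%E.
      by rewrite EFinM fineK// -muleA [X in (_ * X)%E]muleC.
    suff -> : (\int[m1]_(x in B1 i) fubini_F m2 (Fj j) x =
      \int[m1 \x m2]_(x in B1 i `*` B2 j) (F x)%:E)%E by [].
    rewrite [RHS]integral_mkcond.
    have -> : ((fun x => (F x)%:E) \_ (B1 i `*` B2 j) =
               (Fj j) \_ (B1 i `*` setT)).
      apply/funext => -[x y]; rewrite /Fj /patch !in_setX/= !in_setT/=.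
      by case: (x \in B1 i); case: (y \in B2 j).
    rewrite -integral12_prod_meas1; last first.
      have mS : measurable (B1 i `*` [set: Y]) by exact: measurableX.
      by apply: (integrable_mkcond _ mS).1; exact: integrableS (iFj j).
    rewrite [LHS]integral_mkcond.
    apply: eq_integral => x _; rewrite /fubini_F /patch.
    case: ifPn => xB.
      by apply: eq_integral => y _; rewrite in_setX/= xB in_setT.
    rewrite integral0_eq// => y _.
    by rewrite in_setX/= (negbTE xB).
  apply: filterS2 fG => x fx Gx.
  by rewrite -(fineK (fx Logic.I)) -(@fineK _ (m2 (B2 j))) ?ge0_fin_numE ?fB2// lee_fin.
have {}HG : {ae m1, forall x, forall j, (fubini_F m2 (Fj j) x <= C%:E * m2 (B2 j))%E}.
  have : {ae m1, forall x, forall n : nat, forall j, unpickle n = Some j ->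
      (fubini_F m2 (Fj j) x <= C%:E * m2 (B2 j))%E}.
    apply: ae_foralln => n; case: (unpickle n) => [j|]; last exact: aeW.
    by apply: filterS (HG j) => x Hx j' [<-].
  by apply: filterS => x Hx j; apply: (Hx (pickle j)); rewrite pickleK.
have Hx : {ae m1, forall x, m2 [set y | C < F (x, y)] = 0}.
  apply: filterS2 HG (ae_integrable1 iF) => x HGx ix.
  have : {ae m2, forall y, F (x, y) <= C}.
    apply: D2 => // j; apply: le_trans (HGx j).
    rewrite /fubini_F integral_mkcond le_eqVlt; apply/orP; left; apply/eqP.
    by apply: eq_integral => y _; rewrite /Fj /patch in_setX in_setT.
  rewrite /almost_everywhere/= => -/negligibleP.
  have mS : measurable [set y | C < F (x, y)].
    have mFx : measurable_fun setT (fun y => F (x, y)).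
      exact: measurableT_comp.
    rewrite -[X in measurable X]setTI.
    by rewrite -preimage_itvoy; exact: mFx.
  have -> : ~` [set y | F (x, y) <= C] = [set y | C < F (x, y)].
    by apply/seteqP; split => y /=; rewrite ltNge => /negP.
  exact.
have mA : measurable [set z | C < F z].
  rewrite -[X in measurable X]setTI -preimage_itvoy; exact: mF.
apply: (@ae_off_null_set _ _ _ _ [set z | C < F z]) => //; last first.
  by move=> z /negP; rewrite -leNgt.
rewrite /= /product_measure1.
rewrite (ae_eq_integral (cst 0%E))//; first by rewrite integral0.
- exact: measurable_fun_xsection.
- apply: filterS Hx => x Hx _ /=; rewrite -[RHS]Hx; congr (m2 _).
  by apply/seteqP; split => y; rewrite /xsection/= inE.
Qed.

End DetectingProduct.

Section Grid.
Variable R : realType.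
Local Notation mu := (@leb1 R).

Definition grid (pn : int * nat) : set R :=
  `](pn.1%:~R / pn.2.+1%:R), ((pn.1 + 1)%:~R / pn.2.+1%:R)[%classic.

Lemma leb1_itv (a b : R) : leb1 R `]a, b[%classic = (if a < b then (b - a)%:E else 0%E).
Proof. by rewrite /leb1/= lebesgue_measure_itv/= lte_fin. Qed.

(** The cells of mesh 1 / (n + 1) next to a point shrink nicely to it, even when
    the point is an end of its cell; Lebesgue's theorem applies to them. *)
Lemma detecting_grid : detecting mu grid.
Proof.
have w (p : int * nat) : p.1%:~R / p.2.+1%:R < (p.1 + 1)%:~R / p.2.+1%:R :> R.
  by rewrite ltr_pM2r ?invr_gt0 ?ltr0n// intrD ltrDl.
have mE (p : int * nat) : mu (grid p) = (p.2.+1%:R^-1)%:E.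
  rewrite /grid leb1_itv w; congr EFin.
  by rewrite -mulrBl intrD addrC addKr mul1r.
split.
- by move=> p; exact: measurable_itv.
- by move=> p; change (mu (grid p) < +oo)%E; rewrite mE ltry.
move=> F C iF FC.
(* Below, 4 is the ratio of the length of the ball of radius 2 / (n + 1) to that
   of the cell. *)
pose E (x : R) (n : nat) := grid (Num.floor (x * n.+1%:R), n).
have hE x : nicely_shrinking x (E x).
  split; first by move=> n; exact: measurable_itv.
  have r0 (n : nat) : 0 < 2 / n.+1%:R :> R by rewrite divr_gt0// ltr0n.
  exists (4, fun n => PosNum (r0 n)); split => /=.
  - by [].
  - rewrite -[0](mulr0 (2 : R)); apply: cvgM; first exact: cvg_cst.
    exact: cvg_harmonic.
  - move=> n y; rewrite /E /grid/= in_itv/= => /andP[y1 y2].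
    have n0 : 0 < n.+1%:R :> R by rewrite ltr0n.
    move: y1 y2; rewrite ltr_pdivrMr// ltr_pdivlMr// => y1 y2.
    have h1 := floor_le_tmp (x * n.+1%:R); have h2 := floorD1_gt (x * n.+1%:R).
    rewrite /ball/= ltr_pdivlMr// -(gtr0_norm n0) -normrM mulrBl ltr_norml.
    move: h2 y2; rewrite !intrD; set f := _%:~R in y1 h1 *; move=> h2 y2.
    by apply/andP; split; lra.
  - move=> n; rewrite lebesgue_measure_ball; last by rewrite ltW.
    have -> : lebesgue_measure (E x n) = (n.+1%:R^-1)%:E by exact: (mE (_, n)).
    by rewrite -EFinM lee_fin mulr2n -mulrDl ler_pM2r ?invr_gt0 ?ltr0n//; lra.
have lF : locally_integrable setT F.
  by apply: open_integrable_locally => //; exact: openT.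
have H : {ae mu, forall x, lebesgue_pt F x} := lebesgue_differentiation lF.
apply: ae_mono H => x /= lx.
have := nice_lebesgue_differentiation hE lF lx => cv.
rewrite -lee_fin -(cvg_lim _ cv)//; apply: lime_le; first exact: cvgP cv.
apply: nearW => n.
have fE : mu (E x n) = (n.+1%:R^-1)%:E by exact: (mE (_, n)).
have -> : lebesgue_measure (E x n) = (n.+1%:R^-1)%:E by exact: fE.
have H : (\int[mu]_(y in E x n) (F y)%:E <= C%:E * (n.+1%:R^-1)%:E)%E.
  by rewrite -fE; exact: (FC (Num.floor (x * n.+1%:R), n)).
rewrite inver invr_eq0 pnatr_eq0/= invrK.
apply: (@le_trans _ _ (n.+1%:R%:E * (C%:E * (n.+1%:R^-1)%:E))%E).
  by rewrite lee_pmul2l.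
by rewrite -!EFinM lee_fin mulrCA mulfV ?mulr1// pnatr_eq0.
Qed.

End Grid.

(** * Lebesgue measure in space, cubes and plateaus *)

Section SigmaFiniteProduct.
Context d1 d2 (X : measurableType d1) (Y : measurableType d2) (R : realType).
Variables (m1 : {sigma_finite_measure set X -> \bar R})
  (m2 : {sigma_finite_measure set Y -> \bar R}).

(** Carries the sigma-finiteness of a product, which a further product needs. *)
Definition sigma_finite_prod : set (X * Y) -> \bar R := (m1 \x m2)%E.

HB.instance Definition _ := Measure.on sigma_finite_prod.

Let sigma_finite_prodT : sigma_finite setT sigma_finite_prod.
Proof.
have /sigma_finiteP[F [TF ndF Foo]] := sigma_finiteT m1.
have /sigma_finiteP[G [TG ndG Goo]] := sigma_finiteT m2.
exists (fun n => F n `*` G n).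
  apply/seteqP; split => // -[x y] _.
  have [n _ Fx] : (\bigcup_i F i) x by rewrite -TF.
  have [k _ Gy] : (\bigcup_i G i) y by rewrite -TG.
  exists (maxn n k) => //; split => /=.
  - by move: x Fx; exact/subsetPset/ndF/leq_maxl.
  - by move: y Gy; exact/subsetPset/ndG/leq_maxr.
move=> k; have [? ?] := Foo k; have [? ?] := Goo k.
split; first exact: measurableX.
by rewrite /sigma_finite_prod product_measure1E// lte_mul_pinfty// ge0_fin_numE.
Qed.

HB.instance Definition _ := Measure_isSigmaFinite.Build _ _ _
  sigma_finite_prod sigma_finite_prodT.

End SigmaFiniteProduct.

Section Leb3.
Variable R : realType.
Local Notation E := (space3 R).
Local Notation T1 := (measurableTypeR R).
Local Notation T3 := (T1 * T1 * T1)%type.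
Local Notation leb3 := (leb3 R).

Lemma leb3_box (A B C : set T1) : measurable A -> measurable B -> measurable C ->
  leb3 ((A `*` B) `*` C) = (leb1 R A * leb1 R B * leb1 R C)%E.
Proof.
move=> mA mB mC; rewrite /leb3/= product_measure1E//=; last exact: measurableX.
by rewrite product_measure1E.
Qed.

Lemma detecting_leb3 : detecting leb3
  (fun p : ((int * nat) * (int * nat)) * (int * nat) =>
     (@grid R p.1.1 `*` @grid R p.1.2) `*` @grid R p.2).
Proof.
have A0 := detectingX (@detecting_grid R) (@detecting_grid R).
exact: (@detectingX _ _ _ _ R (sigma_finite_prod (leb1 R) (leb1 R)) _ _ _ _ _ A0
  (@detecting_grid R)).
Qed.

Lemma measurable_cube (r : R) : measurable (cube r : set T3).
Proof.
by apply: measurableX; [apply: measurableX|]; exact: measurable_itv.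
Qed.

Lemma leb3_cube_fin (r : R) : (leb3 (cube r) < +oo)%E.
Proof.
rewrite leb3_box//; try exact: measurable_itv.
rewrite /leb1/= !lebesgue_measure_itv/= lte_fin.
by case: ifPn => _; rewrite ?mule0 -?EFinB -?EFinM ltry.
Qed.

Lemma in_cube (r : R) (x : E) :
  cube r x <-> [/\ `|x.1.1| <= r, `|x.1.2| <= r & `|x.2| <= r].
Proof.
rewrite /cube/= !in_itv/= -!ler_norml; split; first by move=> [[]].
by move=> [].
Qed.

Lemma cube_norm (r : R) (x : E) : cube r x <-> `|x| <= r.
Proof.
rewrite in_cube !prod_normE/= !ge_max; split.
  by move=> [-> -> ->].
by move=> /andP[/andP[-> ->] ->].
Qed.

Lemma bigcup_cube : \bigcup_n cube n%:R = [set: E].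
Proof.
apply/seteqP; split => // x _.
exists (`|Num.ceil `|x| |)%N => //; apply/cube_norm.
rewrite natr_absz ger0_norm; first exact: ceil_ge.
by rewrite -(ler_int R) mulr0z; exact: le_trans (ceil_ge _).
Qed.

(** Compact sets are contained in cubes, so this is local integrability in a form
    which needs no covering argument. *)
Definition cube_integrable (f : E -> R) :=
  forall r, leb3.-integrable (cube r) (EFin \o f).

Lemma loc_cube_integrable (f : E -> R) :
  loc_integrable setT f -> cube_integrable f.
Proof. by move=> lf r; apply: lf => //; exact: compact_cube. Qed.

Lemma cube_integrableN (f : E -> R) :
  cube_integrable f -> cube_integrable (fun x => - f x).
Proof. by move=> lf r; apply: (integrableN (lf r)). Qed.

Lemma cube_integrableB (f g : E -> R) :
  cube_integrable f -> cube_integrable g -> cube_integrable (fun x => f x - g x).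
Proof.
by move=> lf lg r; apply: (integrableB _ (lf r) (lg r)); exact: measurable_cube.
Qed.

Lemma cube_integrable_measurable (f : E -> R) :
  cube_integrable f -> measurable_fun (setT : set T3) f.
Proof.
move=> lf; rewrite -bigcup_cube.
apply/measurable_fun_bigcup; first by move=> n; exact: measurable_cube.
move=> n; apply/measurable_EFinP.
exact: measurable_int (lf _).
Qed.

Lemma measurable_crd (a : R -> R) : continuous a ->
  [/\ measurable_fun setT (fun x : T3 => a x.1.1),
      measurable_fun setT (fun x : T3 => a x.1.2) &
      measurable_fun setT (fun x : T3 => a x.2)].
Proof.
move=> ca; have ma : measurable_fun (setT : set T1) a by exact: continuous_measurable_fun.
split; apply: measurableT_comp => //.
- exact: (measurableT_comp measurable_fst measurable_fst).
- exact: (measurableT_comp measurable_snd measurable_fst).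
Qed.

Lemma measurable_tens3 (a b c : R -> R) :
  continuous a -> continuous b -> continuous c ->
  measurable_fun (setT : set T3) (tens3 a b c).
Proof.
move=> ca cb cc; have [ma _ _] := measurable_crd ca.
have [_ mb _] := measurable_crd cb; have [_ _ mc] := measurable_crd cc.
by apply: measurable_funM => //; apply: measurable_funM.
Qed.

Lemma integrable_loc_mul (h g : E -> R) (r M : R) :
  cube_integrable h -> measurable_fun (setT : set T3) g ->
  (forall x, `|g x| <= M) -> (forall x, ~ cube r x -> g x = 0) ->
  leb3.-integrable setT (fun x => (h x * g x)%:E).
Proof.
move=> lh mg gM g0.
have mh := cube_integrable_measurable lh.
have ih : leb3.-integrable setT ((EFin \o h) \_ (cube r)).
  apply: (integrable_mkcond _ _).1; first exact: measurable_cube.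
  exact: lh.
apply: (le_integrable measurableT _ _ (integrableZl measurableT M ih)).
  by apply/measurable_EFinP; exact: measurable_funM.
move=> x _ /=; rewrite /patch; case: ifPn => [xr|].
  by rewrite -EFinM lee_fin !normrM mulrC ler_wpM2r// (le_trans (gM x)) ?ler_norm.
by rewrite notin_setE => /g0 ->; rewrite mulr0 mule0.
Qed.

End Leb3.

Section Plateau.
Variable R : realType.
Local Notation E := (space3 R).
Local Notation T1 := (measurableTypeR R).
Local Notation T3 := (T1 * T1 * T1)%type.
Local Notation leb3 := (leb3 R).
Variable S : R -> R.
Hypothesis smS : smooth S.
Hypothesis S0 : forall x, x <= 0 -> S x = 0.
Hypothesis S1 : forall x, 1 <= x -> S x = 1.
Hypothesis S01 : forall x, 0 <= S x <= 1.

(** A smooth approximation from below of the indicator of ]a, b[. *)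
Definition plateau (n : nat) (a b y : R) := S (n%:R * (y - a)) * S (n%:R * (b - y)).

Lemma smooth_plateau n a b : smooth (plateau n a b).
Proof.
move=> k; apply: CkM.
- apply: (Ck_comp_affine1 (l := fun y : R => n%:R * (y - a))
    (L := fun y : R => n%:R * y)) (smS k).
    by move=> t x v; rewrite /GRing.scale/=; ring.
  by move=> y; apply: cvgM; [exact: cvg_cst|];
    apply: cvgB; [exact: cvg_id|exact: cvg_cst].
- apply: (Ck_comp_affine1 (l := fun y : R => n%:R * (b - y))
    (L := fun y : R => - n%:R * y)) (smS k).
    by move=> t x v; rewrite /GRing.scale/=; ring.
  by move=> y; apply: cvgM; [exact: cvg_cst|];
    apply: cvgB; [exact: cvg_cst|exact: cvg_id].
Qed.

Lemma plateau01 n a b y : 0 <= plateau n a b y <= 1.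
Proof.
have /andP[s1 s2] := S01 (n%:R * (y - a)); have /andP[s3 s4] := S01 (n%:R * (b - y)).
by rewrite /plateau mulr_ge0//= -[leRHS]mulr1 ler_pM.
Qed.

Lemma plateau_out n a b y : ~~ (a < y < b) -> plateau n a b y = 0.
Proof.
rewrite negb_and -!leNgt => /orP[ya|by_]; rewrite /plateau.
  by rewrite S0 ?mul0r// mulr_ge0_le0// subr_le0.
by rewrite [X in _ * X]S0 ?mulr0// mulr_ge0_le0// subr_le0.
Qed.

Lemma plateau_in a b y : a < y < b -> \forall n \near \oo, plateau n a b y = 1.
Proof.
move=> /andP[ay yb].
have c (e : R) : 0 < e -> \forall n \near \oo, 1 <= n%:R * e.
  move=> e0; near=> n; rewrite -ler_pdivrMr// div1r.
  near: n; exact: nbhs_infty_ger.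
near=> n; rewrite /plateau !S1 ?mulr1//; near: n; apply: c; by rewrite subr_gt0.
Unshelve. all: by end_near. Qed.

Lemma supp_plateau r n a b : `|a| <= r -> `|b| <= r -> supp_in r (plateau n a b).
Proof.
rewrite !ler_norml => /andP[a1 a2] /andP[b1 b2] y ry; apply: plateau_out.
apply/negP => /andP[ay yb]; move: ry; rewrite ltNge => /negP; apply.
rewrite ler_norml; apply/andP; split; [exact: le_trans a1 (ltW ay)|].
exact: le_trans (ltW yb) b2.
Qed.

Definition obox (a b : E) : set E :=
  (`]a.1.1, b.1.1[ `*` `]a.1.2, b.1.2[) `*` `]a.2, b.2[.

Definition plateau3 n (a b : E) : E -> R :=
  tens3 (plateau n a.1.1 b.1.1) (plateau n a.1.2 b.1.2) (plateau n a.2 b.2).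

Lemma measurable_obox a b : measurable (obox a b : set T3).
Proof.
by apply: measurableX; [apply: measurableX|]; exact: measurable_itv.
Qed.

Lemma plateau3_cvg (a b x : E) :
  \forall n \near \oo, plateau3 n a b x = \1_(obox a b) x.
Proof.
rewrite indicE; case: (boolP (x \in obox a b)); rewrite ?inE ?notin_setE.
  rewrite /obox/= !in_itv/= => -[[x1 x2] x3].
  near=> n; rewrite /plateau3 /tens3/=.
  have -> : plateau n a.1.1 b.1.1 x.1.1 = 1 by near: n; exact: plateau_in.
  have -> : plateau n a.1.2 b.1.2 x.1.2 = 1 by near: n; exact: plateau_in.
  have -> : plateau n a.2 b.2 x.2 = 1 by near: n; exact: plateau_in.
  by rewrite !mulr1.
rewrite /obox/= !in_itv/= => /not_andP H; apply: nearW => n.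
rewrite /plateau3 /tens3/=; case: H => [/not_andP[/negP|/negP]|/negP] H.
- by rewrite (plateau_out n H) !mul0r.
- by rewrite (plateau_out n H) mulr0 mul0r.
- by rewrite (plateau_out n H) mulr0.
Unshelve. all: by end_near. Qed.

Lemma plateau3_le1 n a b x : `|plateau3 n a b x| <= 1.
Proof.
have /andP[p0 p1] := plateau01 n a.1.1 b.1.1 x.1.1.
have /andP[q0 q1] := plateau01 n a.1.2 b.1.2 x.1.2.
have /andP[r0 r1] := plateau01 n a.2 b.2 x.2.
rewrite /plateau3 /tens3 ger0_norm; last first.
  by apply: mulr_ge0 => //; exact: mulr_ge0.
by apply: mulr_ile1 => //; [exact: mulr_ge0|exact: mulr_ile1].
Qed.

Lemma plateau3_out r n a b x : cube r a -> cube r b -> ~ cube r x ->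
  plateau3 n a b x = 0.
Proof.
move=> /in_cube[a1 a2 a3] /in_cube[b1 b2 b3].
by apply: tens3_out; exact: supp_plateau.
Qed.

Lemma measurable_plateau3 n a b : measurable_fun (setT : set T3) (plateau3 n a b).
Proof. by apply: measurable_tens3; exact: (smooth_plateau n _ _ 0). Qed.

Lemma exists_cube (a b : E) : exists r, cube r a /\ cube r b.
Proof.
exists (Num.max `|a| `|b|).
by split; apply/cube_norm; rewrite le_max lexx ?orbT.
Qed.

Lemma obox_cube r a b : cube r a -> cube r b -> obox a b `<=` cube r.
Proof.
move=> /in_cube[]; rewrite !ler_norml => /andP[? ?] /andP[? ?] /andP[? ?].
move=> /in_cube[]; rewrite !ler_norml => /andP[? ?] /andP[? ?] /andP[? ?] x.
rewrite /obox/= !in_itv/= => -[[/andP[? ?] /andP[? ?]] /andP[? ?]].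
by apply/in_cube; rewrite !ler_norml; split; apply/andP; split; lra.
Qed.

(** Dominated convergence, from plateaus to the indicator of the box. *)
Lemma plateau_box_bound (h : E -> R) (K : R) (a b : E) : cube_integrable h ->
  (forall n, `|\int[leb3]_x (h x * plateau3 n a b x)| <= K) ->
  (`|\int[leb3]_(x in obox a b) (h x)%:E| <= K%:E)%E.
Proof.
move=> lh HK; have mh := cube_integrable_measurable lh.
have [r [ra rb]] := exists_cube a b.
have ih : leb3.-integrable setT ((EFin \o h) \_ (cube r)).
  apply: (integrable_mkcond _ _).1; first exact: measurable_cube.
  exact: lh.
have [|||||_ _ cv] := @dominated_convergence _ _ _ leb3 setT measurableT
  (fun n x => (h x * plateau3 n a b x)%:E) (fun x => (h x * \1_(obox a b) x)%:E)
  (abse \o ((EFin \o h) \_ (cube r))).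
- move=> n; apply/measurable_EFinP; apply: measurable_funM => //.
  exact: measurable_plateau3.
- apply/measurable_EFinP; apply: measurable_funM => //.
  by apply: measurable_indic; exact: measurable_obox.
- apply: aeW => x _; apply: cvg_near_cst.
  near=> n; congr (_ * _)%:E; near: n; exact: plateau3_cvg.
- exact: integrable_abse.
- apply: aeW => x n _ /=; rewrite /patch; case: ifPn => [xr|].
    by rewrite lee_fin normrM ler_piMr// plateau3_le1.
  by rewrite notin_setE => xr; rewrite (plateau3_out n ra rb)// mulr0 normr0; exact: abse_ge0.
have -> : (\int[leb3]_(x in obox a b) (h x)%:E =
           \int[leb3]_x (h x * \1_(obox a b) x)%:E)%E.
  rewrite integral_mkcond; apply: eq_integral => x _.
  by rewrite /patch indicE; case: ifPn => _; rewrite ?mulr1 ?mulr0.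
have cv' : (`|\int[leb3]_x (h x * plateau3 n a b x)%:E|)%E @[n --> \oo] -->
    (`|\int[leb3]_x (h x * \1_(obox a b) x)%:E|)%E by exact: cvg_abse.
apply: (cvge_le _ cv'); apply: nearW => n /=.
have iin : leb3.-integrable setT (fun x => (h x * plateau3 n a b x)%:E).
  apply: (@integrable_loc_mul _ _ _ r 1) => //.
  - exact: measurable_plateau3.
  - exact: plateau3_le1.
  - by move=> x; exact: plateau3_out.
by rewrite -EFin_normr_Rintegral// lee_fin.
Unshelve. all: by end_near. Qed.

Lemma itv_openI (a b c d : R) : `]a, b[%classic `&` `]c, d[%classic =
  `]Num.max a c, Num.min b d[%classic.
Proof.
apply/seteqP; split => y /=; rewrite !in_itv/= gt_max lt_min.
  by move=> [/andP[-> ->] /andP[-> ->]].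
by move=> /andP[/andP[-> ->] /andP[-> ->]].
Qed.

Definition unit_box (a b : E) := [/\ a.1.1 < b.1.1 <= a.1.1 + 1,
  a.1.2 < b.1.2 <= a.1.2 + 1 & a.2 < b.2 <= a.2 + 1].

Definition vol (a b : E) := (b.1.1 - a.1.1) * (b.1.2 - a.1.2) * (b.2 - a.2).

(** A cell of the grid meets the box [Q k] in an open box with edges of length at
    most 1, or not at all; so the averages over cells of [h], truncated to [Q k]
    to be integrable, are at most [C]. *)
Lemma ae_le_of_box (h : E -> R) (C : R) : 0 <= C -> cube_integrable h ->
  (forall a b, unit_box a b ->
     (\int[leb3]_(x in obox a b) (h x)%:E <= (C * vol a b)%:E)%E) ->
  {ae leb3, forall x, h x <= C}.
Proof.
move=> C0 lh H.
have mh := cube_integrable_measurable lh.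
pose Q (k : nat) : set E := obox (- k%:R, - k%:R, - k%:R) (k%:R, k%:R, k%:R).
have Hk k : {ae leb3, forall x, (h \_ (Q k)) x <= C}.
  have [_ _ D] := detecting_leb3 R; apply: D.
    have -> : EFin \o h \_ (Q k) = (EFin \o h) \_ (Q k).
      by rewrite restrict_EFin.
    apply: (integrable_mkcond _ _).1; first exact: measurable_obox.
    apply: integrableS (lh k%:R) => //.
    - exact: measurable_cube.
    - exact: measurable_obox.
    - move=> x; rewrite /Q /obox/= !in_itv/= => -[[/andP[x1 x2] /andP[x3 x4]] /andP[x5 x6]].
      by apply/in_cube; rewrite !ler_norml !ltW.
  move=> [[p1 p2] p3] /=.
  have -> : (\int[leb3]_(x in (@grid R p1 `*` @grid R p2) `*` @grid R p3) ((h \_ (Q k)) x)%:E =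
     \int[leb3]_(x in ((@grid R p1 `*` @grid R p2) `*` @grid R p3) `&` Q k) (h x)%:E)%E.
    rewrite [RHS]integral_mkcondr; apply: eq_integral => x _.
    by rewrite restrict_EFin.
  rewrite leb3_box; try exact: measurable_itv.
  pose lo (p : int * nat) : R := p.1%:~R / p.2.+1%:R.
  pose hi (p : int * nat) : R := (p.1 + 1)%:~R / p.2.+1%:R.
  have lohi p : lo p < hi p <= lo p + 1.
    rewrite /lo /hi ltr_pM2r ?invr_gt0 ?ltr0n// intrD ltrDl ltr01/=.
    rewrite mulrDl lerD2l mul1r invf_le1 ?ltr0n// ler1n//.
  have gridE p : @grid R p = `]lo p, hi p[%classic by [].
  rewrite !gridE !leb1_itv.
  have /andP[-> _] := lohi p1; have /andP[-> _] := lohi p2; have /andP[-> _] := lohi p3.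
  rewrite /Q /obox /= -setXI -setXI !itv_openI.
  set a := (Num.max (lo p1) (- k%:R), Num.max (lo p2) (- k%:R), Num.max (lo p3) (- k%:R)).
  set b := (Num.min (hi p1) k%:R, Num.min (hi p2) k%:R, Num.min (hi p3) k%:R).
  rewrite -[X in (\int[_]_(x in X) _ <= _)%E]/(obox a b).
  have sub p : Num.min (hi p) k%:R - Num.max (lo p) (- k%:R) <= hi p - lo p.
    by rewrite lerB// ?ge_min ?le_max lexx.
  have leD1 p : Num.min (hi p) k%:R <= Num.max (lo p) (- k%:R) + 1.
    by rewrite -lerBlDl (le_trans (sub p))//; have /andP[_] := lohi p; rewrite lerBlDl.
  have [ab|] := pselect (unit_box a b).
    apply: le_trans (H _ _ ab) _; rewrite -!EFinM lee_fin ler_wpM2l//.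
    case: ab => /= /andP[ab1 _] /andP[ab2 _] /andP[ab3 _].
    by rewrite /vol/= !ler_pM ?mulr_ge0 ?subr_ge0 ?(ltW ab1) ?(ltW ab2) ?(ltW ab3).
  move=> nab; have -> : obox a b = set0.
    apply/seteqP; split => // x; rewrite /obox/= !in_itv/=.
    move=> [[/andP[x1 x2] /andP[x3 x4]] /andP[x5 x6]]; apply: nab; split => /=.
    - by rewrite leD1 (lt_trans x1).
    - by rewrite leD1 (lt_trans x3).
    - by rewrite leD1 (lt_trans x5).
  rewrite integral_set0 -!EFinM lee_fin !mulr_ge0 ?subr_ge0//.
  - by have /andP[/ltW] := lohi p1.
  - by have /andP[/ltW] := lohi p2.
  - by have /andP[/ltW] := lohi p3.
have := ae_foralln Hk; apply: ae_mono => x Hx.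
have [k _] : (\bigcup_n cube n%:R) x by rewrite bigcup_cube.
move=> /in_cube[x1 x2 x3].
have := Hx k.+1; rewrite /patch ifT// inE /Q /obox/= !in_itv/= -!ltr_norml.
have kk : k%:R < k.+1%:R :> R by rewrite ltr_nat.
by rewrite !(le_lt_trans _ kk).
Qed.

(** Only smooth functions are paired with [h] here: this is the form in which
    weak derivatives can be used.  Boxes with edges of length at most 1 suffice,
    which keeps the constants of the Sobolev inequality uniform. *)
Lemma ae_bound_of_plateau (h : E -> R) (C : R) : 0 <= C -> cube_integrable h ->
  (forall a b n, unit_box a b ->
     `|\int[leb3]_x (h x * plateau3 n a b x)| <= C * vol a b) ->
  {ae leb3, forall x, `|h x| <= C}.
Proof.
move=> C0 lh H.
have B a b : unit_box a b ->
    (`|\int[leb3]_(x in obox a b) (h x)%:E| <= (C * vol a b)%:E)%E.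
  by move=> ab; apply: plateau_box_bound => // n; exact: H.
have H1 : {ae leb3, forall x, h x <= C}.
  by apply: ae_le_of_box => // a b /B; apply: le_trans; exact: lee_abs.
have H2 : {ae leb3, forall x, - h x <= C}.
  apply: ae_le_of_box => //; first exact: cube_integrableN.
  move=> a b /B; apply: le_trans.
  have [r [ra rb]] := exists_cube a b.
  have ih : leb3.-integrable (obox a b) (EFin \o h).
    apply: integrableS (lh r) => //.
    - exact: measurable_cube.
    - exact: measurable_obox.
    - exact: obox_cube.
  have mo := measurable_obox a b.
  rewrite -abseN -integralN ?integrable_add_def//.
  by rewrite -[leLHS]/(\int[leb3]_(x in obox a b) - (h x)%:E)%E lee_abs.
apply: ae_mono2 H1 H2 => x x1 x2.
by rewrite ler_norml x1 andbT lerNl.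
Qed.

End Plateau.

(** * The Sobolev inequality *)

Section Trilinear.
Variable R : realType.
Local Notation E := (space3 R).
Local Notation T1 := (measurableTypeR R).
Local Notation T3 := (T1 * T1 * T1)%type.
Local Notation leb3 := (leb3 R).

Definition bump r (a : R -> R) := smooth a /\ supp_in r a.

Lemma bump_continuous r a : bump r a -> continuous a.
Proof. by move=> [/(_ 0)]. Qed.

Lemma bump_bounded r a : bump r a -> exists M : R, forall y : R, `|a y| <= M.
Proof.
move=> ba; have [_ sa] := ba.
have ca : continuous (fun y => `|a y|).
  by move=> y; apply: cvg_norm; exact: (bump_continuous ba).
have [r0|r0] := leP 0 r; last first.
  by exists 0 => y; rewrite sa ?normr0// (lt_le_trans r0).
have [||c _ Hc] := @EVT_max R (fun y => `|a y|) (- r) r.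
- by rewrite ge0_cp.
- exact: continuous_subspaceT.
exists `|a c| => y; have [yr|yr] := leP `|y| r.
  by apply: Hc; rewrite in_itv/= -ler_norml.
by rewrite sa// normr0.
Qed.

Lemma bumpB r a b : bump r a -> bump r b -> bump r (fun y => a y - b y).
Proof.
move=> [sa ra] [sb rb]; split.
  move=> n; have -> : (fun y => a y - b y) = (fun y => a y + (-1) * b y).
    by apply/funext => y; rewrite mulN1r.
  by apply: CkD => //; apply: CkM => //; exact: Ck_cst.
by move=> y ry; rewrite ra// rb// subr0.
Qed.

Section Pairing.
Variables (f : E -> R) (r : R).
Hypothesis lf : cube_integrable f.

Lemma integrable_tens3 a b c : bump r a -> bump r b -> bump r c ->
  leb3.-integrable setT (fun x => (f x * tens3 a b c x)%:E).
Proof.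
move=> ba bb bc; have [A HA] := bump_bounded ba; have [B HB] := bump_bounded bb.
have [C HC] := bump_bounded bc.
apply: (@integrable_loc_mul _ _ _ r (A * B * C)) => //.
- by apply: measurable_tens3; [exact: bump_continuous ba|exact: bump_continuous bb|
    exact: bump_continuous bc].
- move=> x; rewrite /tens3 !normrM ler_pM ?mulr_ge0//.
  by rewrite ler_pM.
- by apply: tens3_out; [exact: ba.2|exact: bb.2|exact: bc.2].
Qed.

Definition tri (a b c : R -> R) := \int[leb3]_x (f x * tens3 a b c x).

Lemma triB1 a a' b c : bump r a -> bump r a' -> bump r b -> bump r c ->
  tri (fun y => a y - a' y) b c = tri a b c - tri a' b c.
Proof.
move=> ba ba' bb bc.
rewrite /tri -RintegralB//; try exact: integrable_tens3.
by apply: eq_Rintegral => x _; rewrite /tens3; ring.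
Qed.
Lemma triB2 a b b' c : bump r a -> bump r b -> bump r b' -> bump r c ->
  tri a (fun y => b y - b' y) c = tri a b c - tri a b' c.
Proof.
move=> ba ba' bb bc.
rewrite /tri -RintegralB//; try exact: integrable_tens3.
by apply: eq_Rintegral => x _; rewrite /tens3; ring.
Qed.
Lemma triB3 a b c c' : bump r a -> bump r b -> bump r c -> bump r c' ->
  tri a b (fun y => c y - c' y) = tri a b c - tri a b c'.
Proof.
move=> ba ba' bb bc.
rewrite /tri -RintegralB//; try exact: integrable_tens3.
by apply: eq_Rintegral => x _; rewrite /tens3; ring.
Qed.

(** The product of three differences has eight terms. *)
Lemma tri_split (k1 j1 k2 j2 k3 j3 : R -> R) (K : R) :
  bump r k1 -> bump r j1 -> bump r k2 -> bump r j2 -> bump r k3 -> bump r j3 ->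
  (forall s1 s2 s3 : bool, `|tri (if s1 then j1 else k1) (if s2 then j2 else k2)
     (if s3 then j3 else k3)| <= K) ->
  `|tri (fun y => k1 y - j1 y) (fun y => k2 y - j2 y) (fun y => k3 y - j3 y)|
     <= 8 * K.
Proof.
move=> b1 c1 b2 c2 b3 c3 H.
have H3 s1 s2 : `|tri (if s1 then j1 else k1) (if s2 then j2 else k2)
     (fun y => k3 y - j3 y)| <= 2 * K.
  rewrite triB3//; [|by case: s1|by case: s2].
  rewrite (le_trans (ler_normB _ _))// mulr_natl mulr2n lerD//.
    exact: (H s1 s2 false).
  exact: (H s1 s2 true).
have b3' := bumpB b3 c3.
have H2 s1 : `|tri (if s1 then j1 else k1) (fun y => k2 y - j2 y)
     (fun y => k3 y - j3 y)| <= 4 * K.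
  rewrite triB2//; last by case: s1.
  rewrite (le_trans (ler_normB _ _))//.
  have -> : 4 * K = 2 * K + 2 * K by ring.
  by rewrite lerD//; [exact: (H3 s1 false)|exact: (H3 s1 true)].
have b2' := bumpB b2 c2.
rewrite triB1// (le_trans (ler_normB _ _))//.
have -> : 8 * K = 4 * K + 4 * K by ring.
by rewrite lerD//; [exact: (H2 false)|exact: (H2 true)].
Qed.

End Pairing.
End Trilinear.

Section L2.
Variable R : realType.
Local Notation E := (space3 R).
Local Notation T1 := (measurableTypeR R).
Local Notation T3 := (T1 * T1 * T1)%type.
Local Notation leb3 := (leb3 R).

Definition ubox (a : E) : set E :=
  (`[a.1.1, a.1.1 + 1] `*` `[a.1.2, a.1.2 + 1]) `*` `[a.2, a.2 + 1].

Lemma measurable_ubox a : measurable (ubox a : set T3).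
Proof.
by apply: measurableX; [apply: measurableX|]; exact: measurable_itv.
Qed.

Lemma leb3_ubox a : leb3 (ubox a) = 1%E.
Proof.
rewrite leb3_box; try exact: measurable_itv.
rewrite /leb1/= !lebesgue_measure_itv/= !lte_fin !ltrDl ltr01 -!EFinB.
by rewrite ![_ + 1]addrC !addrK !mule1.
Qed.

Lemma Lnorm2E (g : E -> R) :
  Lnorm leb3 2%:E (EFin \o g) = ((\int[leb3]_x (g x ^+ 2)%:E) `^ 2^-1)%E.
Proof.
rewrite unlock; congr (_ `^ _)%E; apply: eq_integral => x _ /=.
by rewrite powR_mulrn// real_normK// num_real.
Qed.

(** Hoelder's inequality on a cube of volume 1. *)
Lemma L1_ubox_le_L2 (a : E) (g : E -> R) :
  measurable_fun (setT : set T3) g ->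
  (\int[leb3]_(x in ubox a) `|(g x)%:E| <= Lnorm leb3 2%:E (EFin \o g))%E.
Proof.
move=> mg; have mQ := measurable_ubox a.
have := @hoelder _ _ _ leb3 g (\1_(ubox a)) 2 2 mg _ _ _ _.
rewrite Lnorm1 => H.
have -> : (\int[leb3]_(x in ubox a) `|(g x)%:E| =
   \int[leb3]_x `|(g x * \1_(ubox a) x)%:E|)%E.
  rewrite integral_mkcond; apply: eq_integral => x _.
  by rewrite /patch indicE; case: ifPn => _; rewrite ?mulr1// mulr0 /= normr0.
apply: (le_trans (H _ _ _ _)) => //.
  by have := splitr (1 : R); rewrite div1r.
have -> : Lnorm leb3 2%:E (EFin \o \1_(ubox a)) = 1%E.
  rewrite unlock.
  have -> : (\int[leb3]_x `|(EFin \o \1_(ubox a)) x| `^ 2 = 1)%E.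
    transitivity (\int[leb3]_x (\1_(ubox a) x)%:E)%E.
      apply: eq_integral => x _; rewrite /= indicE; case: (_ \in _) => /=.
        by rewrite normr1 powR1.
      by rewrite normr0 powR0.
    by rewrite integral_indic// setIT leb3_ubox.
  by rewrite poweR_EFin powR1.
by rewrite mule1.
Qed.

End L2.

Section Sobolev.
Variable R : realType.
Local Notation E := (space3 R).
Local Notation T1 := (measurableTypeR R).
Local Notation T3 := (T1 * T1 * T1)%type.
Local Notation leb3 := (leb3 R).
Variables (S S' : R -> R) (CS : R).
Hypothesis smS : smooth S.
Hypothesis smS' : smooth S'.
Hypothesis dS : forall x : R, is_derive x 1 S (S' x).
Hypothesis S0 : forall x, x <= 0 -> S x = 0.
Hypothesis S1 : forall x, 1 <= x -> S x = 1.
Hypothesis S01 : forall x, 0 <= S x <= 1.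
Hypothesis S'C : forall x, 0 <= S' x <= CS.
Hypothesis S'0 : forall x, x <= 0 -> S' x = 0.
Hypothesis S'1 : forall x, 1 <= x -> S' x = 0.
Hypothesis CS0 : 0 < CS.

Lemma wderiv_norm2_ge0 Om l (f : E -> R) : (0 <= wderiv_norm2 Om l f)%E.
Proof. by apply: le_ereal_inf_tmp => _ [g _ <-]; exact: Lnorm_ge0. Qed.

Lemma wderiv_norm2_le Om k l (f : E -> R) : (size l <= k)%N ->
  (wderiv_norm2 Om l f <= sobolev_norm Om k f)%E.
Proof.
move=> lk; rewrite /sobolev_norm.
have lk1 : (size l < k.+1)%N by [].
rewrite (bigD1 (Ordinal lk1))//= (bigD1 (in_tuple l))//= -addeA leeDl//.
rewrite adde_ge0//; first by apply: sume_ge0 => ? _; exact: wderiv_norm2_ge0.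
by apply: sume_ge0 => ? _; apply: sume_ge0 => ? _; exact: wderiv_norm2_ge0.
Qed.

Lemma Hk_norm_wderiv k l (f : E -> R) (B : R) : (Hk_norm k f < B%:E)%E ->
  (size l <= k)%N ->
  exists g, is_wderiv setT l f g /\ (Lnorm leb3 2%:E (EFin \o g) < B%:E)%E.
Proof.
move=> fB lk; have := le_lt_trans (wderiv_norm2_le setT f lk) fB.
move=> /ereal_inf_lt[_ [g fg <-]]; rewrite patch_setT => gB; by exists g.
Qed.

Lemma Hk_norm_cube k (f : E -> R) (B : R) : (Hk_norm k f < B%:E)%E ->
  cube_integrable f.
Proof.
move=> /(@Hk_norm_wderiv _ [::])[//|g [[lf _ _] _]].
exact: loc_cube_integrable.
Qed.

Lemma Hk_norm_gt0 k (f : E -> R) (B : R) : (Hk_norm k f < B%:E)%E -> 0 < B.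
Proof.
move=> /(@Hk_norm_wderiv _ [::])[//|g [_ gB]].
by rewrite -lte_fin (le_lt_trans _ gB)// Lnorm_ge0.
Qed.

(** With [m] the integral of the plateau, [k] is [m] times a bump of integral 1 on
    [a, a + 1], namely the derivative of a step.  Then [k] minus the plateau has
    integral 0, so its primitive [j] vanishes outside [a, a + 1] as well.  Both
    are of the size of [m], that is O(b - a), whatever [n]. *)
Lemma plateau_decomp (a b : R) n : a < b <= a + 1 ->
  exists k j j' : R -> R, exists r0, forall r, r0 <= r ->
  [/\ [/\ bump r k, bump r j & bump r j'],
      forall x : R, is_derive x 1 j (j' x),
      forall y, plateau S n a b y = k y - j' y,
      (forall y, `|k y| <= (CS + 1) * (b - a)) /\
      (forall y, ~~ (a <= y <= a + 1) -> k y = 0) &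
      (forall y, `|j y| <= (CS + 1) * (b - a)) /\
      (forall y, ~~ (a <= y <= a + 1) -> j y = 0)].
Proof.
move=> /andP[ab ba].
have sp := smooth_plateau smS n a b.
have [F dF] := antiderivative (Ck_continuous (sp 0)).
have cF : continuous F.
  by move=> x; apply: differentiable_continuous; apply/derivable1_diffP;
    exact: ex_derive.
have p01 := plateau01 S01 n a b.
have ndF := is_derive_homo dF (fun x => proj1 (andP (p01 x))).
pose m := F b - F a.
have m0 : 0 <= m by rewrite subr_ge0 ndF// ltW.
have mba : m <= b - a.
  have [|c _ Ec] := @MVT R F (plateau S n a b) a b ab (fun x _ => dF x).
    exact: continuous_subspaceT.
  by rewrite /m Ec ler_piMl ?subr_ge0 ?(ltW ab)//; have /andP[] := p01 c.
have pout := plateau_out S0 n.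
have Fa y : y <= a -> F y = F a.
  move=> ya; apply: (@is_derive_const_eq _ F _ y a ya dF) => z /andP[_ za].
  by apply: pout; rewrite negb_and -leNgt (ltW za).
have Fb y : b <= y -> F b = F y.
  move=> ya; apply: (@is_derive_const_eq _ F _ b y ya dF) => z /andP[bz _].
  by apply: pout; rewrite negb_and -!leNgt (ltW bz) orbT.
have shift (h : R -> R) : smooth h -> smooth (fun y => h (y - a)).
  move=> sh i; apply: (Ck_comp_affine1 (l := fun y : R => y - a)
    (L := fun y : R => y)) (sh i).
    by move=> t x v; rewrite /GRing.scale/=; ring.
  by move=> y; apply: cvgB; [exact: cvg_id|exact: cvg_cst].
(* [j] is the primitive of [k] minus the plateau that vanishes on the left of [a]. *)
pose k y := m * S' (y - a).
pose j y := m * S (y - a) - (F y - F a).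
pose j' y := k y - plateau S n a b y.
have sk : smooth k by move=> i; apply: CkM; [exact: Ck_cst|exact: shift].
have sj' : smooth j'.
  move=> i; have -> : j' = (fun y => k y + (-1) * plateau S n a b y).
    by apply/funext => y; rewrite mulN1r.
  by apply: CkD => //; apply: CkM => //; exact: Ck_cst.
have dj (x : R) : is_derive x 1 j (j' x).
  have ds : is_derive x 1 (fun y => S (y - a)) (S' (x - a)).
    have := @is_derive_comp_affine1 R R (fun y : R => y - a) (fun y : R => y)
      S S' x 1.
    rewrite mul1r; apply => // t y v; rewrite /GRing.scale/=; ring.
  have D1 : is_derive x 1 (fun y : R => m * S (y - a)) (k x) by exact: is_deriveZ.
  have D2 : is_derive x 1 (fun y : R => F y - F a) (plateau S n a b x).
    by rewrite -[plateau _ _ _ _ _]subr0; exact: is_deriveB.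
  exact: (is_deriveB D1 D2).
have sj : smooth j.
  move=> i; apply: CkW; apply: CkS1 dj (sj' i).
have kout y : ~~ (a <= y <= a + 1) -> k y = 0.
  rewrite negb_and -!ltNge /k => /orP[ya|ya].
    by rewrite S'0 ?mulr0// subr_le0 ltW.
  by rewrite S'1 ?mulr0// lerBrDl ltW.
have jout y : ~~ (a <= y <= a + 1) -> j y = 0.
  rewrite negb_and -!ltNge /j => /orP[ya|ya].
    by rewrite S0 ?subr_le0 ?ltW// (Fa y (ltW ya)) subrr mulr0 subrr.
  by rewrite S1 ?lerBrDl ?ltW// -(Fb y) ?mulr1 ?subrr// (le_trans ba)// ltW.
have j'out y : ~~ (a <= y <= a + 1) -> j' y = 0.
  move=> H; rewrite /j' kout// pout ?subr0//; apply: contra H.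
  by move=> /andP[ay yb]; rewrite (ltW ay) (le_trans (ltW yb)).
exists k, j, j', (`|a| + 1) => r hr.
have out_supp h : (forall y, ~~ (a <= y <= a + 1) -> h y = 0) -> supp_in r h.
  move=> H y ry; apply: H; apply/negP => /andP[ay ya].
  move: ry; rewrite ltNge => /negP; apply; apply: le_trans hr.
  rewrite ler_norml; apply/andP; split.
    by have := ler_norm (- a); rewrite normrN; lra.
  by rewrite (le_trans ya)// lerD2r ler_norm.
have ba0 : 0 <= b - a by rewrite subr_ge0 ltW.
have Cm : 0 <= CS * (b - a) by rewrite mulr_ge0// ltW.
split => //.
- by split; split => //; exact: out_supp.
- by move=> y; rewrite /j' subKr.
- split => // y; rewrite /k normrM ger0_norm//.
  have /andP[s0 s1] := S'C (y - a); rewrite ger0_norm//.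
  apply: (@le_trans _ _ ((b - a) * CS)); first by rewrite ler_pM.
  by rewrite mulrC ler_wpM2r// lerDl.
- split => // y; apply: (@le_trans _ _ (b - a)); last first.
    by rewrite -[leLHS]mul1r ler_wpM2r// lerDr ltW.
  apply: le_trans mba; rewrite /j.
  have /andP[s0 s1] := S01 (y - a).
  have h1 : 0 <= m * S (y - a) <= m by rewrite mulr_ge0//= ler_piMr.
  have h2 : 0 <= F y - F a <= m.
    have [ya|/ltW ya] := leP y a; first by rewrite Fa// subrr lexx m0.
    rewrite subr_ge0 ndF//= /m lerD2r.
    have [by_|/ltW yb] := leP b y; first by rewrite -Fb.
    exact: ndF.
  by rewrite ler_norml; move: h1 h2 => /andP[? ?] /andP[? ?]; apply/andP; split; lra.
Qed.

(** One integration by parts in each of the variables that [s1], [s2], [s3]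
    select, then Hoelder's inequality on the unit box of corner [a]. *)
Lemma tri_wderiv_bound (f g : E -> R) (a : E) (B r : R) (c1 c2 c3 : R)
    (s1 s2 s3 : bool) (k1 k1' k2 k2' k3 k3' : R -> R) :
  is_wderiv setT (mixed3 s1 s2 s3) f g ->
  (Lnorm leb3 2%:E (EFin \o g) < B%:E)%E ->
  bump r k1 -> bump r k2 -> bump r k3 -> smooth k2' -> smooth k3' ->
  (forall x : R, is_derive x 1 k1 (k1' x)) ->
  (forall x : R, is_derive x 1 k2 (k2' x)) ->
  (forall x : R, is_derive x 1 k3 (k3' x)) ->
  (forall y, `|k1 y| <= c1) -> (forall y, `|k2 y| <= c2) ->
  (forall y, `|k3 y| <= c3) ->
  (forall y, ~~ (a.1.1 <= y <= a.1.1 + 1) -> k1 y = 0) ->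
  (forall y, ~~ (a.1.2 <= y <= a.1.2 + 1) -> k2 y = 0) ->
  (forall y, ~~ (a.2 <= y <= a.2 + 1) -> k3 y = 0) ->
  `|tri f (if s1 then k1' else k1) (if s2 then k2' else k2)
     (if s3 then k3' else k3)| <= B * (c1 * c2 * c3).
Proof.
move=> [lf lg fg] gB b1 b2 b3 sk2' sk3' d1 d2 d3 kc1 kc2 kc3 o1 o2 o3.
have B0 : 0 < B by rewrite -lte_fin (le_lt_trans _ gB)// Lnorm_ge0.
have test : test_function setT (tens3 k1 k2 k3).
  by apply: test_tens3; [exact: b1.1|exact: b2.1|exact: b3.1|exact: b1.2|
    exact: b2.2|exact: b3.2].
have c10 : 0 <= c1 := le_trans (normr_ge0 _) (kc1 0).
have c20 : 0 <= c2 := le_trans (normr_ge0 _) (kc2 0).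
have c30 : 0 <= c3 := le_trans (normr_ge0 _) (kc3 0).
have c0 : 0 <= c1 * c2 * c3 by rewrite !mulr_ge0.
have := fg _ test; rewrite (iterD_tens3 s1 s2 s3 d1 d2 d3)// => E1.
rewrite /tri E1 normrM normrX normrN1 expr1n mul1r.
have clg := loc_cube_integrable lg.
have mg := cube_integrable_measurable clg.
have ig := integrable_tens3 clg b1 b2 b3.
rewrite -lee_fin EFin_normr_Rintegral//.
apply: (le_trans (le_abse_integral _ _ _)) => //; first exact: measurable_int ig.
have mQ := measurable_ubox a.
apply: (@le_trans _ _ (\int[leb3]_(x in ubox a) ((c1 * c2 * c3)%:E * `|(g x)%:E|))%E).
  rewrite [leRHS]integral_mkcond; apply: ge0_le_integral => //.
  - by apply: measurableT_comp => //; exact: measurable_int ig.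
  - apply/(measurable_restrictT _ mQ).
    apply/measurable_EFinP; apply: measurable_funM => //.
    by apply: measurableT_comp => //; exact: measurable_funTS.
  - move=> x _; rewrite /patch; case: ifPn => [_|].
      rewrite -EFinM lee_fin normrM mulrC ler_wpM2r//.
      by rewrite /tens3 !normrM ler_pM ?mulr_ge0// ler_pM.
    rewrite notin_setE /ubox/= !in_itv/= /tens3 => /not_andP H.
    suff -> : k1 x.1.1 * k2 x.1.2 * k3 x.2 = 0 by rewrite mulr0 normr0.
    case: H => [/not_andP[|]|] /negP H.
    + by rewrite o1// !mul0r.
    + by rewrite o2// mulr0 mul0r.
    + by rewrite o3// mulr0.
rewrite ge0_integralZl//; last first.
  by apply: measurableT_comp => //; apply/measurable_EFinP; exact: measurable_funTS.
have -> : (B * (c1 * c2 * c3))%:E = ((c1 * c2 * c3)%:E * B%:E)%E.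
  by rewrite -EFinM mulrC.
apply: lee_wpmul2l => //.
exact: (le_trans (L1_ubox_le_L2 _ mg) (ltW gB)).
Qed.

Definition sobolevC : R := 8 * (CS + 1) ^+ 3.

(** The pairing of [f] with three plateaus splits into eight terms.  In each of
    them the derivatives of the [j]'s are moved onto [f], which costs at most one
    derivative in each variable, and the sizes of the [k]'s and [j]'s multiply to
    a multiple of the volume of the box. *)
Lemma sobolev (f : E -> R) (B : R) : (Hk_norm 3 f < B%:E)%E ->
  {ae leb3, forall x, `|f x| <= sobolevC * B}.
Proof.
move=> fB; have B0 := Hk_norm_gt0 fB; have lf := Hk_norm_cube fB.
have C0 : 0 <= sobolevC by rewrite mulr_ge0// exprn_ge0// addr_ge0// ltW.
apply: (ae_bound_of_plateau smS S0 S1 S01) => //; first by rewrite mulr_ge0// ltW.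
move=> a b n [ab1 ab2 ab3].
have [k1 [j1 [j1' [r1 H1]]]] := plateau_decomp n ab1.
have [k2 [j2 [j2' [r2 H2]]]] := plateau_decomp n ab2.
have [k3 [j3 [j3' [r3 H3]]]] := plateau_decomp n ab3.
pose r := Num.max r1 (Num.max r2 r3).
have [|[bk1 bj1 bj1'] dj1 E1 [k1C k1o] [j1C j1o]] := H1 r.
  by rewrite !le_max lexx.
have [|[bk2 bj2 bj2'] dj2 E2 [k2C k2o] [j2C j2o]] := H2 r.
  by rewrite !le_max lexx orbT.
have [|[bk3 bj3 bj3'] dj3 E3 [k3C k3o] [j3C j3o]] := H3 r.
  by rewrite !le_max lexx !orbT.
have -> : \int[leb3]_x (f x * plateau3 S n a b x) =
  tri f (fun y => k1 y - j1' y) (fun y => k2 y - j2' y) (fun y => k3 y - j3' y).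
  by apply: eq_Rintegral => x _; rewrite /plateau3 /tens3 E1 E2 E3.
apply: le_trans (tri_split lf bk1 bj1' bk2 bj2' bk3 bj3' (K := B *
  ((CS + 1) * (b.1.1 - a.1.1) * ((CS + 1) * (b.1.2 - a.1.2)) *
   ((CS + 1) * (b.2 - a.2)))) _) _; last first.
  by rewrite /sobolevC /vol le_eqVlt; apply/orP; left; apply/eqP; ring.
move=> s1 s2 s3.
have dk1 := smooth_is_derive bk1.1.
have dk2 := smooth_is_derive bk2.1.
have dk3 := smooth_is_derive bk3.1.
have sD (h : R -> R) : smooth h -> smooth ('D_1 h).
  by move=> sh i; exact: (Ck_derive1 (smooth_is_derive sh) (sh i.+1)).
have sl : (size (mixed3 s1 s2 s3) <= 3)%N by case: s1; case: s2; case: s3.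
have [g [fg gB]] := Hk_norm_wderiv fB sl.
have := @tri_wderiv_bound f g a B r _ _ _ s1 s2 s3
  (if s1 then j1 else k1) (if s1 then j1' else 'D_1 k1)
  (if s2 then j2 else k2) (if s2 then j2' else 'D_1 k2)
  (if s3 then j3 else k3) (if s3 then j3' else 'D_1 k3) fg gB.
move=> /(_ ((CS + 1) * (b.1.1 - a.1.1)) ((CS + 1) * (b.1.2 - a.1.2))
  ((CS + 1) * (b.2 - a.2))) H.
have -> : tri f (if s1 then j1' else k1) (if s2 then j2' else k2)
  (if s3 then j3' else k3) =
  tri f (if s1 then if s1 then j1' else 'D_1 k1 else if s1 then j1 else k1)
   (if s2 then if s2 then j2' else 'D_1 k2 else if s2 then j2 else k2)
   (if s3 then if s3 then j3' else 'D_1 k3 else if s3 then j3 else k3).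
  by case: s1 s2 s3 {sl fg H} => -[] [].
apply: H.
- by case: s1 {sl fg}.
- by case: s2 {sl fg}.
- by case: s3 {sl fg}.
- by case: s2 {sl fg}; [exact: bj2'.1|apply: sD; exact: bk2.1].
- by case: s3 {sl fg}; [exact: bj3'.1|apply: sD; exact: bk3.1].
- by case: s1 {sl fg}.
- by case: s2 {sl fg}.
- by case: s3 {sl fg}.
- by case: s1 {sl fg}.
- by case: s2 {sl fg}.
- by case: s3 {sl fg}.
- by case: s1 {sl fg}.
- by case: s2 {sl fg}.
- by case: s3 {sl fg}.
Qed.

(** The fundamental lemma of the calculus of variations, as the case of the
    constant 0 in [ae_bound_of_plateau]. *)
Lemma wderiv0_ae_eq (f g : E -> R) : is_wderiv setT [::] f g ->
  {ae leb3, forall x, f x = g x}.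
Proof.
move=> [lf lg fg].
have clf := loc_cube_integrable lf; have clg := loc_cube_integrable lg.
have : {ae leb3, forall x, `|f x - g x| <= 0}.
  apply: (ae_bound_of_plateau smS S0 S1 S01) => //; first exact: cube_integrableB.
  move=> a b n _; rewrite mul0r.
  have [r [ra rb]] := exists_cube a b.
  have bp c d : `|c| <= r -> `|d| <= r -> bump r (plateau S n c d).
    by move=> cr dr; split; [exact: smooth_plateau|exact: supp_plateau].
  have [a1 a2 a3] := (in_cube r a).1 ra; have [b1 b2 b3] := (in_cube r b).1 rb.
  have B1 := bp _ _ a1 b1; have B2 := bp _ _ a2 b2; have B3 := bp _ _ a3 b3.
  have test : test_function setT (plateau3 S n a b).
    by apply: test_tens3; [exact: B1.1|exact: B2.1|exact: B3.1|exact: B1.2|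
      exact: B2.2|exact: B3.2].
  have := fg _ test; rewrite /= expr0 mul1r => E1.
  have -> : \int[leb3]_x ((f x - g x) * plateau3 S n a b x) =
     \int[leb3]_x (f x * plateau3 S n a b x) - \int[leb3]_x (g x * plateau3 S n a b x).
    rewrite -RintegralB//; first by apply: eq_Rintegral => x _; rewrite mulrBl.
      exact: (integrable_tens3 clf B1 B2 B3).
    exact: (integrable_tens3 clg B1 B2 B3).
  by rewrite E1 subrr normr0.
apply: ae_mono => x; rewrite normr_le0 subr_eq0 => /eqP; exact.
Qed.

(** The Sobolev norm sees [f] through representatives, which [wderiv0_ae_eq]
    identifies with [f] almost everywhere. *)
Lemma Hk_norm_L2 k (f : E -> R) (B : R) : (Hk_norm k f < B%:E)%E ->
  (Lnorm leb3 2%:E (EFin \o f) < B%:E)%E.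
Proof.
move=> fB; have [//|g [fg gB]] := Hk_norm_wderiv (l := [::]) fB.
apply: le_lt_trans gB.
have mf := cube_integrable_measurable (Hk_norm_cube fB).
have mg : measurable_fun (setT : set T3) g.
  by case: fg => _ lg _; exact: cube_integrable_measurable (loc_cube_integrable lg).
have fgae := wderiv0_ae_eq fg.
rewrite !Lnorm2E le_eqVlt; apply/orP; left; apply/eqP; congr (_ `^ _)%E.
apply: ae_eq_integral => //.
- by apply/measurable_EFinP; exact: measurable_funX.
- by apply/measurable_EFinP; exact: measurable_funX.
- by apply: ae_mono fgae => x -> _.
Qed.

End Sobolev.

(** * Estimates of integrals without measurability *)

Section LowerIntegral.
Context d (X : measurableType d) (R : realType).
Variable mu : {measure set X -> \bar R}.
Implicit Types (f g : X -> \bar R) (D : set X).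
Import HBNNSimple.

(** A simple function below [f], set to 0 on the exceptional null set, lies below
    [g] and keeps its integral: monotonicity holds for nonmeasurable functions. *)
Lemma lower_integral_le_ae D f g : (forall x, D x -> 0 <= f x)%E ->
  (forall x, D x -> 0 <= g x)%E -> {ae mu, forall x, D x -> (f x <= g x)%E} ->
  (\int[mu]_(x in D) f x <= \int[mu]_(x in D) g x)%E.
Proof.
move=> f0 g0 [N [mN muN fgN]].
rewrite ge0_integralE// [leRHS]ge0_integralE//.
apply: ge_ereal_sup => _ [h /= hf <-].
apply: ereal_sup_ge.
have mNC : measurable (~` N) by exact: measurableC.
exists (sintegral mu (proj_nnsfun h mNC)).
  exists (proj_nnsfun h mNC) => //= x; rewrite mindicE.
  have [xN|xN] := boolP (x \in ~` N); last first.
    by rewrite mulr0 patchE; case: ifPn => // /set_mem /g0.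
  rewrite mulr1; apply: (le_trans (hf x)); rewrite !patchE; case: ifPn => // xD.
  apply: contrapT => fg; move: xN; rewrite inE; apply; apply: fgN => /= H.
  by apply: fg; apply: H; exact: set_mem.
rewrite -!integralT_nnsfun.
apply: ae_ge0_le_integral => //.
- by move=> x _; rewrite lee_fin.
- by apply/measurable_EFinP.
- by move=> x _; rewrite lee_fin.
- by apply/measurable_EFinP.
exists N; split => // x /= H; apply: contrapT => xN; apply: H => _.
by rewrite mindicE mem_set// mulr1.
Qed.

(** A majorant with a known integral bounds the integral of any function, the
    default value 0 of divergent integrals included. *)
Lemma Rintegral_le_ae D (F : X -> R) g (K : R) : (forall x, D x -> 0 <= g x)%E ->
  {ae mu, forall x, D x -> (`|F x|%:E <= g x)%E} ->
  (\int[mu]_(x in D) g x <= K%:E)%E ->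
  `|\int[mu]_(x in D) F x| <= K.
Proof.
move=> g0 Fg gK.
have P : (\int[mu]_(x in D) (fun x => (F x)%:E)^\+ x <= K%:E)%E.
  apply: le_trans gK; apply: lower_integral_le_ae => //.
  apply: ae_mono Fg => x Fg /Fg; apply: le_trans.
  by rewrite funeposE -EFin_max lee_fin ge_max ler_norm normr_ge0.
have M : (\int[mu]_(x in D) (fun x => (F x)%:E)^\- x <= K%:E)%E.
  apply: le_trans gK; apply: lower_integral_le_ae => //.
  apply: ae_mono Fg => x Fg /Fg; apply: le_trans.
  by rewrite funenegE -EFinN -EFin_max lee_fin ge_max -normrN ler_norm normr_ge0.
rewrite /Rintegral integralE.
have P0 : (0 <= \int[mu]_(x in D) (fun x => (F x)%:E)^\+ x)%E by exact: integral_ge0.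
have M0 : (0 <= \int[mu]_(x in D) (fun x => (F x)%:E)^\- x)%E by exact: integral_ge0.
move: P M P0 M0; set p := integral _ _ _; set m := integral _ _ _.
case: p => [p| |] //; case: m => [m| |] //=.
rewrite !lee_fin => pK mK p0 m0.
by rewrite ler_norml; apply/andP; split; lra.
Qed.

(** The nonzero value [- m] is not the default value of a divergent integral, so
    it is the integral of the negative part. *)
Lemma le_of_Rintegral_npos D (F : X -> R) g (m : R) : 0 < m ->
  (forall x, D x -> 0 <= g x)%E ->
  {ae mu, forall x, D x -> (g x <= (- F x)%:E)%E} ->
  \int[mu]_(x in D) F x = - m ->
  (\int[mu]_(x in D) g x <= m%:E)%E.
Proof.
move=> m0 g0 gF; rewrite /Rintegral integralE.
have -> : (\int[mu]_(x in D) (fun x => (F x)%:E)^\+ x = 0)%E.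
  apply/eqP; rewrite eq_le integral_ge0// andbT.
  rewrite -(integral0 mu D); apply: lower_integral_le_ae => //.
  apply: ae_mono gF => x gF Dx.
  rewrite funeposE -EFin_max lee_fin ge_max lexx andbT.
  have := le_trans (g0 x Dx) (gF Dx).
  by rewrite lee_fin oppr_ge0.
rewrite add0e fineN => /oppr_inj E.
have -> : m%:E = (\int[mu]_(x in D) (fun x => (F x)%:E)^\- x)%E.
  move: E; case: (integral _ _ _) => [r /= ->//| |] /= E; move: m0.
    by rewrite -E ltxx.
  by rewrite -E ltxx.
apply: lower_integral_le_ae => //.
apply: ae_mono gF => x gF /gF; move/le_trans; apply.
by rewrite funenegE -EFinN le_max lexx.
Qed.

End LowerIntegral.

(** * Sobolev norms and functions of time *)

Section SobolevEmbedding.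
Variable R : realType.
Local Notation E := (space3 R).
Local Notation T1 := (measurableTypeR R).
Local Notation T3 := (T1 * T1 * T1)%type.
Local Notation leb3 := (leb3 R).

Lemma sobolev_embedding : exists C : R, 0 <= C /\
  forall (f : E -> R) (B : R), (Hk_norm 3 f < B%:E)%E ->
  {ae leb3, forall x, `|f x| <= C * B}.
Proof.
have [S [S' [C [[sS sS' dS] S0 S1 S01 [S'C S'0 S'1 C0]]]]] := smooth_step R.
exists (sobolevC C); split; first by rewrite mulr_ge0// exprn_ge0// addr_ge0// ltW.
exact: sobolev.
Qed.

Lemma Hk_norm_ge0 k (f : E -> R) : (0 <= Hk_norm k f)%E.
Proof.
exact: le_trans (wderiv_norm2_ge0 _ [::] _) (@wderiv_norm2_le _ _ k [::] _ _).
Qed.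

Lemma Hk_norm_Lnorm k (f : E -> R) : (Lnorm leb3 2%:E (EFin \o f) <= Hk_norm k f)%E.
Proof.
have [->|] := eqVneq (Hk_norm k f) +oo%E; first exact: leey.
rewrite -ltey => fy; have [S [S' [C [[sS sS' dS] S0 S1 S01 _]]]] := smooth_step R.
have f0 := Hk_norm_ge0 k f.
apply/lee_addgt0Pr => e e0; apply: ltW.
rewrite -(@fineK _ (Hk_norm k f)) ?ge0_fin_numE// -EFinD.
apply: (Hk_norm_L2 sS S0 S1 S01 (k := k)).
by rewrite -[X in (X < _)%E](@fineK _ (Hk_norm k f)) ?ge0_fin_numE// lte_fin ltrDl.
Qed.

Lemma Hk_norm_lty_cube k (f : E -> R) : (Hk_norm k f < +oo)%E ->
  cube_integrable f.
Proof.
move=> fy; apply: (@Hk_norm_cube _ k _ (fine (Hk_norm k f) + 1)).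
by rewrite EFinD fineK ?ge0_fin_numE ?Hk_norm_ge0// lteDl// ge0_fin_numE ?Hk_norm_ge0.
Qed.

End SobolevEmbedding.

Section StrongMeasurability.
Variable R : realType.
Local Notation E := (space3 R).
Local Notation T1 := (measurableTypeR R).
Local Notation T3 := (T1 * T1 * T1)%type.
Local Notation leb3 := (leb3 R).
Local Notation L2 f := (Lnorm leb3 2%:E (EFin \o f%R)).

(** A function of the membership of [t] in finitely many measurable sets is
    measurable, whatever the function: split on one set at a time. *)
Lemma measurable_simple_fun_comp m (A : 'I_m -> set T1) (Phi : ('I_m -> bool) -> \bar R) :
  (forall k, measurable (A k)) ->
  measurable_fun (setT : set T1) (fun t => Phi (fun k => t \in A k)).
Proof.
elim: m A Phi => [|m IH] A Phi mA.
  have -> : (fun t => Phi (fun k => t \in A k)) = cst (Phi (fun=> false)).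
    by apply/funext => t /=; congr Phi; apply/funext => -[].
  exact: measurable_cst.
pose ext (b : bool) (h : 'I_m -> bool) (k : 'I_m.+1) : bool :=
  if unlift ord0 k is Some j then h j else b.
have E t : (fun k => t \in A k) = ext (t \in A ord0) (fun j => t \in A (lift ord0 j)).
  by apply/funext => k; rewrite /ext; case: unliftP => [j ->|->].
have M b := IH (fun j => A (lift ord0 j)) (fun h => Phi (ext b h))
  (fun j => mA (lift ord0 j)).
have -> : (fun t => Phi (fun k => t \in A k)) =
  (fun t => if t \in A ord0 then Phi (ext true (fun j => t \in A (lift ord0 j)))
            else Phi (ext false (fun j => t \in A (lift ord0 j)))).
  by apply/funext => t; rewrite E; case: ifP.
apply: measurable_fun_ifT => //.
by apply: (measurable_fun_bool true); rewrite setTI preimage_mem_true.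
Qed.

Lemma L2_triangle (f g : E -> R) :
  measurable_fun (setT : set T3) f -> measurable_fun (setT : set T3) g ->
  (L2 f <= L2 g + L2 (fun x => g x - f x)%R)%E.
Proof.
move=> mf mg.
have -> : L2 (fun x => g x - f x) = L2 (fun x => f x - g x).
  by rewrite !Lnorm2E; congr (_ `^ _)%E; apply: eq_integral => x _; rewrite -sqrrN opprB.
have -> : f = g \+ (fun x => f x - g x).
  by apply/funext => x /=; rewrite addrC subrK.
apply: le_trans (minkowski_EFin _ mg _ _) _ => //.
- by apply: measurable_funB.
- by rewrite ler1n.
rewrite leeD2l// le_eqVlt; apply/orP; left; apply/eqP; congr (Lnorm _ _ (EFin \o _)).
by apply/funext => x /=; rewrite addrAC subrr add0r.
Qed.

(** The norms of simple functions depend on [t] through finitely many indicators,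
    hence are measurable in [t]; along an approximating sequence they converge for
    almost every [t] to the norm of [f t].  The square of their upper limit is
    therefore measurable for all times, and equal to the square of the norm of
    [f t] for almost all of them. *)
Lemma L2_in_time_majorant k (f : R -> E -> R) (T : R) :
  Lp_in 2%:E (@Hk_norm R k) T f ->
  exists b : R -> \bar R, [/\ measurable_fun (setT : set T1) b,
    forall t, (0 <= b t)%E, (\int[leb1 R]_(t in `[0%R, T]%classic) b t < +oo)%E &
    {ae leb1 R, forall t, t \in `[0, T] -> measurable_fun (setT : set T3) (f t) /\
      (\int[leb3]_x (f t x ^+ 2)%:E <= b t)%E}].
Proof.
move=> [[s [simp_s cvs]] Nf].
have Ms n t : measurable_fun (setT : set T3) (s n t).
  have [m [A [g [Ag sE]]]] := simp_s n.
  have -> : s n t = (fun x => \sum_(k < m) \1_(A k) t * g k x).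
    by apply/funext => x; rewrite sE.
  apply: measurable_sum => i; apply: measurable_funM => //.
  exact: cube_integrable_measurable (Hk_norm_lty_cube (Ag i).2).
pose h n t := L2 (s n t).
have mh n : measurable_fun (setT : set T1) (h n).
  have [m [A [g [Ag sE]]]] := simp_s n.
  have -> : h n = (fun t => (fun be : 'I_m -> bool =>
     L2 (fun x => \sum_(k < m) (be k)%:R * g k x)) (fun k => t \in A k)).
    apply/funext => t; rewrite /h; congr (Lnorm _ _ (EFin \o _)).
    by apply/funext => x; rewrite sE; apply: eq_bigr => i _; rewrite indicE.
  apply: (@measurable_simple_fun_comp m A (fun be : 'I_m -> bool =>
     L2 (fun x => \sum_(k < m) (be k)%:R * g k x))) => i; exact: (Ag i).1.
have Iy : (\int[leb1 R]_t (((fun t => Hk_norm k (f t)) \_ `[0%R, T]%classic) t `^ 2)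
   < +oo)%E.
  move: Nf; rewrite unlock => /lty_poweRy; rewrite invr_eq0 pnatr_eq0 => /(_ isT).
  congr (_ < _)%E; apply: eq_integral => t _.
  by rewrite gee0_abs// patchE; case: ifPn => // _; exact: Hk_norm_ge0.
pose b t : \bar R := (limn_esup (h ^~ t) `^ 2)%E.
have hfin n t : (h n t < +oo)%E.
  have [m [A [g [Ag sE]]]] := simp_s n.
  have gy i : (L2 (g i) < +oo)%E by exact: le_lt_trans (Hk_norm_Lnorm _ _) (Ag i).2.
  have mg i : measurable_fun (setT : set T3) (g i).
    exact: cube_integrable_measurable (Hk_norm_lty_cube (Ag i).2).
  have L0 : L2 (fun=> 0) = 0%E by exact: Lnorm0.
  have -> : h n t = L2 (\sum_(i < m) (fun x => \1_(A i) t * g i x)).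
    by congr (Lnorm _ _ (EFin \o _)); apply/funext => x; rewrite sE fct_sumE.
  pose P (F : E -> R) : Prop := measurable_fun (setT : set T3) F /\ (L2 F < +oo)%E.
  suff [] : P (\sum_(i < m) (fun x => \1_(A i) t * g i x)) by [].
  apply: (@big_ind _ P).
  - by split; [exact: measurable_cst|rewrite -[L2 _]/(L2 (fun=> 0)) L0].
  - move=> F G [mF Fy] [mG Gy]; split; first exact: measurable_funD.
    apply: le_lt_trans (minkowski_EFin _ mF mG _) _; first by rewrite ler1n.
    exact: lte_add_pinfty.
  - move=> i _; rewrite /P indicE; case: (_ \in _) => /=.
      by have -> : (fun x => 1 * g i x) = g i by apply/funext => x; rewrite mul1r.
    have -> : (fun x => 0 * g i x) = (fun=> 0) by apply/funext => x; rewrite mul0r.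
    by split; [exact: measurable_cst|rewrite L0].
have hb : {ae leb1 R, forall t, t \in `[0, T] -> measurable_fun (setT : set T3) (f t) /\
    (L2 (f t) = limn_esup (h ^~ t))}.
  apply: ae_mono cvs => t cv tT.
  have {}cv := cv tT.
  have [efin _] := (fine_cvgP _ _).1 cv.
  have mf : measurable_fun (setT : set T3) (f t).
    have [n0 _ /(_ n0 (leqnn _)) /= e0] := efin.
    have -> : f t = (fun x => s n0 t x - (s n0 t x - f t x)).
      by apply/funext => x; rewrite subKr.
    apply: measurable_funB; first exact: Ms.
    apply: cube_integrable_measurable (@Hk_norm_lty_cube _ k _ _).
    by rewrite -ge0_fin_numE ?Hk_norm_ge0.
  split => //.
  pose e n := Hk_norm k (s n t \- f t).
  have L2e n : (L2 (fun x => s n t x - f t x) <= e n)%E by exact: Hk_norm_Lnorm.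
  have Lf : L2 (f t) \is a fin_num.
    have [n0 _ /(_ n0 (leqnn _)) /= e0] := efin.
    rewrite ge0_fin_numE ?Lnorm_ge0//; apply: le_lt_trans (L2_triangle mf (Ms n0 t)) _.
    apply: lte_add_pinfty; first exact: hfin.
    by apply: le_lt_trans (L2e n0) _; rewrite -ge0_fin_numE ?Hk_norm_ge0.
  suff : h ^~ t @ \oo --> L2 (f t).
    by move=> /[dup] /cvgP/is_cvg_limn_esupE -> /cvg_lim ->.
  apply: (@squeeze_cvge _ _ _ _ (fun n => L2 (f t) - e n)%E _ (fun n => L2 (f t) + e n)%E).
  - apply: filterS efin => n en; apply/andP; split.
      rewrite leeBlDr//.
      apply: le_trans (L2_triangle mf (Ms n t)) _.
      by rewrite leeD2l.
    apply: le_trans (L2_triangle (Ms n t) mf) _.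
    rewrite leeD2l//.
    have -> // : L2 (fun x => f t x - s n t x) = L2 (fun x => s n t x - f t x).
    by rewrite !Lnorm2E; congr (_ `^ _)%E; apply: eq_integral => x _; rewrite -sqrrN opprB.
  - rewrite -[X in _ --> X]sube0; apply: cvgeB => //; [|exact: cvg_cst].
    by rewrite fin_num_adde_defr.
  - rewrite -[X in _ --> X]adde0; apply: cvgeD => //; [|exact: cvg_cst].
    by rewrite fin_num_adde_defr.
have mb : measurable_fun (setT : set T1) b.
  apply: (@measurableT_comp _ _ _ _ _ _ (fun y => (y `^ 2)%E)).
    exact: measurable_poweR.
  exact: measurable_fun_limn_esup.
exists b; split => //.
- by move=> t; exact: poweR_ge0.
- apply: le_lt_trans Iy; rewrite integral_mkcond; apply: lower_integral_le_ae.
  + by move=> t _; rewrite patchE; case: ifPn => // _; exact: poweR_ge0.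
  + by move=> t _; exact: poweR_ge0.
  apply: ae_mono hb => t hb _; rewrite !patchE; case: ifPn => [tT|_]; last exact: poweR_ge0.
  have [_ ht] := hb (set_mem tT).
  by rewrite /b -ht gt0_ler_poweR// ?in_itv/= ?leey ?andbT ?Lnorm_ge0 ?Hk_norm_ge0 ?Hk_norm_Lnorm.
- apply: ae_mono hb => t hb /hb[ft E1]; split => //.
  rewrite /b -E1 poweR_Lnorm// le_eqVlt; apply/orP; left; apply/eqP.
  by apply: eq_integral => x _ /=; rewrite powR_mulrn// real_normK// num_real.
Qed.

End StrongMeasurability.

(** * Space-time test functions *)

Lemma norm_mul_01 (R : realType) (m P C q r : R) : `|m| <= P -> `|m| <= C ->
  0 <= q <= 1 -> 0 <= r <= 1 -> `|m * q * r| <= P * q * r /\ `|m * q * r| <= C.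
Proof.
move=> mP mC /andP[q0 q1] /andP[r0 r1].
have C0 := le_trans (normr_ge0 _) mC.
rewrite !normrM (ger0_norm q0) (ger0_norm r0); split; first by rewrite !ler_wpM2r.
by rewrite -[leRHS]mulr1 ler_pM ?mulr_ge0// -[leRHS]mulr1 ler_pM.
Qed.

Section SpaceTime.
Variable R : realType.
Local Notation E := (space3 R).
Local Notation T1 := (measurableTypeR R).
Local Notation T3 := (T1 * T1 * T1)%type.
Local Notation leb3 := (leb3 R).
Variables (S S' : R -> R) (CS : R).
Hypothesis smS : smooth S.
Hypothesis smS' : smooth S'.
Hypothesis dS : forall x : R, is_derive x 1 S (S' x).
Hypothesis S0 : forall x : R, x <= 0 -> S x = 0.
Hypothesis S1 : forall x : R, 1 <= x -> S x = 1.
Hypothesis S01 : forall x : R, 0 <= S x <= 1.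
Hypothesis S'C : forall x : R, 0 <= S' x <= CS.
Hypothesis S'0 : forall x : R, x <= 0 -> S' x = 0.
Hypothesis S'1 : forall x : R, 1 <= x -> S' x = 0.
Hypothesis CS0 : 0 < CS.

Section Eta.
Variables (t2 h : R).
Hypothesis h0 : 0 < h.

(** The second factor falls from 1 to 0 on [t2 - h, t2]; the first one is 1 for
    [t >= 0] and only makes the support compact. *)
Definition time_ramp (t : R) := S (t + 1) * S (h^-1 * (t2 - t)).
Definition time_ramp' (t : R) :=
  S (t + 1) * (- h^-1 * S' (h^-1 * (t2 - t))) + S (h^-1 * (t2 - t)) * S' (t + 1).

Lemma is_derive_time_ramp (t : R) : is_derive t 1 time_ramp (time_ramp' t).
Proof.
have d1 : is_derive t 1 (fun t => S (t + 1)) (S' (t + 1)).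
  have := @is_derive_comp_affine1 R R (fun y : R => y + 1) (fun y : R => y) S S' t 1.
  rewrite mul1r; apply => // s y v; rewrite /GRing.scale/=; ring.
have d2 : is_derive t 1 (fun t => S (h^-1 * (t2 - t))) (- h^-1 * S' (h^-1 * (t2 - t))).
  have := @is_derive_comp_affine1 R R (fun y : R => h^-1 * (t2 - y))
    (fun y : R => - h^-1 * y) S S' t 1.
  rewrite mulr1; apply => // s y v; rewrite /GRing.scale/=; ring.
exact: (is_deriveM d1 d2).
Qed.

Lemma smooth_time_ramp : smooth time_ramp.
Proof.
move=> n; apply: CkM.
- apply: (Ck_comp_affine1 (l := fun y : R => y + 1) (L := fun y : R => y)) (smS n).
    by move=> t x v; rewrite /GRing.scale/=; ring.
  by move=> y; apply: cvgD; [exact: cvg_id|exact: cvg_cst].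
- apply: (Ck_comp_affine1 (l := fun y : R => h^-1 * (t2 - y))
    (L := fun y : R => - h^-1 * y)) (smS n).
    by move=> t x v; rewrite /GRing.scale/=; ring.
  by move=> y; apply: cvgM; [exact: cvg_cst|];
    apply: cvgB; [exact: cvg_cst|exact: cvg_id].
Qed.

Lemma time_ramp01 (t : R) : 0 <= time_ramp t <= 1.
Proof.
have /andP[s1 s2] := S01 (t + 1); have /andP[s3 s4] := S01 (h^-1 * (t2 - t)).
by rewrite /time_ramp mulr_ge0//= mulr_ile1.
Qed.

Lemma time_ramp_out (t : R) : ~~ (- 1 <= t <= t2) -> time_ramp t = 0.
Proof.
rewrite negb_and -!ltNge => /orP[t1|t1]; rewrite /time_ramp.
  by rewrite S0 ?mul0r//; lra.
by rewrite [X in _ * X]S0 ?mulr0// mulr_ge0_le0 ?invr_ge0 ?(ltW h0)// subr_le0 ltW.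
Qed.

Lemma time_ramp'E (t : R) : 0 <= t -> time_ramp' t = - (h^-1 * S' (h^-1 * (t2 - t))).
Proof.
move=> t0; have t1 : 1 <= t + 1 by rewrite lerDr.
by rewrite /time_ramp' (S1 t1) (S'1 t1) mulr0 addr0 mul1r mulNr.
Qed.

Lemma time_ramp_start : h <= t2 -> time_ramp 0 = 1.
Proof.
move=> ht; rewrite /time_ramp add0r S1// subr0 S1 ?mulr1//.
by rewrite ler_pdivlMl// mulr1.
Qed.

End Eta.

Section Cutoff.
Variables (a b c : R).
Hypothesis a0 : 0 <= a.
Hypothesis b0 : 0 <= b.
Hypothesis c0 : 0 < c.

(** Equal to 1 where c |y| <= a - b t - 1 and to 0 where c |y| >= a - b t: a window
    that closes in at the speed b / c. *)
Definition window (t y : R) := S (a - b * t - c * y) * S (a - b * t + c * y).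
Definition left_edge (t y : R) := S (a - b * t - c * y) * S' (a - b * t + c * y).
Definition right_edge (t y : R) := S (a - b * t + c * y) * S' (a - b * t - c * y).
Definition edge_sum (t y : R) := left_edge t y + right_edge t y.
Definition edge_diff (t y : R) := left_edge t y - right_edge t y.

Definition cutoff t : E -> R := tens3 (window t) (window t) (window t).

(** Up to the factors -b and c, replacing the window of the variable [i] by
    [edge_sum] differentiates the cutoff in time through this variable, while
    [edge_diff] differentiates it in the direction [i]. *)
Definition cutoffp (i : 'I_3) t : E -> R :=
  if val i is i'.+1 then if i' is _.+1 then tens3 (window t) (window t) (edge_sum t)
  else tens3 (window t) (edge_sum t) (window t) else tens3 (edge_sum t) (window t) (window t).
Definition cutoffm (i : 'I_3) t : E -> R :=
  if val i is i'.+1 then if i' is _.+1 then tens3 (window t) (window t) (edge_diff t)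
  else tens3 (window t) (edge_diff t) (window t) else tens3 (edge_diff t) (window t) (window t).

Lemma window01 (t y : R) : 0 <= window t y <= 1.
Proof.
have /andP[s1 s2] := S01 (a - b * t - c * y).
have /andP[s3 s4] := S01 (a - b * t + c * y).
by rewrite /window mulr_ge0//= mulr_ile1.
Qed.

Lemma left_edge_bounds (t y : R) : 0 <= left_edge t y <= CS.
Proof.
have /andP[s1 s2] := S01 (a - b * t - c * y).
have /andP[s3 s4] := S'C (a - b * t + c * y).
by rewrite /left_edge mulr_ge0//= -[leRHS]mul1r ler_pM.
Qed.

Lemma right_edge_bounds (t y : R) : 0 <= right_edge t y <= CS.
Proof.
have /andP[s1 s2] := S01 (a - b * t + c * y).
have /andP[s3 s4] := S'C (a - b * t - c * y).
by rewrite /right_edge mulr_ge0//= -[leRHS]mul1r ler_pM.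
Qed.

(** This domination of the space derivative by the time derivative is what gives
    the transport derivative of the cutoff a sign. *)
Lemma edge_diff_le (t y : R) :
  `|edge_diff t y| <= edge_sum t y /\ `|edge_diff t y| <= CS.
Proof.
rewrite /edge_diff /edge_sum.
have /andP[? ?] := left_edge_bounds t y.
have /andP[? ?] := right_edge_bounds t y.
by split; rewrite ler_norml; apply/andP; split; lra.
Qed.

Lemma edge_sum_le (t y : R) : 0 <= edge_sum t y <= 2 * CS.
Proof.
rewrite /edge_sum.
have /andP[? ?] := left_edge_bounds t y.
have /andP[? ?] := right_edge_bounds t y.
by apply/andP; split; lra.
Qed.

Definition cutoff_radius := (a + b) / c.

Lemma window_out (t y : R) : - 1 <= t -> cutoff_radius < `|y| ->
  [/\ window t y = 0, left_edge t y = 0 & right_edge t y = 0].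
Proof.
rewrite /cutoff_radius ltr_pdivrMr// => t1 yr.
have H : a - b * t < c * `|y|.
  rewrite [c * _]mulrC; apply: le_lt_trans yr.
  have : b * - t <= b * 1 by rewrite ler_wpM2l// lerNl.
  by rewrite mulr1; lra.
rewrite /window /left_edge /right_edge; have [y0|y0] := leP 0 y.
  move: H; rewrite ger0_norm// => H.
  have k0 : a - b * t - c * y <= 0 by rewrite subr_le0 ltW.
  by rewrite (S0 k0) (S'0 k0) !mul0r mulr0.
move: H; rewrite ltr0_norm// mulrN => H.
have k0 : a - b * t + c * y <= 0 by lra.
by rewrite (S0 k0) (S'0 k0) !mulr0 mul0r.
Qed.

Lemma window_in (t y r : R) : `|y| <= r -> 1 <= a - b * t - c * r -> window t y = 1.
Proof.
rewrite ler_norml => /andP[y1 y2] H.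
have c1 : c * y <= c * r by rewrite ler_pM2l.
have c2 : - (c * r) <= c * y by rewrite -mulrN ler_pM2l.
by rewrite /window !S1 ?mulr1//; lra.
Qed.

Lemma cutoff01 (t : R) x : 0 <= cutoff t x <= 1.
Proof.
rewrite /cutoff /tens3.
have /andP[p0 p1] := window01 t x.1.1; have /andP[q0 q1] := window01 t x.1.2.
have /andP[r0 r1] := window01 t x.2.
by move: (window _ _) (window _ _) (window _ _) p0 p1 q0 q1 r0 r1 => p q r *;
  rewrite !mulr_ge0//= mulr_ile1 ?mulr_ge0// mulr_ile1.
Qed.

Lemma cutoff_in (t : R) (x : E) r :
  cube r x -> 1 <= a - b * t - c * r -> cutoff t x = 1.
Proof.
by move=> /in_cube[x1 x2 x3] H; rewrite /cutoff /tens3 !(window_in (r := r))// !mulr1.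
Qed.

Lemma cutoffm_le (i : 'I_3) (t : R) x :
  `|cutoffm i t x| <= cutoffp i t x /\ `|cutoffm i t x| <= CS.
Proof.
have w1 := window01 t x.1.1; have w2 := window01 t x.1.2; have w3 := window01 t x.2.
have [m1 n1] := edge_diff_le t x.1.1; have [m2 n2] := edge_diff_le t x.1.2.
have [m3 n3] := edge_diff_le t x.2.
rewrite /cutoffm /cutoffp; case: i => -[|[|i]] /= _; rewrite /tens3.
- exact: norm_mul_01.
- by rewrite ![window _ _ * _]mulrC; exact: norm_mul_01.
- have e z : window t x.1.1 * window t x.1.2 * z = z * window t x.1.1 * window t x.1.2.
    by rewrite mulrC mulrA.
  by rewrite !e; exact: norm_mul_01.
Qed.

Lemma cutoffp_le (i : 'I_3) (t : R) x : 0 <= cutoffp i t x <= 2 * CS.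
Proof.
have [+ _] := cutoffm_le i t x => /(le_trans (normr_ge0 _)) ->/=.
have w1 := window01 t x.1.1; have w2 := window01 t x.1.2; have w3 := window01 t x.2.
have N y : `|edge_sum t y| <= 2 * CS.
  by have /andP[? ?] := edge_sum_le t y; rewrite ger0_norm.
apply: le_trans (ler_norm _) _.
rewrite /cutoffp; case: i => -[|[|i]] /= _; rewrite /tens3.
- by apply: (norm_mul_01 (N _) (N _) _ _).2.
- by rewrite [window _ _ * _]mulrC; apply: (norm_mul_01 (N _) (N _) _ _).2.
- by rewrite [window _ _ * window _ _ * _]mulrC mulrA; apply: (norm_mul_01 (N _) (N _) _ _).2.
Qed.

Lemma cutoff_out (t : R) (x : E) : - 1 <= t -> ~ cube cutoff_radius x -> cutoff t x = 0.
Proof.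
move=> t1; apply: tens3_out => y yr; by have [] := window_out t1 yr.
Qed.

Lemma window_continuous (t : R) : continuous (window t).
Proof.
have cS := Ck_continuous (smS 0).
move=> y; apply: cvgM.
  apply: (@continuous_comp _ _ _ (fun y => a - b * t - c * y) S); last exact: cS.
  apply: cvgB; first exact: cvg_cst.
  by apply: cvgM; [exact: cvg_cst|exact: cvg_id].
apply: (@continuous_comp _ _ _ (fun y => a - b * t + c * y) S); last exact: cS.
apply: cvgD; first exact: cvg_cst.
by apply: cvgM; [exact: cvg_cst|exact: cvg_id].
Qed.

Lemma measurable_cutoff (t : R) : measurable_fun (setT : set T3) (cutoff t).
Proof. by apply: measurable_tens3; exact: window_continuous. Qed.

Lemma cutoffpm_out i (t : R) (x : E) : - 1 <= t -> ~ cube cutoff_radius x ->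
  cutoffp i t x = 0 /\ cutoffm i t x = 0.
Proof.
move=> t1 xr.
have o1 y : cutoff_radius < `|y| -> window t y = 0 by move=> /(window_out t1)[].
have o2 y : cutoff_radius < `|y| -> edge_sum t y = 0.
  by move=> /(window_out t1)[_]; rewrite /edge_sum => -> ->; rewrite addr0.
have o3 y : cutoff_radius < `|y| -> edge_diff t y = 0.
  by move=> /(window_out t1)[_]; rewrite /edge_diff => -> ->; rewrite subr0.
rewrite /cutoffp /cutoffm; case: i => -[|[|i]] /= _;
  by split; apply: tens3_out xr.
Qed.

Variables (t2 h : R).
Hypothesis h0 : 0 < h.

Definition spacetime_test (p : R * E) : R := time_ramp t2 h p.1 * cutoff p.1 p.2.

Let lm (l : E -> R) (p : R * E) : R := a - b * p.1 - c * l p.2.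
Let lp (l : E -> R) (p : R * E) : R := a - b * p.1 + c * l p.2.

Lemma smooth_window (l : E -> R) :
  (forall (s : R) x v, l (s *: v + x) = s * l v + l x) -> continuous l ->
  smooth (fun p : R * E => window p.1 (l p.2)).
Proof.
move=> ll cl n; apply: CkM.
- apply: (Ck_comp_affine1 (l := lm l) (L := fun p : R * E => - b * p.1 - c * l p.2)) (smS n).
    by move=> s x v; rewrite /lm/= ll /GRing.scale/=; ring.
  move=> p; apply: cvgB.
    by apply: cvgB; [exact: cvg_cst|apply: cvgM; [exact: cvg_cst|exact: cvg_fst]].
  apply: cvgM; first exact: cvg_cst.
  by apply: (@continuous_comp _ _ _ snd l); [exact: cvg_snd|exact: cl].
- apply: (Ck_comp_affine1 (l := lp l) (L := fun p : R * E => - b * p.1 + c * l p.2)) (smS n).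
    by move=> s x v; rewrite /lp/= ll /GRing.scale/=; ring.
  move=> p; apply: cvgD.
    by apply: cvgB; [exact: cvg_cst|apply: cvgM; [exact: cvg_cst|exact: cvg_fst]].
  apply: cvgM; first exact: cvg_cst.
  by apply: (@continuous_comp _ _ _ snd l); [exact: cvg_snd|exact: cl].
Qed.

Lemma is_derive_window (l : E -> R) (p v : R * E) :
  (forall (s : R) x v, l (s *: v + x) = s * l v + l x) ->
  is_derive p v (fun p : R * E => window p.1 (l p.2))
    (- b * v.1 * edge_sum p.1 (l p.2) + c * l v.2 * edge_diff p.1 (l p.2)).
Proof.
move=> ll.
have d1 := @is_derive_comp_affine1 R _ (lm l) (fun p : R * E => - b * p.1 - c * l p.2)
  S S' p v.
have d2 := @is_derive_comp_affine1 R _ (lp l) (fun p : R * E => - b * p.1 + c * l p.2)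
  S S' p v.
have {}d1 := d1 _ dS; have {}d2 := d2 _ dS.
have D := is_deriveM (d1 _) (d2 _).
apply: (is_derive_eq (D _ _)).
- by move=> s x w; rewrite /lm/= ll /GRing.scale/=; ring.
- by move=> s x w; rewrite /lp/= ll /GRing.scale/=; ring.
- rewrite /GRing.scale/= /edge_sum /edge_diff /left_edge /right_edge /lm /lp; ring.
Qed.

Lemma smooth_spacetime_test : smooth spacetime_test.
Proof.
have c1 := @continuous_crd1 R; have c2 := @continuous_crd2 R; have c3 := @continuous_crd3 R.
move=> n; apply: CkM.
  apply: (Ck_comp_affine1 (l := fst) (L := fst)) (smooth_time_ramp t2 h n) => //.
  by move=> p; exact: cvg_fst.
apply: CkM; first apply: CkM.
- exact: (smooth_window (l := fun x : E => x.1.1)).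
- exact: (smooth_window (l := fun x : E => x.1.2)).
- exact: (smooth_window (l := fun x : E => x.2)).
Qed.

Lemma is_derive_spacetime_test (p v : R * E) : is_derive p v spacetime_test
  (v.1 * time_ramp' t2 h p.1 * cutoff p.1 p.2 - b * v.1 * time_ramp t2 h p.1 *
     (cutoffp axis0 p.1 p.2 + cutoffp axis1 p.1 p.2 + cutoffp axis2 p.1 p.2)
   + c * time_ramp t2 h p.1 * (v.2.1.1 * cutoffm axis0 p.1 p.2 + v.2.1.2 * cutoffm axis1 p.1 p.2
       + v.2.2 * cutoffm axis2 p.1 p.2)).
Proof.
have d0 := @is_derive_comp_affine1 R _ fst fst (time_ramp t2 h) (time_ramp' t2 h) p v
  (fun _ _ _ => erefl) (is_derive_time_ramp t2 h).
have d1 := @is_derive_window (fun x : E => x.1.1) p v (fun _ _ _ => erefl).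
have d2 := @is_derive_window (fun x : E => x.1.2) p v (fun _ _ _ => erefl).
have d3 := @is_derive_window (fun x : E => x.2) p v (fun _ _ _ => erefl).
have D := is_deriveM d0 (is_deriveM (is_deriveM d1 d2) d3).
apply: (is_derive_eq D).
rewrite /GRing.scale/= /cutoff /cutoffp /cutoffm /tens3 !fctE/=; ring.
Qed.

Lemma d_t_spacetime_test t x : d_t spacetime_test t x = time_ramp' t2 h t * cutoff t x
  - b * time_ramp t2 h t * \sum_(i < 3) cutoffp i t x.
Proof.
rewrite /d_t (@derive_val _ _ _ _ _ _ _ (is_derive_spacetime_test _ _))/=.
rewrite !big_ord_recl big_ord0.
have -> : cutoffp ord0 t x = cutoffp axis0 t x by [].
have -> : cutoffp (lift ord0 ord0) t x = cutoffp axis1 t x by [].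
have -> : cutoffp (lift ord0 (lift ord0 ord0)) t x = cutoffp axis2 t x by [].
by rewrite /=; ring.
Qed.

Lemma d_x_spacetime_test j t x : d_x j spacetime_test t x = c * time_ramp t2 h t * cutoffm j t x.
Proof.
rewrite /d_x (@derive_val _ _ _ _ _ _ _ (is_derive_spacetime_test _ _))/=.
case: j => -[|[|[|j]]]//= jlt; rewrite /basis3/= !(mulr0, mul0r, oppr0, add0r, addr0, mul1r).
- by congr (_ * cutoffm _ t x); apply/val_inj.
- by congr (_ * cutoffm _ t x); apply/val_inj.
- by congr (_ * cutoffm _ t x); apply/val_inj.
Qed.

Lemma test_spacetime_test T : t2 < T -> test_function (strip T) spacetime_test.
Proof.
move=> t2T; split; first exact: smooth_spacetime_test.
exists (`[- 1, t2] `*` cube cutoff_radius); split.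
- by apply: compact_setX; [exact: segment_compact|exact: compact_cube].
- by move=> [t x] /= []; rewrite in_itv/= => /andP[_ tt2] _; exact: le_lt_trans t2T.
- move=> [t x] /= /not_andP; rewrite /spacetime_test/= in_itv/=.
  have [tt|tt] := boolP (- 1 <= t <= t2); last by rewrite (time_ramp_out h0 tt) mul0r.
  case=> // xr; have /andP[t1 _] := tt.
  by rewrite cutoff_out ?mulr0.
Qed.

(** For velocities bounded by the speed [b] at which the cutoff retreats, the
    transport term has a sign up to the contribution of the ramp in time. *)
Lemma spacetime_test_transport (v : 'I_3 -> R) (t : R) (x : E) :
  c = 1 -> 0 <= t ->
  (forall i, `|v i| <= b) ->
  let D := d_t spacetime_test t x + \sum_(j < 3) v j * d_x j spacetime_test t x in
  h^-1 * S' (h^-1 * (t2 - t)) * cutoff t x <= - D /\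
  - D <= (h^-1 * CS + 12 * b * CS) * \1_(cube cutoff_radius) x.
Proof.
move=> c1 t0 vb D; have t1 : - 1 <= t by rewrite (le_trans _ t0)// oppr_le0.
pose P := \sum_(i < 3) cutoffp i t x.
pose M := \sum_(j < 3) v j * cutoffm j t x.
have DE : - D = h^-1 * S' (h^-1 * (t2 - t)) * cutoff t x
    + time_ramp t2 h t * (b * P - M).
  rewrite /D d_t_spacetime_test time_ramp'E// -/P.
  have -> : \sum_(j < 3) v j * d_x j spacetime_test t x = time_ramp t2 h t * M.
    by rewrite /M mulr_sumr; apply: eq_bigr => j _; rewrite d_x_spacetime_test c1; ring.
  ring.
have MP : `|M| <= b * P.
  rewrite /M /P mulr_sumr; apply: le_trans (ler_norm_sum _ _ _) _.
  by apply: ler_sum => j _; rewrite normrM ler_pM//; exact: (cutoffm_le _ _ _).1.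
have P6 : P <= 6 * CS.
  rewrite /P; apply: (@le_trans _ _ (\sum_(i < 3) 2 * CS)).
    by apply: ler_sum => i _; have /andP[] := cutoffp_le i t x.
  by rewrite sumr_const card_ord -mulr_natr; lra.
have /andP[e0 e1] := time_ramp01 t2 h t.
have bM : 0 <= b * P - M by move: MP; rewrite ler_norml => /andP[]; lra.
split; first by rewrite DE lerDl mulr_ge0.
have [xr|xr] := pselect (cube cutoff_radius x); last first.
  have cp i := (cutoffpm_out i t1 xr).1; have cm i := (cutoffpm_out i t1 xr).2.
  rewrite DE cutoff_out// /P /M big1; last by move=> i _; exact: cp.
  rewrite big1; last by move=> i _; rewrite cm mulr0.
  by rewrite !mulr0 subrr mulr0 addr0 indicE memNset// mulr0.
rewrite indicE mem_set// mulr1 DE lerD//.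
  have /andP[s0 s1] := S'C (h^-1 * (t2 - t)).
  have /andP[q0 q1] := cutoff01 t x.
  rewrite -[leRHS]mulr1 ler_pM// ?mulr_ge0 ?invr_ge0 ?(ltW h0)//.
  by rewrite ler_pM2l// invr_gt0.
have bP : b * P <= b * (6 * CS) by rewrite ler_wpM2l.
rewrite -[leRHS]mul1r ler_pM//.
by move: MP; rewrite ler_norml => /andP[]; lra.
Qed.

End Cutoff.
End SpaceTime.

(** * Conservation of mass and momentum *)

Lemma ae_forall d (X : measurableType d) (R : realType) (mu : {measure set X -> \bar R})
    (I : finType) (P : I -> X -> Prop) :
  (forall i, {ae mu, forall x, P i x}) -> {ae mu, forall x, forall i, P i x}.
Proof. exact: filter_forall. Qed.

(** The integrable majorant [B] of [- F] excludes the default value 0, so that [J]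
    can be compared with the actual integral of [F]. *)
Lemma le_Rintegral_npos d (X : measurableType d) (R : realType)
    (mu : {measure set X -> \bar R}) (D : set X) (F : X -> R) (J B : X -> \bar R) :
  (forall x, D x -> 0 <= J x)%E -> (forall x, D x -> 0 <= B x)%E ->
  {ae mu, forall x, D x -> (J x <= (- F x)%:E)%E} ->
  {ae mu, forall x, D x -> ((- F x)%:E <= B x)%E} ->
  (\int[mu]_(x in D) B x < +oo)%E ->
  (\int[mu]_(x in D) J x <= (- \int[mu]_(x in D) F x)%:E)%E.
Proof.
move=> J0 B0 JF FB By.
have F0 : {ae mu, forall x, D x -> F x <= 0}.
  apply: ae_mono JF => x JF Dx; have := le_trans (J0 x Dx) (JF Dx).
  by rewrite lee_fin oppr_ge0.
have P0 : (\int[mu]_(x in D) (fun x => (F x)%:E)^\+ x = 0)%E.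
  apply/eqP; rewrite eq_le integral_ge0// andbT.
  rewrite -(integral0 mu D); apply: lower_integral_le_ae => //.
  apply: ae_mono F0 => x F0 Dx.
  by rewrite funeposE -EFin_max lee_fin ge_max lexx andbT F0.
have My : (\int[mu]_(x in D) (fun x => (F x)%:E)^\- x < +oo)%E.
  apply: le_lt_trans By; apply: lower_integral_le_ae => //.
  apply: ae_mono FB => x FB Dx.
  by rewrite funenegE ge_max -EFinN FB// B0.
rewrite /Rintegral [X in fine X]integralE P0 add0e fineN opprK fineK; last first.
  by rewrite ge0_fin_numE// integral_ge0.
apply: lower_integral_le_ae => //.
apply: ae_mono JF => x JF /JF /le_trans; apply.
by rewrite funenegE -EFinN le_max lexx.
Qed.

Section CubeIntegrals.
Variable R : realType.
Local Notation E := (space3 R).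
Local Notation T1 := (measurableTypeR R).
Local Notation T3 := (T1 * T1 * T1)%type.
Local Notation leb3 := (leb3 R).

Lemma cubeS r r' : r <= r' -> (cube r : set E) `<=` cube r'.
Proof. by move=> rr x /cube_norm xr; apply/cube_norm; exact: le_trans rr. Qed.

Lemma integral_cube_sup (f : E -> R) (M : \bar R) :
  measurable_fun (setT : set T3) f -> (forall x, 0 <= f x) ->
  (M < \int[leb3]_x (f x)%:E)%E -> exists r0 : R, forall r, r0 <= r ->
    (M < \int[leb3]_(x in cube r) (f x)%:E)%E.
Proof.
move=> mf f0 Mf; apply: contrapT => H; move: Mf; apply/negP; rewrite -leNgt.
have mE r : measurable_fun (cube r : set T3) (EFin \o f).
  by apply/measurable_EFinP; exact: measurable_funTS.
have cv := @ge0_nondecreasing_set_cvg_integral _ T3 R (fun n : nat => cube n%:R)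
  (EFin \o f) leb3 _ (fun n => measurable_cube n%:R) (fun n => mE n%:R) _.
rewrite bigcup_cube in cv.
apply: cvge_le (cv _ _); first last.
- by move=> n x _; rewrite lee_fin.
- move=> m n mn; rewrite subsetEset; apply: cubeS; by rewrite ler_nat.
apply: nearW => n; rewrite leNgt; apply/negP => Mn; apply: H; exists n%:R => r nr.
apply: lt_le_trans Mn _; apply: ge0_subset_integral => //.
- exact: measurable_cube.
- exact: measurable_cube.
- by move=> x _; rewrite lee_fin.
- exact: cubeS.
Qed.

Lemma integral_cst_cube (K r : R) :
  (\int[leb3]_x (K * \1_(cube r) x)%:E = K%:E * leb3 (cube r))%E.
Proof.
rewrite -integral_cst; last exact: measurable_cube.
rewrite [RHS]integral_mkcond; apply: eq_integral => x _.
by rewrite patchE indicE; case: ifPn => _; rewrite ?mulr1// mulr0.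
Qed.

End CubeIntegrals.

Section Conservation.
Variable R : realType.
Local Notation E := (space3 R).
Local Notation T1 := (measurableTypeR R).
Local Notation T3 := (T1 * T1 * T1)%type.
Local Notation leb3 := (leb3 R).
Local Notation leb1 := (leb1 R).
Variables (S S' : R -> R) (CS : R).
Hypothesis smS : smooth S.
Hypothesis smS' : smooth S'.
Hypothesis dS : forall x : R, is_derive x 1 S (S' x).
Hypothesis S0 : forall x : R, x <= 0 -> S x = 0.
Hypothesis S1 : forall x : R, 1 <= x -> S x = 1.
Hypothesis S01 : forall x : R, 0 <= S x <= 1.
Hypothesis S'C : forall x : R, 0 <= S' x <= CS.
Hypothesis S'0 : forall x : R, x <= 0 -> S' x = 0.
Hypothesis S'1 : forall x : R, 1 <= x -> S' x = 0.
Hypothesis CS0 : 0 < CS.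

(** The integral of the derivative of the ramp, from 1 down to 0. *)
Lemma integral_ramp (t0 h : R) : 0 < h ->
  (\int[leb1]_(t in `[t0, (t0 + h)%R]%classic)
     (h^-1 * S' (h^-1 * (t0 + h - t)))%:E = 1)%E.
Proof.
move=> h0.
have th : t0 < t0 + h by rewrite ltrDl.
pose F (t : R) := - S (h^-1 * (t0 + h - t)).
have dF (t : R) : is_derive t 1 F (h^-1 * S' (h^-1 * (t0 + h - t))).
  have := @is_derive_comp_affine1 R R (fun y : R => h^-1 * (t0 + h - y))
    (fun y : R => - h^-1 * y) S S' t 1.
  rewrite mulr1 => D; have {}D := is_deriveN (D _ dS).
  rewrite -[h^-1 * S' _]opprK -mulNr; apply: D.
  by move=> s y v; rewrite /GRing.scale/=; ring.
have cF : continuous F.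
  by move=> t; apply: differentiable_continuous; apply/derivable1_diffP; exact: ex_derive.
rewrite (@continuous_FTC2 _ _ F t0 (t0 + h) th).
- rewrite /F subrr mulr0 (S0 (lexx 0)) [t0 + h]addrC addrK mulVf ?gt_eqF// (S1 (lexx 1)).
  by rewrite oppr0 sub0e EFinN oppeK.
- apply: continuous_subspaceT => t; apply: cvgM; first exact: cvg_cst.
  apply: (@continuous_comp _ _ _ (fun t => h^-1 * (t0 + h - t)) S').
    by apply: cvgM; [exact: cvg_cst|apply: cvgB; [exact: cvg_cst|exact: cvg_id]].
  exact: (Ck_continuous (smS' 0)).
- split.
  + by move=> t _; exact: ex_derive.
  + by apply: cvg_at_right_filter; exact: cF.
  + by apply: cvg_at_left_filter; exact: cF.
- by move=> t _; rewrite derive1E; exact: derive_val.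
Qed.

Variables (A gam del alp bet eps : R).
Variables (rho0 : E -> R) (u0 : 'I_3 -> E -> R).
Variables (rho : R -> E -> R) (u : R -> 'I_3 -> E -> R).
Hypothesis A0 : 0 < A.
Hypothesis gam1 : 1 < gam.

(* These properties of the solution are all that the argument uses; they hold in
   both regularity classes. *)
Hypothesis rho_ge0 : forall (t : R) x, 0 <= t -> 0 <= rho t x.
Hypothesis rho_meas : forall t : R, 0 <= t -> measurable_fun (setT : set T3) (rho t).
Hypothesis rho_bnd : forall T : R, 0 < T -> exists K : R, 0 < K /\
  forall t : R, t \in `[0, T] -> {ae leb3, forall x, rho t x <= K}.
Hypothesis rho_cont : forall T : R, 0 < T -> forall t0 : R, t0 \in `[0, T] ->
  forall e : R, 0 < e -> exists d : R, 0 < d /\ forall t : R, t \in `[0, T] -> `|t - t0| < d ->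
    {ae leb3, forall x, `|rho t x - rho t0 x| <= e}.
Hypothesis u_bnd : forall T : R, 0 < T -> exists V : R, 0 < V /\
  {ae leb1, forall t, t \in `[0, T] -> forall i, {ae leb3, forall x, `|u t i x| <= V}}.
Hypothesis stress_bnd : forall T : R, 0 < T -> exists (C : R) (b : R -> \bar R),
  [/\ 0 < C, measurable_fun (setT : set T1) b, forall t, (0 <= b t)%E,
      (\int[leb1]_(t in `[0%R, T]%classic) b t < +oo)%E &
  {ae leb1, forall t, t \in `[0, T] -> exists q : E -> R,
     [/\ measurable_fun (setT : set T3) q, forall x, 0 <= q x,
      (\int[leb3]_x (q x)%:E <= b t)%E &
      forall i j, {ae leb3, forall x,
        `|eps * stress del alp bet rho u t i j x| <= C * (rho t x + q x)}]}].
Hypothesis rho_init : rho 0 = rho0.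
Hypothesis mom_int : forall i, leb3.-integrable setT (fun x => (rho0 x * u0 i x)%:E).
Hypothesis ceq : forall T : R, 0 < T -> continuity_eq rho0 rho u T.
Hypothesis meq : forall T : R, 0 < T ->
  momentum_eq A gam del alp bet eps rho0 u0 rho u T.
Hypothesis m0_gt0 : (0 < total_mass rho0)%E.
Hypothesis m0_lty : (total_mass rho0 < +oo)%E.

Let m0 := fine (total_mass rho0).

Lemma m0E : total_mass rho0 = m0%:E.
Proof. by rewrite /m0 fineK// ge0_fin_numE// ltW. Qed.

(** Continuity in time, uniform in space, moves the mass of a cube of finite volume
    by little; a gap below the mass at [t0] survives at nearby times. *)
Lemma cube_mass_stable (T t0 r M : R) : 0 < T -> t0 \in `[0, T] ->
  (M%:E < \int[leb3]_(x in cube r) (rho t0 x)%:E)%E ->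
  exists d M1, [/\ 0 < d, M < M1 & forall t, t \in `[0, T] -> `|t - t0| < d ->
    (M1%:E <= \int[leb3]_(x in cube r) (rho t x)%:E)%E].
Proof.
move=> T0 t0T MI.
have vfin : leb3 (cube r) \is a fin_num by rewrite ge0_fin_numE// leb3_cube_fin.
pose v := fine (leb3 (cube r)).
have v0 : 0 <= v by rewrite fine_ge0.
have pos t : t \in `[0, T] -> 0 <= t by rewrite in_itv/= => /andP[].
have [e [M1 [e0 MM1 H]]] : exists e M1, [/\ 0 < e, M < M1 &
    ((M1 + e * v)%:E <= \int[leb3]_(x in cube r) (rho t0 x)%:E)%E].
  case: (\int[leb3]_(x in cube r) (rho t0 x)%:E)%E MI => [I|_|//]; last first.
    by exists 1, (M + 1); split; rewrite ?ltrDl// leey.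
  rewrite lte_fin => MI; pose g := (I - M) / (v + 2).
  have v2 : 0 < v + 2 by rewrite ltr_wpDl.
  have g0 : 0 < g by rewrite divr_gt0// subr_gt0.
  have gE : g * (v + 2) = I - M by rewrite /g divfK// gt_eqF.
  exists g, (M + g); split => //; first by rewrite ltrDl.
  by rewrite lee_fin; move: gE; rewrite mulrDr; lra.
have [d [d0 Hd]] := rho_cont T0 t0T e0.
exists d, M1; split => // t tT td.
have mc := @measurable_cube R r.
have mr s : s \in `[0, T] -> measurable_fun (cube r : set T3) (fun x => (rho s x)%:E).
  by move=> /pos /rho_meas ms; apply/measurable_EFinP; exact: measurable_funTS.
have : (\int[leb3]_(x in cube r) (rho t0 x)%:E <=
        \int[leb3]_(x in cube r) ((rho t x)%:E + e%:E))%E.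
  apply: ae_ge0_le_integral => //.
  - by move=> x _; rewrite lee_fin rho_ge0// pos.
  - exact: mr.
  - by move=> x _; have := rho_ge0 x (pos t tT); rewrite -EFinD lee_fin; lra.
  - by apply: emeasurable_funD => //; exact: mr.
  apply: ae_mono (Hd t tT td) => x + _; rewrite -EFinD lee_fin ler_norml => /andP[]; lra.
rewrite ge0_integralD//; last 3 first.
- by move=> x _; rewrite lee_fin rho_ge0// pos.
- exact: mr.
- by move=> x _; rewrite lee_fin ltW.
rewrite integral_cst// => /(le_trans H).
rewrite -[leb3 (cube r)]fineK// -EFinM EFinD leeD2rE//.
Qed.

(** Otherwise some cube has a mass larger than [M1 > m0] during a short time
    interval [t0, t0 + h].  The window contains this cube all along, and the ramp
    falls in this interval; as the transport term has a sign, the continuity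
    equation bounds [M1] by the mass at time 0 weighted by the window, which is at
    most [m0]. *)
Lemma mass_le (t0 : R) : 0 <= t0 -> (\int[leb3]_x (rho t0 x)%:E <= total_mass rho0)%E.
Proof.
move=> t00; rewrite leNgt; apply/negP; rewrite m0E => Hlt.
have m0' : 0 < m0 by rewrite -lte_fin -m0E.
have rr0 x : 0 <= rho0 x by rewrite -rho_init; exact: rho_ge0.
have mrho0 : measurable_fun (setT : set T3) rho0 by rewrite -rho_init; exact: rho_meas.
have [r1 Hr1] := integral_cube_sup (rho_meas t00) (fun x => rho_ge0 x t00) Hlt.
have [r2 Hr2] := integral_cube_sup mrho0 rr0 m0_gt0.
pose r := Num.max r1 (Num.max r2 0).
have {}Hr1 := Hr1 r _; have {}Hr2 := Hr2 r _.
have {}Hr1 := Hr1 (ltac:(by rewrite !le_max lexx)).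
have {}Hr2 := Hr2 (ltac:(by rewrite !le_max lexx orbT)).
have r0 : 0 <= r by rewrite !le_max lexx !orbT.
pose T := t0 + 2.
have T0 : 0 < T by rewrite ltr_wpDl.
have t0T : t0 \in `[0, T] by rewrite in_itv/= t00/= /T lerDl ler0n.
have [d [M1 [d0 mM1 HM1]]] := cube_mass_stable T0 t0T Hr1.
(* The ramp must end before [t0 + d], and [h <= 1] keeps it within [0, T]. *)
pose h := Num.min (d / 2) 1.
have h0 : 0 < h by rewrite lt_min ltr01 divr_gt0.
have hd : h < d by rewrite gt_min ltr_pdivrMr// ltr_pMr// ltr1n.
have h1 : h <= 1 by rewrite ge_min lexx orbT.
have [K [K0 HK]] := rho_bnd T0.
have [V [V0 HV]] := u_bnd T0.
pose t2 := t0 + h.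
have t2T : t2 < T by rewrite /t2 /T ltrD2l (le_lt_trans h1)// ltr1n.
(* The window closes in by at most V T and still contains the cube of radius r. *)
pose a := 1 + V * T + r.
have a0 : 0 <= a by rewrite !addr_ge0// mulr_ge0// ltW.
pose phi := spacetime_test S a V 1 t2 h.
have test : test_function (strip T) phi.
  by apply: test_spacetime_test => //; exact: ltW.
have cin (t : R) x : 0 <= t -> t <= T -> cube r x -> cutoff S a V 1 t x = 1.
  move=> tt0 tT xr; apply: (cutoff_in S1 ltr01 xr).
  have : V * t <= V * T by rewrite ler_pM2l.
  by rewrite /a; lra.
pose m := \int[leb3]_x (rho0 x * phi (0, x)).
have phi0 x : phi (0, x) = cutoff S a V 1 0 x.
  by rewrite /phi /spacetime_test/= time_ramp_start// ?mul1r// /t2 lerDr.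
have phi01 x : 0 <= phi (0, x) <= 1 by rewrite phi0; exact: cutoff01.
have mphi : measurable_fun (setT : set T3) (fun x => rho0 x * phi (0, x)).
  have -> : (fun x => rho0 x * phi (0, x)) = (fun x => rho0 x * cutoff S a V 1 0 x).
    by apply/funext => x; rewrite phi0.
  by apply: measurable_funM => //; exact: measurable_cutoff.
have rp0 x : 0 <= rho0 x * phi (0, x).
  by rewrite mulr_ge0//; have /andP[] := phi01 x.
have Ile : (\int[leb3]_x (rho0 x * phi (0, x))%:E <= m0%:E)%E.
  rewrite -m0E; apply: ge0_le_integral => //.
  - by move=> x _; rewrite lee_fin.
  - exact/measurable_EFinP.
  - exact/measurable_EFinP.
  - move=> x _; rewrite lee_fin ler_piMr//; by have /andP[] := phi01 x.
have Igt : (0 < \int[leb3]_x (rho0 x * phi (0, x))%:E)%E.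
  apply: (lt_le_trans Hr2); rewrite integral_mkcond; apply: ge0_le_integral => //.
  - by move=> x _; rewrite patchE; case: ifPn => //; rewrite lee_fin.
  - apply/(measurable_restrictT _ (measurable_cube r)).
    by apply/measurable_EFinP; exact: measurable_funTS.
  - exact/measurable_EFinP.
  - move=> x _; rewrite patchE; case: ifPn => [xr|_]; last by rewrite lee_fin.
    rewrite lee_fin phi0 cin ?mulr1//; first exact: ltW.
    exact: set_mem.
have mE : (\int[leb3]_x (rho0 x * phi (0, x))%:E = m%:E)%E.
  rewrite /m /Rintegral fineK// fin_numE; apply/andP; split.
    by rewrite gt_eqF// (lt_trans _ Igt)// ltNy0.
  by rewrite lt_eqF// (le_lt_trans Ile)// ltry.
have m_gt0 : 0 < m by rewrite -lte_fin -mE.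
have m_le : m <= m0 by rewrite -lee_fin -mE.
pose G t := \int[leb3]_x (rho t x * d_t phi t x
   + \sum_(j < 3) rho t x * u t j x * d_x j phi t x).
have GE : \int[leb1]_(t in `[0, T]%classic) G t = - m.
  by apply/eqP; rewrite -addr_eq0; apply/eqP; exact: ceq T0 _ test.
pose g (t : R) : \bar R :=
  if (t0 <= t <= t2) then (M1 * (h^-1 * S' (h^-1 * (t2 - t))))%:E else 0%E.
have M10 : 0 < M1 by exact: lt_trans mM1.
have hi0 : 0 <= h^-1 by rewrite invr_ge0 ltW.
have S'ge0 y : 0 <= S' y by have /andP[] := S'C y.
have S'le y : S' y <= CS by have /andP[] := S'C y.
have gle : (\int[leb1]_(t in `[0%R, T]%classic) g t <= m%:E)%E.
  apply: (le_of_Rintegral_npos m_gt0 _ _ GE).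
    by move=> t _; rewrite /g; case: ifPn => // _; rewrite lee_fin !mulr_ge0// ltW.
  apply: ae_mono HV => t HVt; rewrite -[t \in _]/(t \in `[0, T]) in HVt *.
  move=> tT'; have tT : t \in `[0, T] by [].
  have tt0 : 0 <= t by move: tT; rewrite in_itv/= => /andP[].
  have tT2 : t <= T by move: tT; rewrite in_itv/= => /andP[].
  have Vi := HVt tT.
  have m1t : -1 <= t by rewrite (le_trans _ tt0)// oppr_le0.
  pose rad := cutoff_radius a V 1.
  pose B (x : E) : \bar R := (K * (h^-1 * CS + 12 * V * CS) * \1_(cube rad) x)%:E.
  pose J (x : E) : \bar R := ((h^-1 * S' (h^-1 * (t2 - t))) * (rho t x * \1_(cube r) x))%:E.
  have JG : (\int[leb3]_x J x <= (- G t)%:E)%E.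
    have Vall : {ae leb3, forall x, (forall i, `|u t i x| <= V) /\ rho t x <= K}.
      have := HK t tT; apply: ae_mono2 (ae_forall Vi) => x v1 v2; exact: conj.
    have ineqs x : (forall i, `|u t i x| <= V) -> rho t x <= K ->
      ((h^-1 * S' (h^-1 * (t2 - t))) * (rho t x * \1_(cube r) x)
        <= - (rho t x * d_t phi t x + \sum_(j < 3) rho t x * u t j x * d_x j phi t x)) /\
      (- (rho t x * d_t phi t x + \sum_(j < 3) rho t x * u t j x * d_x j phi t x)
        <= K * (h^-1 * CS + 12 * V * CS) * \1_(cube rad) x).
      move=> v1 v2.
      have -> : rho t x * d_t phi t x + \sum_(j < 3) rho t x * u t j x * d_x j phi t x =
        rho t x * (d_t phi t x + \sum_(j < 3) u t j x * d_x j phi t x).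
        by rewrite mulrDr mulr_sumr; congr (_ + _); apply: eq_bigr => j _; rewrite mulrA.
      have rp := rho_ge0 x tt0.
      have [low upp] := spacetime_test_transport dS S0 S1 S01 S'C S'0 S'1 a (ltW V0) ltr01
        t2 h0 x erefl tt0 v1.
      rewrite -mulrN; split.
        rewrite mulrCA ler_wpM2l//; apply: le_trans low.
        rewrite ler_wpM2l ?mulr_ge0 ?S'ge0// indicE; case: (boolP (x \in _)) => xr /=.
          by rewrite cin//; exact: set_mem.
        by have /andP[] := cutoff01 S01 a V 1 t x.
      rewrite -mulrA; apply: ler_pM => //.
      apply: le_trans low; apply: mulr_ge0; first exact: mulr_ge0.
      by have /andP[] := cutoff01 S01 a V 1 t x.
    apply: (@le_Rintegral_npos _ _ _ leb3 setT _ J B).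
    - by move=> x _; rewrite lee_fin !mulr_ge0// ?rho_ge0// indicE ler0n.
    - move=> x _; rewrite lee_fin !mulr_ge0// ?(ltW K0) ?addr_ge0 ?mulr_ge0 ?(ltW V0) ?(ltW CS0)//.
    - by apply: ae_mono Vall => x [v1 v2] _; rewrite lee_fin; exact: (ineqs x v1 v2).1.
    - by apply: ae_mono Vall => x [v1 v2] _; rewrite lee_fin; exact: (ineqs x v1 v2).2.
    - rewrite integral_cst_cube lte_mul_pinfty ?leb3_cube_fin// lee_fin.
      by rewrite mulr_ge0 ?addr_ge0 ?mulr_ge0 ?(ltW K0) ?(ltW V0) ?(ltW CS0).
  rewrite /g; case: ifPn => [/andP[tt1 tt2]|_]; last first.
    apply: le_trans JG; apply: integral_ge0 => x _.
    by rewrite lee_fin !mulr_ge0// ?rho_ge0// indicE ler0n.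
  apply: le_trans JG; rewrite /J.
  have -> : (\int[leb3]_x (h^-1 * S' (h^-1 * (t2 - t)) * (rho t x * \1_(cube r) x))%:E =
    (h^-1 * S' (h^-1 * (t2 - t)))%:E * \int[leb3]_(x in cube r) (rho t x)%:E)%E.
    rewrite [X in (_ = _ * X)%E]integral_mkcond -ge0_integralZl//.
    - apply: eq_integral => x _; rewrite patchE indicE.
      by case: ifPn => _; rewrite ?mulr1// !mulr0 mule0.
    - apply/(measurable_restrictT _ (measurable_cube r)).
      by apply/measurable_EFinP; apply: measurable_funTS; exact: rho_meas.
    - by move=> x _; rewrite patchE; case: ifPn => // _; rewrite lee_fin rho_ge0.
    - by rewrite lee_fin mulr_ge0.
  rewrite mulrC EFinM; apply: lee_wpmul2l; first by rewrite lee_fin mulr_ge0.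
  apply: HM1 => //; rewrite ger0_norm ?subr_ge0//.
  by rewrite (le_lt_trans _ hd)// lerBlDl.
have : (\int[leb1]_(t in `[0%R, T]%classic) g t = M1%:E)%E.
  have -> : (\int[leb1]_(t in `[0%R, T]%classic) g t =
     \int[leb1]_(t in `[t0, t2]%classic) (M1%:E * (h^-1 * S' (h^-1 * (t2 - t)))%:E))%E.
    rewrite integral_mkcond [RHS]integral_mkcond; apply: eq_integral => t _.
    rewrite !patchE /g; have [|] := boolP (t \in `[t0, t2]%classic).
      rewrite inE/= in_itv/= => /andP[q1 q2]; rewrite mem_set.
        by rewrite q1 q2.
      by rewrite /= in_itv/= (le_trans t00 q1) (le_trans q2 (ltW t2T)).
    move=> /negP; rewrite inE/= in_itv/= => /negP/negbTE ->.
    by case: ifP.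
  rewrite ge0_integralZl//.
  - by rewrite integral_ramp// mule1.
  - have mramp : measurable_fun (setT : set R) (fun t : R => h^-1 * S' (h^-1 * (t2 - t))).
      apply: continuous_measurable_fun => t; apply: cvgM; first exact: cvg_cst.
      apply: (@continuous_comp _ _ _ (fun t => h^-1 * (t2 - t)) S').
        by apply: cvgM; [exact: cvg_cst|apply: cvgB; [exact: cvg_cst|exact: cvg_id]].
      exact: (Ck_continuous (smS' 0)).
    by apply/measurable_EFinP; exact: measurable_funS mramp.
  - by move=> t _; rewrite lee_fin mulr_ge0.
  - by rewrite lee_fin ltW.
move=> gE; move: gle; rewrite gE lee_fin => M1m.
by have := lt_le_trans mM1 (le_trans M1m m_le); rewrite ltxx.
Qed.

(** The first coefficient of [rho t x] comes from the time derivative of the test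
    function, which lives on the ramp; everything else carries a space derivative
    of the window, hence the factor [c] that tends to 0. *)
Lemma flux_le (t1 c V K C del0 : R) (q : E -> R) (i : 'I_3) (t : R) (x : E)
  (phi : R * E -> R) : phi = spacetime_test S 2 0 c (t1 + 1) 1 ->
  0 <= t -> 0 < c -> 0 <= V -> 0 <= del0 ->
  (forall j, `|u t j x| <= V) -> rho t x <= K ->
  (t1 <= t -> `|u t i x| <= del0) ->
  (forall j, `|eps * stress del alp bet rho u t i j x| <= C * (rho t x + q x)) ->
  `|rho t x * u t i x * d_t phi t x
    + \sum_(j < 3) rho t x * u t i x * u t j x * d_x j phi t x
    + pressure A gam (rho t x) * d_x i phi t x
    - eps * \sum_(j < 3) stress del alp bet rho u t i j x * d_x j phi t x| <=
  (del0 * S' (t1 + 1 - t) + c * CS * (3 * V ^+ 2 + A * K `^ (gam - 1) + 3 * C)) * rho t x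
  + c * CS * (3 * C) * q x.
Proof.
move=> phiE tt0 c0 V0 d0 uV rK ud sC.
have rp := rho_ge0 x tt0.
have dtE : d_t phi t x = - S' (t1 + 1 - t) * cutoff S 2 0 c t x.
  by rewrite phiE d_t_spacetime_test// time_ramp'E// invr1 !mul1r !mul0r subr0.
have dxE j : `|d_x j phi t x| <= c * CS.
  rewrite phiE d_x_spacetime_test// normrM; apply: ler_pM => //.
    have /andP[e0 e1] := time_ramp01 S01 (t1 + 1) 1 t.
    by rewrite normrM (ger0_norm e0) gtr0_norm// ler_piMr// ltW.
  exact: (cutoffm_le S01 S'C _ _ _ _ _ _).2.
have /andP[s0 s1] := S'C (t1 + 1 - t).
have k0 : 0 <= c * CS by rewrite mulr_ge0// ltW.
have b1 : `|rho t x * u t i x * d_t phi t x| <= del0 * S' (t1 + 1 - t) * rho t x.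
  have [tt1|tt1] := leP t1 t; last first.
    by rewrite dtE S'1 ?oppr0 ?mul0r ?mulr0 ?normr0 ?mul0r//; lra.
  have /andP[q0 q1] := cutoff01 S01 2 0 c t x.
  have dt_le : `|d_t phi t x| <= S' (t1 + 1 - t).
    by rewrite dtE normrM normrN (ger0_norm s0) (ger0_norm q0) ler_piMr.
  rewrite !normrM (ger0_norm rp) -mulrA mulrC ler_wpM2r//.
  by rewrite ler_pM// ud.
have b2 : `|\sum_(j < 3) rho t x * u t i x * u t j x * d_x j phi t x| <=
    c * CS * (3 * V ^+ 2) * rho t x.
  apply: le_trans (ler_norm_sum _ _ _) _.
  apply: (@le_trans _ _ (\sum_(j < 3) rho t x * V * V * (c * CS))).
    apply: ler_sum => j _; rewrite !normrM (ger0_norm rp).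
    by rewrite !ler_pM ?mulr_ge0// ?uV// ; exact: le_trans (dxE j) _.
  rewrite sumr_const card_ord.
  by rewrite [leLHS](_ : _ = c * CS * (3 * V ^+ 2) * rho t x)//; ring.
have b3 : `|pressure A gam (rho t x) * d_x i phi t x| <=
    c * CS * (A * K `^ (gam - 1)) * rho t x.
  have -> : pressure A gam (rho t x) = A * (rho t x `^ (gam - 1)) * rho t x.
    rewrite /pressure -mulrA -{3}(powRr1 rp) -powRD ?subrK//.
    by rewrite gt_eqF// (lt_trans ltr01 gam1).
  have p0 : 0 <= A * rho t x `^ (gam - 1) by rewrite mulr_ge0 ?powR_ge0// ltW.
  rewrite normrM (ger0_norm (mulr_ge0 p0 rp)) mulrAC; apply: ler_wpM2r => //.
  rewrite mulrC; apply: ler_pM => //; apply: ler_wpM2l; first exact: ltW.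
  by rewrite ge0_ler_powR// ?nnegrE ?subr_ge0 ?(ltW gam1)// (le_trans rp rK).
have b4 : `|eps * \sum_(j < 3) stress del alp bet rho u t i j x * d_x j phi t x| <=
    c * CS * (3 * C) * (rho t x + q x).
  rewrite mulr_sumr; apply: le_trans (ler_norm_sum _ _ _) _.
  apply: (@le_trans _ _ (\sum_(j < 3) C * (rho t x + q x) * (c * CS))).
    by apply: ler_sum => j _; rewrite mulrA normrM ler_pM.
  rewrite sumr_const card_ord.
  by rewrite [leLHS](_ : _ = c * CS * (3 * C) * (rho t x + q x))//; ring.
apply: le_trans (ler_normB _ _) _; apply: le_trans (lerD _ b4) _.
  apply: le_trans (ler_normD _ _) _; apply: lerD _ b3.
  by apply: le_trans (ler_normD _ _) _; apply: lerD b1 b2.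
by rewrite le_eqVlt; apply/orP; left; apply/eqP; ring.
Qed.

(** At a fixed [c] the momentum weighted by the window is at most [del0 * m0] plus
    a multiple of [c]; the windows increase to the whole space as [c] tends to 0. *)
Lemma momentum_le (t1 del0 : R) (i : 'I_3) : 0 <= t1 -> 0 <= del0 ->
  (forall t : R, t1 <= t -> {ae leb3, forall x, `|u t i x| <= del0}) ->
  `|total_momentum rho0 u0 i| <= del0 * m0.
Proof.
move=> t10 d0 ud; pose T := t1 + 2.
have T0 : 0 < T by rewrite ltr_wpDl.
have [K [K0 HK]] := rho_bnd T0.
have [V [V0 HV]] := u_bnd T0.
have [C [b [C0 mb b0 bT Hb]]] := stress_bnd T0.
have m00 : 0 <= m0 by rewrite fine_ge0// ltW.
pose B := fine (\int[leb1]_(t in `[0%R, T]%classic) b t)%E.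
have BE : (\int[leb1]_(t in `[0%R, T]%classic) b t = B%:E)%E.
  by rewrite fineK// ge0_fin_numE// integral_ge0.
pose kap := 3 * V ^+ 2 + A * K `^ (gam - 1) + 3 * C.
have kap0 : 0 <= kap.
  by rewrite !addr_ge0// ?mulr_ge0// ?powR_ge0// ?sqr_ge0// ltW.
pose Q := CS * (kap * m0 * T + 3 * C * B).
(* The windows are those of the cutoffs w(x / R) with R = n + 1. *)
pose c (n : nat) : R := n.+1%:R^-1.
have c0 n : 0 < c n by rewrite invr_gt0.
pose phi n := spacetime_test S 2 0 (c n) (t1 + 1) 1.
pose a n := \int[leb3]_x (rho0 x * u0 i x * phi n (0, x)).
have aQ n : `|a n| <= del0 * m0 + c n * Q.
  have test : test_function (strip T) (phi n).
    by apply: test_spacetime_test => //; rewrite /T; lra.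
  have /eqP := meq T0 i test; rewrite addrC addr_eq0 => /eqP; rewrite -/(a n) => ->.
  rewrite normrN.
  have k0 : 0 <= c n * CS by rewrite mulr_ge0// ltW.
  have w1 : 0 <= c n * CS * (3 * C) by rewrite mulr_ge0// mulr_ge0// ltW.
  pose g (t : R) : \bar R :=
    ((del0 * m0 * S' (t1 + 1 - t) + c n * CS * kap * m0)%:E
     + (c n * CS * (3 * C))%:E * b t)%E.
  have cS' : continuous (fun t : R => S' (t1 + 1 - t)).
    move=> t; apply: (@continuous_comp _ _ _ (fun t => t1 + 1 - t) S').
      by apply: cvgB; [exact: cvg_cst|exact: cvg_id].
    exact: (Ck_continuous (smS' 0)).
  have mS' : measurable_fun (setT : set R) (fun t : R => S' (t1 + 1 - t)).
    exact: continuous_measurable_fun.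
  have S'ge0 y : 0 <= S' y by have /andP[] := S'C y.
  have w2 : 0 <= c n * CS * kap * m0 by rewrite mulr_ge0// mulr_ge0.
  have w3 y : 0 <= del0 * m0 * S' y by rewrite mulr_ge0// mulr_ge0.
  apply: (@Rintegral_le_ae _ _ _ leb1 _ _ g).
  - move=> t _; apply: adde_ge0; first by rewrite lee_fin addr_ge0.
    by apply: mule_ge0.
  - apply: ae_mono2 HV Hb => t HVt Hbt tT'; have tT : t \in `[0, T] by [].
    have tt0 : 0 <= t by move: tT; rewrite in_itv/= => /andP[].
    have Vi := HVt tT; have [q [mq q0 qb Hq]] := Hbt tT.
    have [bE|] := eqVneq (b t) +oo%E.
      by rewrite /g bE gt0_muley ?lte_fin ?mulr_gt0// addey// leey.
    rewrite -ltey => bfin.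
    have bfE : b t = (fine (b t))%:E by rewrite fineK// ge0_fin_numE.
    rewrite /g bfE -EFinM -EFinD lee_fin.
    pose G (x : E) : \bar R :=
      ((del0 * S' (t1 + 1 - t) + c n * CS * kap)%:E * (rho t x)%:E
      + (c n * CS * (3 * C))%:E * (q x)%:E)%E.
    have w0 : 0 <= del0 * S' (t1 + 1 - t) + c n * CS * kap.
      by rewrite addr_ge0// mulr_ge0.
    apply: (@Rintegral_le_ae _ _ _ leb3 _ _ G).
    + by move=> x _; rewrite /G -!EFinM -EFinD lee_fin addr_ge0// mulr_ge0// rho_ge0.
    + have : {ae leb3, forall x, (forall j, `|u t j x| <= V) /\ rho t x <= K}.
        by apply: ae_mono2 (ae_forall Vi) (HK t tT) => x; exact: conj.
      (* Before [t1] the ramp is constant, so [del0] acts only after [t1]. *)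
      have : {ae leb3, forall x, (t1 <= t -> `|u t i x| <= del0) /\
          forall j, `|eps * stress del alp bet rho u t i j x| <= C * (rho t x + q x)}.
        have H : {ae leb3, forall x, t1 <= t -> `|u t i x| <= del0}.
          have [tt1|tt1] := leP t1 t; first by apply: ae_mono (ud t tt1).
          exact: aeW.
        by apply: ae_mono2 H (ae_forall (Hq i)) => x; exact: conj.
      apply: ae_mono2 => x [h1 h2] [h3 h4] _; rewrite /G -!EFinM -EFinD lee_fin.
      by apply: (flux_le (phi := phi n) erefl tt0 (c0 n) (ltW V0)).
    + have mr : measurable_fun (setT : set T3) (fun x => (rho t x)%:E).
        by apply/measurable_EFinP; exact: rho_meas.
      have mqE : measurable_fun (setT : set T3) (fun x => (q x)%:E).
        exact/measurable_EFinP.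
      have r0 x : (0 <= (rho t x)%:E)%E by rewrite lee_fin rho_ge0.
      have q0E x : (0 <= (q x)%:E)%E by rewrite lee_fin.
      rewrite /G ge0_integralD//; last 4 first.
      * by move=> x _; rewrite mule_ge0.
      * exact: measurable_funeM.
      * by move=> x _; rewrite mule_ge0.
      * exact: measurable_funeM.
      rewrite !ge0_integralZl//.
      have -> : del0 * m0 * S' (t1 + 1 - t) + c n * CS * kap * m0 =
        (del0 * S' (t1 + 1 - t) + c n * CS * kap) * m0 by ring.
      rewrite [leRHS]EFinD 2![in leRHS]EFinM; apply: leeD; apply: lee_wpmul2l => //.
      * by rewrite -m0E; exact: mass_le.
      * by rewrite -bfE.
  - have mI : measurable (`[0%R, T]%classic : set T1) by exact: measurable_itv.
    have mg1 : measurable_fun (`[0%R, T]%classic : set T1)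
        (fun t => (del0 * m0 * S' (t1 + 1 - t))%:E).
      apply/measurable_EFinP; apply: measurable_funM => //.
      exact: measurable_funS mS'.
    have mbI : measurable_fun (`[0%R, T]%classic : set T1) b by exact: measurable_funTS.
    have -> : (\int[leb1]_(t in `[0%R, T]%classic) g t =
      \int[leb1]_(t in `[0%R, T]%classic) (del0 * m0 * S' (t1 + 1 - t))%:E
      + (\int[leb1]_(t in `[0%R, T]%classic) (c n * CS * kap * m0)%:E
      + \int[leb1]_(t in `[0%R, T]%classic) ((c n * CS * (3 * C))%:E * b t)))%E.
      have h1 t : (`[0%R, T]%classic t -> 0 <= (del0 * m0 * S' (t1 + 1 - t))%:E)%E.
        by rewrite lee_fin.
      have h2 t : (`[0%R, T]%classic t -> 0 <= (c n * CS * kap * m0)%:E)%E.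
        by rewrite lee_fin.
      have h3 t : (`[0%R, T]%classic t -> 0 <= (c n * CS * (3 * C))%:E * b t)%E.
        by move=> _; rewrite mule_ge0// lee_fin.
      have mcst : measurable_fun (`[0%R, T]%classic : set T1)
        (fun=> (c n * CS * kap * m0)%:E) by exact: measurable_cst.
      have mCb : measurable_fun (`[0%R, T]%classic : set T1)
        (fun t => ((c n * CS * (3 * C))%:E * b t)%E) by exact: measurable_funeM.
      rewrite -(ge0_integralD leb1 mI h2 mcst h3 mCb).
      rewrite -(ge0_integralD leb1 mI h1 mg1 (fun t It => adde_ge0 (h2 t It) (h3 t It))
        (emeasurable_funD mcst mCb)).
      by apply: eq_integral => t _; rewrite /g EFinD addeA.
    have -> : (\int[leb1]_(t in `[0%R, T]%classic) (c n * CS * kap * m0)%:E =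
        (c n * CS * kap * m0 * T)%:E)%E.
      rewrite integral_cst// [RHS]EFinM; congr (_ * _)%E.
      by rewrite /Defs.leb1/= lebesgue_measure_itv/= lte_fin T0 -EFinB subr0.
    rewrite ge0_integralZl//.
    rewrite BE -!EFinM.
    have -> : (\int[leb1]_(t in `[0%R, T]%classic) (del0 * m0 * S' (t1 + 1 - t))%:E =
        (del0 * m0)%:E)%E.
      under eq_integral do rewrite EFinM.
      rewrite ge0_integralZl//; last 3 first.
      * by apply/measurable_EFinP; exact: measurable_funS mS'.
      * by move=> t _; rewrite lee_fin.
      * by rewrite lee_fin mulr_ge0.
      rewrite -[RHS]mule1 -(@integral_ramp t1 1)//; congr (_ * _)%E.
      rewrite integral_mkcond [RHS]integral_mkcond; apply: eq_integral => t _.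
      rewrite !patchE invr1 !mul1r.
      have [|] := boolP (t \in `[t1, (t1 + 1)%R]%classic).
        rewrite inE/= in_itv/= => /andP[q1 q2]; rewrite mem_set//=.
        by rewrite in_itv/= (le_trans t10 q1) (le_trans q2)// lerD2l ler1n.
      move=> /negP; rewrite inE/= in_itv/= => H; case: ifP => // _.
      congr EFin; have [tt1|tt1] := leP t1 t; last first.
        by rewrite S'1// addrAC lerDr subr_ge0 ltW.
      by rewrite S'0// subr_le0 leNgt; apply/negP => /ltW tt2; apply: H; rewrite tt1 tt2.
    rewrite -!EFinD lee_fin lerD2l /Q; lra.
have ca : a @ \oo --> total_momentum rho0 u0 i.
  pose F (n : nat) (x : E) : \bar R := (rho0 x * u0 i x * phi n (0, x))%:E.
  have phiE n x : phi n (0, x) = cutoff S 2 0 (c n) 0 x.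
    by rewrite /phi /spacetime_test/= time_ramp_start// ?mul1r//; lra.
  have mru : measurable_fun (setT : set T3) (fun x => rho0 x * u0 i x).
    by apply/measurable_EFinP; exact: measurable_int (mom_int i).
  have mF n : measurable_fun (setT : set T3) (F n).
    apply/measurable_EFinP; apply: measurable_funM => //.
    have -> : (fun x => phi n (0, x)) = cutoff S 2 0 (c n) 0.
      by apply/funext => x; rewrite phiE.
    exact: measurable_cutoff.
  have FE x : F ^~ x @ \oo --> (rho0 x * u0 i x)%:E.
    apply: cvg_near_cst; have := nbhs_infty_ger `|x|.
    apply: filterS => n nx /=; rewrite /F phiE.
    rewrite (@cutoff_in _ S S1 2 0 (c n) (c0 n) 0 x `|x|) ?mulr1//.
      exact/cube_norm.
    rewrite mul0r subr0 lerBrDr [leRHS](_ : 2 = 1 + 1)// lerD2l /c ler_pdivrMl//.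
    by rewrite mulr1 (le_trans nx)// ler_nat.
  have Fle n x : (`|F n x| <= `|(rho0 x * u0 i x)%:E|)%E.
    rewrite /F phiE EFinM abseM -[leRHS]mule1 lee_pmul//.
    by have /andP[q0 q1] := cutoff01 S01 2 0 (c n) 0 x; rewrite lee_fin ger0_norm.
  have mru' : measurable_fun (setT : set T3) (fun x => (rho0 x * u0 i x)%:E).
    exact/measurable_EFinP.
  have ae1 : {ae leb3, forall x, (setT : set T3) x ->
      F ^~ x @ \oo --> (rho0 x * u0 i x)%:E} by apply: aeW => x _; exact: FE.
  have ae2 : {ae leb3, forall x n, (setT : set T3) x ->
      (`|F n x| <= `|(rho0 x * u0 i x)%:E|)%E} by apply: aeW => x n _; exact: Fle.
  have [_ _ cF] := @dominated_convergence _ T3 R leb3 setT measurableT F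
    (fun x => (rho0 x * u0 i x)%:E) (fun x => `|(rho0 x * u0 i x)%:E|%E) mF mru'
    ae1 (integrable_abse (mom_int i)) ae2.
  apply: fine_cvg; rewrite fineK; first exact: cF.
  exact: (integrable_fin_num _ (mom_int i)).
have cR : (fun n => del0 * m0 + c n * Q) @ \oo --> del0 * m0.
  rewrite -[X in _ --> X]addr0 -[X in _ --> _ + X](mul0r Q).
  apply: cvgD; first exact: cvg_cst.
  by apply: cvgMr_tmp; exact: cvg_harmonic.
apply: ler_cvg_to (cvg_norm ca) cR _; exact: nearW.
Qed.

Lemma momentum_vanishes (i : 'I_3) :
  (forall e : R, 0 < e -> exists t1 : R, 0 <= t1 /\ forall t : R, t1 <= t ->
    forall i, {ae leb3, forall x, `|u t i x| <= e}) ->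
  total_momentum rho0 u0 i = 0.
Proof.
move=> H; apply/eqP; rewrite -normr_le0; apply/ler_addgt0Pr => e e0; rewrite add0r.
have m00 : 0 <= m0 by rewrite fine_ge0// ltW.
have m1 : 0 < m0 + 1 by rewrite ltr_wpDl.
have d0 : 0 < e / (m0 + 1) by rewrite divr_gt0.
have [t1 [t10 Ht1]] := H _ d0.
apply: le_trans (momentum_le t10 (ltW d0) (fun t tt1 => Ht1 t tt1 i)) _.
by rewrite -mulrA ler_piMr ?(ltW e0)// mulrC ler_pdivrMr// mul1r lerDl.
Qed.

End Conservation.

(** * Density and velocity in the regularity classes *)

Section Prelim.
Variable R : realType.
Local Notation E := (space3 R).
Local Notation T1 := (measurableTypeR R).
Local Notation T3 := (T1 * T1 * T1)%type.
Local Notation leb3 := (leb3 R).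
Local Notation leb1 := (leb1 R).

(** One-sided at 0, where a power is discontinuous from the left: powers of negative
    numbers are 1. *)
Lemma powR_near (k : R) (y e : R) : 0 < k -> 0 <= y -> 0 < e ->
  exists d : R, 0 < d /\ forall z : R, 0 <= z -> `|z - y| < d ->
    `|z `^ k - y `^ k| <= e.
Proof.
move=> k0; rewrite le_eqVlt => /predU1P[<-|y0] e0.
  (* At y = 0, z^k <= e means z <= e^(1 / k). *)
  exists (e `^ k^-1); split; first exact: powR_gt0.
  move=> z z0; rewrite subr0 ger0_norm// => ze.
  rewrite powR0 ?gt_eqF// subr0 ger0_norm ?powR_ge0//.
  rewrite -[e]powRr1 ?(ltW e0)// -(mulVf (lt0r_neq0 k0)) powRrM.
  by rewrite ge0_ler_powR ?nnegrE ?powR_ge0// ltW.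
have /cvgrPdist_le/(_ e e0) : {for y, continuous (fun z : R => z `^ k)}.
  apply: differentiable_continuous; apply/derivable1_diffP.
  by apply: ex_derive; exact: is_derive1_powR.
case/nbhs_ballP => d /= d0 H; exists d; split => // z _ zd.
by rewrite distrC; apply: H; rewrite /ball/= distrC.
Qed.

Lemma powR_unif (k M e : R) : 0 < k -> 0 < e ->
  exists d : R, 0 < d /\ forall y z : R, 0 <= y <= M -> 0 <= z -> `|z - y| <= d ->
    `|z `^ k - y `^ k| <= e.
Proof.
move=> k0 e0.
have := (compact_near_coveringP _).1 (@segment_compact R 0 M) _ (0 : R)^'+
  (fun d y => forall z, 0 <= y -> 0 <= z -> `|z - y| <= d -> `|z `^ k - y `^ k| <= e) _.
case.
- move=> y; rewrite /= in_itv/= => /andP[y0 yM].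
  have e20 : 0 < e / 2 by rewrite divr_gt0.
  have [d [d0 Hd]] := powR_near k0 y0 e20.
  exists (ball y (d / 2), [set r | r < d / 2]).
    split; first by apply: nbhsx_ballx; rewrite divr_gt0.
    by apply: nbhs_right_lt; rewrite divr_gt0.
  move=> [y' r] [/=]; rewrite /ball/= => yy' rd z y'0 z0 zy'.
  have -> : z `^ k - y' `^ k = (z `^ k - y `^ k) - (y' `^ k - y `^ k) by ring.
  apply: le_trans (ler_normB _ _) _; rewrite [e](splitr e); apply: lerD; apply: Hd => //.
    have -> : z - y = (z - y') - (y - y') by ring.
    apply: le_lt_trans (ler_normB _ _) _; rewrite [d](splitr d); apply: ler_ltD.
      exact: le_trans zy' (ltW rd).
    exact: yy'.
  by rewrite distrC (lt_trans yy')// ltr_pdivrMr// ltr_pMr// ltr1n.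
- move=> r /= r0 H; exists (r / 2); split; first by rewrite divr_gt0.
  have Hr : 0 < r / 2 by rewrite divr_gt0.
  move=> y z yM z0 zy.
  apply: (H (r / 2)) => //=; last by have /andP[] := yM.
  by rewrite sub0r normrN gtr0_norm// ltr_pdivrMr// ltr_pMr// ltr1n.
Qed.

Lemma C_in_unif (T : R) (f : R -> E -> R) : C_in (@Hk_norm R 3) T f ->
  forall t : R, t \in `[0, T] -> forall e : R, 0 < e ->
  exists d : R, 0 < d /\ forall s : R, s \in `[0, T] -> `|s - t| < d ->
    {ae leb3, forall x, `|f s x - f t x| <= e}.
Proof.
move=> fC t tT e e0; have [C [C0 HC]] := sobolev_embedding R.
have [_ cv] := fC t tT.
have C1 : 0 < C + 1 by rewrite ltr_wpDl.
have eC : 0 < e / (C + 1) by rewrite divr_gt0.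
have [d /= d0 Hd] : within `[0, T]%classic (nbhs t)
    (fun s => Hk_norm 3 (f s \- f t)%R < (e / (C + 1))%:E)%E.
  apply: (cv [set y | (y < (e / (C + 1))%:E)%E]).
  by apply: open_nbhs_nbhs; split; [exact: open_ereal_lt_ereal|rewrite /= lte_fin].
exists d; split => // s sT sd.
have sH : (Hk_norm 3 (f s \- f t)%R < (e / (C + 1))%:E)%E.
  by apply: Hd => //; rewrite /= distrC.
apply: ae_mono (HC _ _ sH) => x /= /le_trans; apply.
by rewrite mulrCA ler_piMr ?(ltW e0)// ler_pdivrMr// mul1r lerDl.
Qed.

Lemma Hk_norm_ae_bounded (f : E -> R) : (Hk_norm 3 f < +oo)%E ->
  exists M : R, 0 <= M /\ {ae leb3, forall x, `|f x| <= M}.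
Proof.
move=> fy; have [C [C0 HC]] := sobolev_embedding R.
have f0 := Hk_norm_ge0 3 f.
exists (C * (fine (Hk_norm 3 f) + 1)); split.
  by rewrite mulr_ge0// addr_ge0// fine_ge0.
by apply: HC; rewrite EFinD fineK ?ge0_fin_numE// lteDl// ge0_fin_numE.
Qed.

(** Compactness of the time interval. *)
Lemma C_in_bounded (T : R) (f : R -> E -> R) : C_in (@Hk_norm R 3) T f ->
  exists M : R, 0 < M /\ forall t : R, t \in `[0, T] ->
    {ae leb3, forall x, `|f t x| <= M}.
Proof.
move=> fC.
have := (compact_near_coveringP _).1 (@segment_compact R 0 T) _ (pinfty_nbhs R)
  (fun M t => t \in `[0, T] -> {ae leb3, forall x, `|f t x| <= M}) _.
case.
- move=> t tT; have [M [M0 HM]] := Hk_norm_ae_bounded (fC t tT).1.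
  have [d [d0 Hd]] := C_in_unif fC tT ltr01.
  exists (ball t d, [set r | M + 1 < r]).
    by split; [exact: nbhsx_ballx|exact: (nbhs_pinfty_gt (num_real _))].
  move=> [s r] [/=]; rewrite /ball/= => sd Mr sT.
  have := Hd s sT; rewrite distrC => /(_ sd); apply: ae_mono2 HM => x h1 h2.
  have -> : f s x = f t x + (f s x - f t x) by rewrite addrC subrK.
  by apply: le_trans (ler_normD _ _) _; apply: le_trans (ltW Mr); exact: lerD.
- move=> r [_ H]; exists (Num.max (r + 1) 1); split; first by rewrite lt_max ltr01 orbT.
  move=> t tT; apply: (H (Num.max (r + 1) 1)) => //.
  by rewrite lt_max ltrDl ltr01.
Qed.

Lemma Lnorm_oo_ae d (X : measurableType d) (mu : {measure set X -> \bar R})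
    (f : X -> \bar R) : (0 < mu setT)%E ->
  {ae mu, forall x, (`|f x| <= Lnorm mu +oo f)%E}.
Proof. by move=> mu0; rewrite unlock mu0; exact: ess_sup_ge. Qed.

Lemma leb1_gt0 : (0 < leb1 setT)%E.
Proof.
by rewrite /Defs.leb1/= -set_itvNyy lebesgue_measure_itv/= ltey.
Qed.

Lemma leb3_gt0 : (0 < leb3 setT)%E.
Proof.
by rewrite -!setXTT leb3_box// !mule_gt0//; exact: leb1_gt0.
Qed.

Lemma Linfty_in_time (k : nat) (T : R) (f : R -> E -> R) :
  Lp_in +oo (@Hk_norm R k) T f ->
  exists B : R, {ae leb1, forall t, t \in `[0, T] -> (Hk_norm k (f t) < B%:E)%E}.
Proof.
move=> [_]; set N := Lnorm _ _ _ => Ny.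
have H := @Lnorm_oo_ae _ T1 leb1 ((fun t => Hk_norm k (f t)) \_ `[0%R, T]%classic) leb1_gt0.
have N0 : (0 <= N)%E by exact: Lnorm_ge0.
exists (fine N + 1); apply: ae_mono H => t + tT.
rewrite patchE mem_set//= -/N => /(le_trans (lee_abs _)) /le_lt_trans; apply.
by rewrite EFinD fineK ?lteDl// ge0_fin_numE.
Qed.

Lemma integrable_ae_dominated d (X : measurableType d) (mu : {measure set X -> \bar R})
    (f g : X -> R) : measurable_fun setT f -> measurable_fun setT g ->
  (forall x, 0 <= g x) -> (\int[mu]_x (g x)%:E < +oo)%E ->
  {ae mu, forall x, `|f x| <= g x} -> mu.-integrable setT (fun x => (f x)%:E).
Proof.
move=> mf mg g0 gy fg; apply/integrableP; split; first exact/measurable_EFinP.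
apply: le_lt_trans gy; apply: ae_ge0_le_integral => //.
- by apply: measurableT_comp => //; exact/measurable_EFinP.
- by move=> x _; rewrite lee_fin.
- exact/measurable_EFinP.
- by apply: ae_mono fg => x fgx _; rewrite abse_EFin lee_fin.
Qed.

Lemma limsup0_ae (u : R -> 'I_3 -> E -> R) :
  limf_esup (fun t => sup_norm (u t)) (pinfty_nbhs R) = 0%E ->
  forall e : R, 0 < e -> exists t1 : R, 0 <= t1 /\ forall t : R, t1 <= t ->
    forall i, {ae leb3, forall x, `|u t i x| <= e}.
Proof.
move=> H e e0.
have : (limf_esup (fun t => sup_norm (u t)) (pinfty_nbhs R) < e%:E)%E.
  by rewrite H lte_fin.
move=> /ereal_inf_lt[_ [A [r [_ rA] <-]]] Ae.
exists (Num.max (r + 1) 0); split; first by rewrite le_max lexx orbT.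
move=> t; rewrite ge_max => /andP[rt _] i.
have tA : (sup_norm (u t) < e%:E)%E.
  apply: le_lt_trans Ae; apply: ereal_sup_ubound; exists t => //; apply: rA.
  by rewrite (lt_le_trans _ rt)// ltrDl.
have := @Lnorm_oo_ae _ T3 leb3 (fun x => (enorm3 (fun i => u t i x))%:E) leb3_gt0.
apply: ae_mono => x /= H'; have := le_lt_trans H' tA.
rewrite lte_fin ger0_norm ?sqrtr_ge0// => /ltW; apply: le_trans.
rewrite /enorm3 -sqrtr_sqr; apply: ler_wsqrtr.
by rewrite (bigD1 i)//= lerDl sumr_ge0// => j _; exact: sqr_ge0.
Qed.

End Prelim.

Section Density.
Variable R : realType.
Local Notation E := (space3 R).
Local Notation T1 := (measurableTypeR R).
Local Notation T3 := (T1 * T1 * T1)%type.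
Local Notation leb3 := (leb3 R).
Variables (A gam : R) (rho : R -> E -> R).
Hypothesis A0 : 0 < A.
Hypothesis gam1 : 1 < gam.
Hypothesis rho_ge0 : forall (t : R) x, 0 <= t -> 0 <= rho t x.
Hypothesis soundC : forall T : R, 0 < T -> C_in (@Hk_norm R 3) T (sound_speed A gam rho).

Let kap : R := (Num.sqrt (A * gam))^-1.
Let k : R := 2 / (gam - 1).

Let k0 : 0 < k.
Proof. by rewrite divr_gt0// subr_gt0. Qed.

Let sqrt0 : 0 < Num.sqrt (A * gam).
Proof. by rewrite sqrtr_gt0 mulr_gt0// (lt_trans ltr01 gam1). Qed.

Let kap0 : 0 < kap.
Proof. by rewrite invr_gt0. Qed.

(** The density is a power of the sound speed, whose norms are those that
    regularity controls. *)
Lemma density_sound_speed t x : 0 <= rho t x ->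
  0 <= kap * sound_speed A gam rho t x /\
  rho t x = (kap * sound_speed A gam rho t x) `^ k.
Proof.
move=> r0; rewrite /kap /sound_speed mulrA mulVf ?gt_eqF// mul1r powR_ge0; split => //.
rewrite -powRrM /k mulrACA [2^-1 * _]mulrC.
have g0 : gam - 1 != 0 by rewrite gt_eqF// subr_gt0.
have -> : (gam - 1) * 2 * ((gam - 1)^-1 * 2^-1) = 1 by field.
by rewrite powRr1.
Qed.

Lemma density_measurable (t : R) : 0 <= t -> measurable_fun (setT : set T3) (rho t).
Proof.
move=> t0; have tT : t \in `[0, t + 1] by rewrite in_itv/= t0 lerDl ler01.
have T0 : 0 < t + 1 by rewrite ltr_wpDl.
have mc : measurable_fun (setT : set T3) (sound_speed A gam rho t).
  exact: cube_integrable_measurable (Hk_norm_lty_cube (soundC T0 tT).1).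
have -> : rho t = (fun y : R => y `^ k) \o (fun x => kap * sound_speed A gam rho t x).
  by apply/funext => x /=; exact: (density_sound_speed (rho_ge0 x t0)).2.
apply: measurableT_comp; first exact: measurable_powR.
by apply: measurable_funM.
Qed.

Lemma density_bounded (T : R) : 0 < T -> exists K : R, 0 < K /\
  forall t : R, t \in `[0, T] -> {ae leb3, forall x, rho t x <= K}.
Proof.
move=> T0; have [M [M0 HM]] := C_in_bounded (soundC T0).
exists ((kap * M) `^ k); split; first by rewrite powR_gt0// mulr_gt0.
move=> t tT; have t0 : 0 <= t by move: tT; rewrite in_itv/= => /andP[].
apply: ae_mono (HM t tT) => x cM.
have [c0 ->] := density_sound_speed (rho_ge0 x t0).
rewrite ge0_ler_powR ?nnegrE ?(ltW k0)//; first by rewrite mulr_ge0// ltW.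
by rewrite ler_pM2l// (le_trans (ler_norm _)).
Qed.

Lemma density_continuous (T : R) : 0 < T -> forall t0 : R, t0 \in `[0, T] ->
  forall e : R, 0 < e -> exists d : R, 0 < d /\
  forall t : R, t \in `[0, T] -> `|t - t0| < d ->
    {ae leb3, forall x, `|rho t x - rho t0 x| <= e}.
Proof.
move=> T0 t0 t0T e e0; have [M [M0 HM]] := C_in_bounded (soundC T0).
have [d' [d'0 Hd']] := powR_unif (kap * M) k0 e0.
have [d [d0 Hd]] := C_in_unif (soundC T0) t0T (divr_gt0 d'0 kap0).
have pos (t : R) : t \in `[0, T] -> 0 <= t by rewrite in_itv/= => /andP[].
exists d; split => // t tT td; apply: ae_mono2 (HM t0 t0T) (Hd t tT td) => x cM ct.
have [c0 ->] := density_sound_speed (rho_ge0 x (pos t tT)).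
have [c1 ->] := density_sound_speed (rho_ge0 x (pos t0 t0T)).
apply: Hd' => //; first by rewrite c1 ler_pM2l// (le_trans (ler_norm _)).
by rewrite -mulrBr normrM (gtr0_norm kap0) mulrC -ler_pdivlMr.
Qed.

End Density.

(** * Viscous stress, initial momentum, conclusion *)

Section Weighted.
Variable R : realType.
Local Notation E := (space3 R).
Local Notation T1 := (measurableTypeR R).
Local Notation T3 := (T1 * T1 * T1)%type.
Local Notation leb3 := (leb3 R).
Local Notation leb1 := (leb1 R).

(** With a = r^((1 + del) / 2) and f = r^p g, this is a |f| <= a^2 + f^2, where
    a^2 = r^(1 + del) is at most a multiple of r. *)
Lemma weighted_young (r K del p g : R) : 0 < r <= K -> 0 <= del ->
  r `^ ((1 + del) / 2 + p) * `|g| <= K `^ del * r + (r `^ p * g) ^+ 2.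
Proof.
move=> /andP[r0 rK] d0.
have rn0 : r != 0 by rewrite gt_eqF.
rewrite powRD; last by apply/implyP => _.
set a := r `^ ((1 + del) / 2); set f := r `^ p * g.
have fE : r `^ p * `|g| = `|f| by rewrite /f normrM ger0_norm// powR_ge0.
have a2 : a ^+ 2 <= K `^ del * r.
  rewrite /a -powR_mulrn ?powR_ge0// -powRrM divfK// addrC powRD; last by apply/implyP.
  rewrite powRr1 ?(ltW r0)// ler_pM2r// ge0_ler_powR// ?nnegrE ?(ltW r0)//.
  exact: le_trans (ltW r0) rK.
rewrite -mulrA fE; apply: (@le_trans _ _ (a ^+ 2 + `|f| ^+ 2)).
  have := sqr_ge0 (a - `|f|); have := sqr_ge0 a; have := sqr_ge0 `|f|.
  by rewrite sqrrB => h1 h2 h3; lra.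
by rewrite real_normK ?num_real// lerD2r.
Qed.

(** [weighted_young] with [p = (del - 1) / 2]; [q] is the sum of the squares of the
    weighted derivatives, whose integral [L2_in_time_majorant] controls in time. *)
Lemma viscous_stress_bound (alp bet eps del T K : R) (rho : R -> E -> R)
    (u : R -> 'I_3 -> E -> R) : 0 <= del ->
  (forall (t : R) x, t \in `[0, T] -> 0 < rho t x) ->
  (forall t : R, t \in `[0, T] -> {ae leb3, forall x, rho t x <= K}) ->
  (forall i j, Lp_in 2%:E (@Hk_norm R 3) T
     (fun t x => rho t x `^ ((del - 1) / 2) * grad_u u t i j x)) ->
  exists (C : R) (b : R -> \bar R),
  [/\ 0 < C, measurable_fun (setT : set T1) b, forall t, (0 <= b t)%E,
      (\int[leb1]_(t in `[0%R, T]%classic) b t < +oo)%E &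
  {ae leb1, forall t, t \in `[0, T] -> exists q : E -> R,
     [/\ measurable_fun (setT : set T3) q, forall x, 0 <= q x,
      (\int[leb3]_x (q x)%:E <= b t)%E &
      forall i j, {ae leb3, forall x,
        `|eps * stress del alp bet rho u t i j x| <= C * (rho t x + q x)}]}].
Proof.
move=> d0 rpos rK hLp.
pose f (p : 'I_3 * 'I_3) t x := rho t x `^ ((del - 1) / 2) * grad_u u t p.1 p.2 x.
have [b Hb] := choice (fun p : 'I_3 * 'I_3 => L2_in_time_majorant (hLp p.1 p.2)).
have b0 p t : (0 <= b p t)%E by have [_ + _ _] := Hb p; exact.
have mb p : measurable_fun (setT : set T1) (b p) by have [] := Hb p.
pose D := `|eps| * (2 * `|alp| + 3 * `|bet|).
have D0 : 0 <= D by rewrite mulr_ge0// addr_ge0// mulr_ge0.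
have Kd := powR_ge0 K del.
exists (D * (K `^ del + 1) + 1), (fun t => \sum_p b p t)%E; split.
- by rewrite ltr_wpDl// mulr_ge0// addr_ge0.
- by apply: emeasurable_sum => p; exact: mb.
- by move=> t; exact: sume_ge0.
- have mI : measurable (`[0%R, T]%classic : set T1) by exact: measurable_itv.
  rewrite ge0_integral_sum//; last by move=> p; exact: measurable_funTS.
  by apply: lte_sum_pinfty => p _; have [_ _ + _] := Hb p.
have bq : {ae leb1, forall t, forall p, t \in `[0, T] ->
    measurable_fun (setT : set T3) (f p t) /\ (\int[leb3]_x (f p t x ^+ 2)%:E <= b p t)%E}.
  by apply: ae_forall => p; have [_ _ _] := Hb p.
apply: ae_mono bq => t bq tT; exists (fun x => \sum_p f p t x ^+ 2); split.
- by apply: measurable_sum => p; apply: measurable_funX; exact: (bq p tT).1.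
- by move=> x; apply: sumr_ge0 => p _; exact: sqr_ge0.
- under eq_integral do rewrite -sumEFin.
  rewrite ge0_integral_sum//; last 2 first.
  + by move=> p; apply/measurable_EFinP; apply: measurable_funX; exact: (bq p tT).1.
  + by move=> p x _; rewrite lee_fin sqr_ge0.
  by apply: lee_sum => p _; exact: (bq p tT).2.
move=> i j; apply: ae_mono (rK t tT) => x rxK.
set q := \sum_p f p t x ^+ 2; set r := rho t x.
have r0 : 0 < r by exact: rpos.
have q0 : 0 <= q by apply: sumr_ge0 => p _; exact: sqr_ge0.
pose Z := K `^ del * r + q.
have Y k l : `|r `^ del * grad_u u t k l x| <= Z.
  have rK' : 0 < r <= K by rewrite r0.
  have := weighted_young ((del - 1) / 2) (grad_u u t k l x) rK' d0.
  have -> : (1 + del) / 2 + (del - 1) / 2 = del by field.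
  rewrite normrM (ger0_norm (powR_ge0 _ _)) => /le_trans; apply.
  rewrite /Z lerD2l /q (bigD1 (k, l))//= lerDl.
  by apply: sumr_ge0 => p _; exact: sqr_ge0.
have Z0 : 0 <= Z by rewrite addr_ge0// mulr_ge0// ltW.
have ZC : Z <= (K `^ del + 1) * (r + q).
  have -> : (K `^ del + 1) * (r + q) = Z + (K `^ del * q + r) by rewrite /Z; ring.
  by rewrite lerDl addr_ge0 ?mulr_ge0// ltW.
apply: (@le_trans _ _ (D * Z)); last first.
  apply: (@le_trans _ _ (D * ((K `^ del + 1) * (r + q)))); first by rewrite ler_wpM2l.
  by rewrite mulrA ler_wpM2r ?addr_ge0 ?(ltW r0)// lerDl.
rewrite normrM -mulrA ler_wpM2l// /stress -/r.
apply: le_trans (ler_normD _ _) _; rewrite mulrDl; apply: lerD.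
  rewrite -mulrA normrM [2 * _]mulrC -mulrA ler_wpM2l// mulrDr.
  apply: le_trans (ler_normD _ _) _; apply: le_trans (lerD (Y i j) (Y j i)) _.
  by rewrite mulr2n mulrDl mul1r.
rewrite !normrM -!mulrA [3 * _]mulrCA ler_wpM2l//.
rewrite mulrA -normrM mulr_sumr; apply: (@le_trans _ _ (3 * Z * 1)); last by rewrite mulr1.
apply: ler_pM => //; last by case: eqP => _; rewrite ?normr1// normr0 ler01.
apply: le_trans (ler_norm_sum _ _ _) _.
apply: (@le_trans _ _ (\sum_(k < 3) Z)); first by apply: ler_sum => k _; exact: Y.
by rewrite sumr_const card_ord -[Z *+ 3]mulr_natl.
Qed.

End Weighted.

Section Regular.
Variable R : realType.
Local Notation E := (space3 R).
Local Notation T1 := (measurableTypeR R).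
Local Notation T3 := (T1 * T1 * T1)%type.
Local Notation leb3 := (leb3 R).
Local Notation leb1 := (leb1 R).
Variables (A gam del alp bet eps : R) (rho0 : E -> R) (u0 : 'I_3 -> E -> R).
Variables (rho : R -> E -> R) (u : R -> 'I_3 -> E -> R).
Hypothesis A0 : 0 < A.
Hypothesis gam1 : 1 < gam.
Hypothesis del01 : 0 < del < 1.
Hypothesis reg : global_regular_solution A gam del alp bet eps rho0 u0 rho u.
Hypothesis mass_lty : (total_mass rho0 < +oo)%E.

Lemma regular_cases (T : R) : 0 < T ->
  (eps = 0 /\ euler_regular A gam del alp bet eps rho0 u0 rho u T) \/
  ns_regular A gam del alp bet eps rho0 u0 rho u T.
Proof.
move=> /reg; rewrite /regular_solution.
by case: eqP => [e0|_] r; [left|right].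
Qed.

Lemma regular_weak (T : R) : 0 < T -> weak_solution A gam del alp bet eps rho0 u0 rho u T.
Proof. by move=> /regular_cases[[_ []]|[]]. Qed.

Lemma regular_ge0 (t : R) x : 0 <= t -> 0 <= rho t x.
Proof.
move=> t0; have T0 : 0 < t + 1 by rewrite ltr_wpDl.
have tT : t \in `[0, t + 1] by rewrite in_itv/= t0 lerDl ler01.
have [[_ [_ + _]]|[_ [+ _ _ _] _]] := regular_cases T0; first exact.
by move=> /(_ t x tT)/ltW.
Qed.

Lemma regular_sound (T : R) : 0 < T -> C_in (@Hk_norm R 3) T (sound_speed A gam rho).
Proof.
move=> /regular_cases[[_ [_ _ [ct [cx [ut [ux [_ _ [? _] _]]]]]]]|[_ [_ ? _ _] _]] //.
Qed.

Let meas := density_measurable A0 gam1 regular_ge0 regular_sound.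
Let bnd := density_bounded A0 gam1 regular_ge0 regular_sound.

Lemma regular_velocity_bounded (T : R) : 0 < T -> exists V : R, 0 < V /\
  {ae leb1, forall t, t \in `[0, T] -> forall i, {ae leb3, forall x, `|u t i x| <= V}}.
Proof.
move=> T0.
suff H i : exists V : R, 0 <= V /\
    {ae leb1, forall t, t \in `[0, T] -> {ae leb3, forall x, `|u t i x| <= V}}.
  have [V HV] := choice H; exists (1 + \sum_i V i); split.
    by rewrite ltr_pwDl// sumr_ge0// => i _; exact: (HV i).1.
  have : {ae leb1, forall t, forall i, t \in `[0, T] ->
      {ae leb3, forall x, `|u t i x| <= V i}}.
    by apply: ae_forall => i; exact: (HV i).2.
  apply: ae_mono => t Ht tT i; apply: ae_mono (Ht i tT) => x /le_trans; apply.
  rewrite (bigD1 i)//= addrCA lerDl addr_ge0// sumr_ge0// => j _; exact: (HV j).1.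
have [[_ [_ _ [ct [cx [ut [ux [_ _ [_ uC] _]]]]]]]|[_ _ [ul _ _ _]]] := regular_cases T0.
  have [M [M0 HM]] := C_in_bounded (uC i).
  by exists M; split; [exact: ltW|exact: aeW].
have [B HB] := Linfty_in_time (ul i).2; have [C [C0 HC]] := sobolev_embedding R.
exists (C * `|B|); split; first by rewrite mulr_ge0.
apply: ae_mono HB => t HB tT; apply: ae_mono (HC _ _ (HB tT)) => x /le_trans; apply.
by rewrite ler_wpM2l// ler_norm.
Qed.

Lemma regular_stress_bound (T : R) : 0 < T -> exists (C : R) (b : R -> \bar R),
  [/\ 0 < C, measurable_fun (setT : set T1) b, forall t, (0 <= b t)%E,
      (\int[leb1]_(t in `[0%R, T]%classic) b t < +oo)%E &
  {ae leb1, forall t, t \in `[0, T] -> exists q : E -> R,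
     [/\ measurable_fun (setT : set T3) q, forall x, 0 <= q x,
      (\int[leb3]_x (q x)%:E <= b t)%E &
      forall i j, {ae leb3, forall x,
        `|eps * stress del alp bet rho u t i j x| <= C * (rho t x + q x)}]}].
Proof.
move=> T0; have [[e0 _]|[_ [rp _ _ _] [_ _ f2 _]]] := regular_cases T0; last first.
  have [K [_ HK]] := bnd T0; have /andP[/ltW d0 _] := del01.
  exact: viscous_stress_bound d0 rp HK f2.
exists 1, (fun=> 0%E); split => //; first by rewrite integral0.
apply: aeW => t; rewrite in_itv/= => /andP[t0 _].
exists (fun=> 0); split => //; first by rewrite integral0.
move=> i j; apply: aeW => x.
by rewrite e0 mul0r normr0 mul1r addr0; exact: regular_ge0.
Qed.

(** In the Euler case the initial velocity is bounded.  In the viscous case it is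
    square integrable with a weight, and [weighted_young] with
    [p = (1 - del) / 2] applies. *)
Lemma regular_momentum_integrable i : leb3.-integrable setT (fun x => (rho0 x * u0 i x)%:E).
Proof.
have T0 : 0 < 1 :> R by [].
have t0 : (0 : R) \in `[0, 1] by rewrite in_itv/= lexx ler01.
have [rE uE _ _] := regular_weak T0.
have mr : measurable_fun (setT : set T3) rho0 by rewrite -rE; exact: meas.
have r0 x : 0 <= rho0 x by rewrite -rE; exact: regular_ge0.
have int_scale (c : R) (g : E -> R) : 0 <= c -> measurable_fun (setT : set T3) g ->
    (forall x, 0 <= g x) -> (\int[leb3]_x (g x)%:E < +oo)%E ->
    (\int[leb3]_x (c * rho0 x + g x)%:E < +oo)%E.
  move=> c0 mg g0 gy; under eq_integral do rewrite EFinD EFinM.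
  rewrite ge0_integralD//; last 4 first.
  - by move=> x _; rewrite mule_ge0// lee_fin.
  - by apply: measurable_funeM; exact/measurable_EFinP.
  - by move=> x _; rewrite lee_fin.
  - exact/measurable_EFinP.
  rewrite ge0_integralZl//; last 2 first.
  - exact/measurable_EFinP.
  - by move=> x _; rewrite lee_fin.
  by apply: lte_add_pinfty => //; rewrite lte_mul_pinfty.
have [[_ [_ _ [ct [cx [ut [ux [_ _ [_ uC] _]]]]]]]|[_ [rp _ _ _] [_ wC _ _]]] := regular_cases T0.
  have u0y := (uC i 0 t0).1; rewrite uE in u0y.
  have mu0 : measurable_fun (setT : set T3) (u0 i).
    exact: cube_integrable_measurable (Hk_norm_lty_cube u0y).
  have [M [M0 HM]] := Hk_norm_ae_bounded u0y.
  refine (@integrable_ae_dominated R _ T3 leb3 (fun x => rho0 x * u0 i x)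
    (fun x => M * rho0 x + 0) _ _ _ _ _).
  - exact: measurable_funM.
  - by apply: measurable_funD => //; apply: measurable_funM.
  - by move=> x; rewrite addr0 mulr_ge0.
  - by apply: int_scale => //; rewrite integral0.
  - by apply: ae_mono HM => x uM; rewrite addr0 normrM (ger0_norm (r0 x)) mulrC ler_wpM2r.
have /andP[d0 d1] := del01.
pose h x := rho0 x `^ ((1 - del) / 2) * u0 i x.
have hy : (Hk_norm 3 h < +oo)%E by have := (wC i 0 t0).1; rewrite rE uE.
have mh : measurable_fun (setT : set T3) h.
  exact: cube_integrable_measurable (Hk_norm_lty_cube hy).
have rp0 x : 0 < rho0 x by rewrite -rE; exact: rp.
have mu0 : measurable_fun (setT : set T3) (u0 i).
  have -> : u0 i = (fun x => rho0 x `^ (- ((1 - del) / 2)) * h x).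
    apply/funext => x; rewrite /h mulrA -powRD ?addNr ?powRr0 ?mul1r//.
    by apply/implyP => _; rewrite gt_eqF.
  apply: measurable_funM => //.
  by apply: (measurableT_comp (measurable_powR _)).
have [K [K0 HK]] := bnd T0.
refine (@integrable_ae_dominated R _ T3 leb3 (fun x => rho0 x * u0 i x)
  (fun x => K `^ del * rho0 x + h x ^+ 2) _ _ _ _ _).
- exact: measurable_funM.
- by apply: measurable_funD; [exact: measurable_funM|exact: measurable_funX].
- by move=> x; rewrite addr_ge0 ?sqr_ge0// mulr_ge0// powR_ge0.
- apply: int_scale; [exact: powR_ge0|exact: measurable_funX|by move=> x; exact: sqr_ge0|].
  have := le_lt_trans (Hk_norm_Lnorm 3 h) hy; rewrite Lnorm2E => /lty_poweRy.
  by apply; rewrite invr_eq0 pnatr_eq0.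
- apply: ae_mono (HK 0 t0) => x; rewrite rE => rK.
  have rK' : 0 < rho0 x <= K by rewrite rp0.
  have := weighted_young ((1 - del) / 2) (u0 i x) rK' (ltW d0).
  have -> : (1 + del) / 2 + (1 - del) / 2 = 1 by field.
  by rewrite powRr1// normrM ger0_norm.
Qed.

End Regular.

Theorem theorem2p3 (R : realType) (A gam del alp bet eps : R)
    (rho0 : space3 R -> R) (u0 : 'I_3 -> space3 R -> R) :
  0 < A -> 1 < gam -> 0 < del < 1 -> 0 < alp -> 0 <= alp + bet -> 0 <= eps ->
  (0 < eps -> far_field_vacuum_data rho0 u0) ->
  (0 < total_mass rho0 < +oo)%E ->
  0 < enorm3 (total_momentum rho0 u0) ->
  ~ exists (rho : R -> space3 R -> R) (u : R -> 'I_3 -> space3 R -> R),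
      global_regular_solution A gam del alp bet eps rho0 u0 rho u /\
      limf_esup (fun t => sup_norm (u t)) (pinfty_nbhs R) = 0%E.
Proof.
move=> A0 gam1 del01 _ _ _ _ /andP[m0 my] P0 [rho [u [reg lim]]].
have [S [S' [CS [[sS sS' dS] S0 S1 S01 [S'C S'0 S'1 CS0]]]]] := smooth_step R.
have [rE _ _ _] := regular_weak reg ltr01.
have ge0 := regular_ge0 reg; have sound := regular_sound reg.
suff PE i : total_momentum rho0 u0 i = 0.
  move: P0; rewrite /enorm3 big1 ?sqrtr0 ?ltxx// => i _.
  by rewrite PE expr0n.
apply: (momentum_vanishes sS sS' dS S0 S1 S01 S'C S'0 S'1 CS0 A0 gam1 ge0
  (density_measurable A0 gam1 ge0 sound) (density_bounded A0 gam1 ge0 sound)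
  (density_continuous A0 gam1 ge0 sound) (regular_velocity_bounded reg)
  (regular_stress_bound A0 gam1 del01 reg) rE
  (regular_momentum_integrable A0 gam1 del01 reg my) _ _ m0 my).
- by move=> T /(regular_weak reg)[].
- by move=> T /(regular_weak reg)[].
- exact: limsup0_ae.
Qed.
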